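(* Let $L$ and $L^*$ be welded-concordant $m$-component virtual links. Then for all sequences $J$ in $\{1,\dots,m\}$ with length $|J|\ge2$, $$\bar\mu_J(L)\equiv\bar\mu_J(L^* )\pmod{\Delta_J}.$$
   Context: Virtual links. An $m$-component virtual link diagram consists of $m$ ordered oriented closed curves generically immersed in the plane, whose double points are marked as classical (over/under) or virtual crossings. Moves: Reidemeister moves; the detour move (an arc containing only virtual crossings may be replaced by any generic arc with the same endpoints all of whose crossings are virtual); the forbidden overpass move (an arc crossing over two strands that meet in a virtual crossing may be moved across that virtual crossing while staying over both strands, i.e. consecutive overcrossings commute); births (adding a disjoint crossing-free circle), deaths (deleting such a circle), saddles (oriented band surgery). Two virtual knots are welded concordant if they are related by a finite connected sequence of these moves with $\#(\text{births})-\#(\text{saddles})+\#(\text{deaths})=0$ (connected: the surface described by the sequence is connected). Two $m$-component virtual links are welded concordant if there is a sequence of such moves restricting to such a concordance on each component. Group and words. Let $L=K_1\cup\dots\cup K_m$ be a diagram. The arcs of $L$ are the paths along $L$ from one undercrossing to the next (virtual crossings ignored; a component without undercrossings is one arc). Let $a_{i,1},\dots,a_{i,n_i}$ be the arcs of $K_i$ in order, second index modulo $n_i$. The group $G(L)$ is generated by the arcs with one relation per undercrossing: $a_{i,j+1}=w_{i,j}^{-1}a_{i,j}w_{i,j}$, $w_{i,j}=o^{\varepsilon}$, where $o$ is the overcrossing arc and $\varepsilon=\pm1$ the sign of the crossing passed when going from $a_{i,j}$ to $a_{i,j+1}$. Put $l_{i,j}=w_{i,1}\cdots w_{i,j}$.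 A meridian-longitude word pair for $K_i$ is $(a_i,\lambda_i)$ with $a_i=a_{i,1}$ and $\lambda_i=l_{i,n_i}a_{i,1}^{k}$, with $k$ chosen so that the total exponent sum in $\lambda_i$ of the letters $a_{i,1},\dots,a_{i,n_i}$ is $0$ ($\lambda_i=1$ if $K_i$ has no undercrossings). Let $F$ be the free group on $a_1,\dots,a_m$. Define homomorphisms $\phi^{(q)}$, $q\ge1$, from the free group on all arcs to $F$ by $\phi^{(1)}(a_{i,j})=a_i$, $\phi^{(q)}(a_{i,1})=a_i$, and $\phi^{(q+1)}(a_{i,j+1})=\phi^{(q)}(l_{i,j})^{-1}a_i\,\phi^{(q)}(l_{i,j})$ for $1\le j\le n_i-1$. Put $\lambda_i^{(q)}=\phi^{(q)}(\lambda_i)$. Invariants. The Magnus expansion $\epsilon:F\to\mathbb Z[[a_1,\dots,a_m]]$ (non-commuting power series) is given by $a_i\mapsto1+a_i$, and $\epsilon_J(f)$ is the coefficient of $a_{j_1}\cdots a_{j_s}$ in $\epsilon(f)$ for $J=j_1\cdots j_s$. For $J$ of length $s\ge1$ and $q>s$, set $\mu_{J|j}(L)=\epsilon_J(\lambda_j^{(q)})$, where $J|j=j_1\cdots j_sj$; this is independent of $q>s$. For a sequence $J$ of length at least 2, $\Delta_J$ is the greatest common divisor of the integers $\mu_{\hat J}(L)$, where $\hat J$ ranges over all sequences (of length at least 2) obtained from $J$ by deleting one or more terms and cyclically permuting the remaining terms ($\Delta_J=0$ if there are none or all are $0$). Then $\bar\mu_J(L)$ is the residue class of $\mu_J(L)$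 modulo $\Delta_J$. In the congruence to be proved $\Delta_J$ is computed from $L$, and the diagrams and meridian-longitude word pairs of $L,L^*$ used to compute $\mu$ are arbitrary. *)

(* Defs.v *)
From HB Require Import structures.
From mathcomp Require Import all_boot all_order all_algebra.
From Stdlib Require Import Relation_Operators.

Set Implicit Arguments.
Unset Strict Implicit.
Unset Printing Implicit Defensive.

Import Order.TTheory GRing.Theory Num.Theory.

(** * Virtual link diagrams

  A diagram is recorded, up to isotopy of the plane, as the 4-valent planar
  map traced by its curves: each oriented closed curve is the cyclic sequence
  of the crossings it traverses (classical and virtual ones alike), and every
  traversal says how it meets the other strand at that crossing.  The relative
  position of disjoint connected pieces of a diagram is not recorded: it can be
  changed at will by detour moves along arcs without crossings. *)

(* [Over s], [Under s]: the two strands of a classical crossing of sign [s]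
   ([true] for +1).  [Virtual b]: a strand of a virtual crossing; the other
   strand crosses it from right to left if [b], from left to right if not. *)
Inductive passage := Over of bool | Under of bool | Virtual of bool.

Definition passage_code (p : passage) : bool + bool + bool :=
  match p with
  | Over s => inl (inl s) | Under s => inl (inr s) | Virtual b => inr b
  end.
Definition passage_decode (x : bool + bool + bool) : passage :=
  match x with
  | inl (inl s) => Over s | inl (inr s) => Under s | inr b => Virtual b
  end.
Lemma passage_codeK : cancel passage_code passage_decode.
Proof. by case. Qed.
HB.instance Definition _ := Countable.copy passage (can_type passage_codeK).

(* A letter is one traversal of a crossing; crossings are named by numbers. *)
Notation letter := (nat * passage)%type.

Definition is_over (l : letter) := if l.2 is Over _ then true else false.
Definition is_under (l : letter) := if l.2 is Under _ then true else false.
Definition is_virtual (l : letter) := if l.2 is Virtual _ then true else false.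

(* the other strand of the same crossing *)
Definition twin (l : letter) : letter :=
  (l.1, match l.2 with
        | Over s => Under s | Under s => Over s | Virtual b => Virtual (~~ b)
        end).

(* Does the other strand leave the crossing on the left of this one?  At a
   positive crossing the frame (over, under) is positive. *)
Definition goes_left (l : letter) : bool :=
  match l.2 with Over s => s | Under s => ~~ s | Virtual b => b end.

(* A finite family of closed curves, each with a name identifying it. *)
Definition diagram := seq (nat * seq letter).

Definition names (D : diagram) : seq nat := [seq c.1 | c <- D].
Definition letters (D : diagram) : seq letter := flatten [seq c.2 | c <- D].

(* Every crossing is traversed exactly twice, by two strands that match. *)
Definition well_formed (D : diagram) : bool :=
  [&& uniq (names D), uniq (letters D),
      all (fun l => twin l \in letters D) (letters D) &
      all2rel (fun l l' : letter => (l.1 == l'.1) ==> (l' \in [:: l; twin l]))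
              (letters D)].

Definition curve_through (D : diagram) (l : letter) : seq letter :=
  let cs := [seq c.2 | c <- D] in nth [::] cs (find (fun c => l \in c) cs).
Definition following (D : diagram) (l : letter) := next (curve_through D l) l.
Definition preceding (D : diagram) (l : letter) := prev (curve_through D l) l.

(* Half-edges: [(l, true)] leaves, [(l, false)] enters the crossing of [l]
   along the strand [l]. *)
Notation dart := (letter * bool)%type.

Definition darts (D : diagram) : seq dart :=
  [seq (l, h) | l <- letters D, h <- [:: true; false]].

(* the other end of the edge *)
Definition edge (D : diagram) (d : dart) : dart :=
  if d.2 then (following D d.1, false) else (preceding D d.1, true).
(* the next half-edge counterclockwise around the crossing *)
Definition turn (d : dart) : dart := (twin d.1, goes_left d.1 == d.2).
(* Walk along the edge, then along the next edge of the face on its right. *)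
Definition face (D : diagram) (d : dart) : dart := turn (edge D d).

Definition num_classes (D : diagram) (e : rel dart) : nat :=
  n_comp [rel x y : seq_sub (darts D) | e (ssval x) (ssval y)] predT.

(* Euler's formula V - E + F = 2C (curves without crossings do not count). *)
Definition planar (D : diagram) : bool :=
  num_classes D (frel turn) + num_classes D (frel (face D)) ==
  num_classes D (frel (edge D)) +
  2 * num_classes D (fun x y => (edge D x == y) || (turn x == y)).

Definition is_diagram (D : diagram) : bool := well_formed D && planar D.

(** * Moves *)

Definition relabel (f : nat -> nat) (l : letter) : letter := (f l.1, l.2).

(* the same diagram: other starting points [r] on the curves, other names [f]
   of the crossings, another enumeration of the curves *)
Definition same_diagram (D D' : diagram) : Prop :=
  exists (f r : nat -> nat), injective f /\
    perm_eq D' [seq (c.1, [seq relabel f l | l <- rot (r c.1) c.2]) | c <- D].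

(* smooth away the crossings in [X], keeping the strands *)
Definition erase (X : seq nat) (D : diagram) : diagram :=
  [seq (c.1, [seq l <- c.2 | l.1 \notin X]) | c <- D].

(* the two traversals joined by the edge of a dart *)
Definition swap_ends (D : diagram) (d : dart) : letter -> letter :=
  let l := d.1 in let l' := (edge D d).1 in
  [eta id with l |-> l', l' |-> l].

(* [d] lies on a triangular face with three distinct crossings. *)
Definition triangle (D : diagram) (d : dart) : Prop :=
  face D (face D (face D d)) = d /\
  uniq [:: d.1.1; (face D d).1.1; (face D (face D d)).1.1].

(* Slide the strand along [d] over the opposite crossing: on each of the three
   strands the two crossings of the triangle get interchanged. *)
Definition slide (D : diagram) (d : dart) : diagram :=
  [seq (c.1, [seq swap_ends D d (swap_ends D (face D d)
                    (swap_ends D (face D (face D d)) l)) | l <- c.2]) | c <- D].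

Definition top_edge (D : diagram) (d : dart) : bool :=
  is_over d.1 && is_over (edge D d).1.

(* Each move in one direction; [step] also uses the inverses.  In [R2] the
   two crossings have opposite signs, and the lower strand may run parallel or
   antiparallel to the upper one. *)
Inductive move : diagram -> diagram -> Prop :=
| Same D D' : same_diagram D D' -> move D D'
| R1 D l : l \in letters D -> ~~ is_virtual l -> following D l = twin l ->
    move D (erase [:: l.1] D)
| R2 D x y s :
    (x, Over s) \in letters D -> (y, Over (~~ s)) \in letters D ->
    following D (x, Over s) = (y, Over (~~ s)) ->
    following D (x, Under s) = (y, Under (~~ s)) \/
    following D (y, Under (~~ s)) = (x, Under s) ->
    move D (erase [:: x; y] D)
| R3 D d : triangle D d -> top_edge D d ->
    ~~ is_virtual (face D (face D d)).1 -> move D (slide D d)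
| Overpass D d : triangle D d -> top_edge D d ->
    is_virtual (face D (face D d)).1 -> move D (slide D d)
| Detour k (v v' u u' : seq letter) (R R' : diagram) :
    all is_virtual v -> all is_virtual v' ->
    erase [seq l.1 | l <- v] ((k, u) :: R) =
      erase [seq l.1 | l <- v'] ((k, u') :: R') ->
    move ((k, v ++ u) :: R) ((k, v' ++ u') :: R').

(** * Concordance

  A movie is a sequence of diagrams.  A curve keeps its name as long as it only
  undergoes [Still] steps and saddles [Split k k'] (where [k] splits into [k]
  and [k']) or [Merge k k'] (where [k'] is absorbed by [k]); a name is never
  used again once it has disappeared.  So names stand for sheets of the surface
  described by the movie, and saddles are the bands which join them. *)

Inductive event :=
| Still
| Birth of nat
| Death of nat
| Split of nat & nat
| Merge of nat & nat.

Definition event_names (e : event) : seq nat :=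
  match e with
  | Still => [::] | Birth k | Death k => [:: k]
  | Split k k' | Merge k k' => [:: k; k']
  end.

(* Saddles: since both diagrams are planar, the two arcs involved automatically
   lie in antiparallel directions on the boundary of a common face, possibly
   after moving disjoint pieces of the diagram. *)
Inductive step (used : seq nat) : event -> diagram -> diagram -> Prop :=
| StepMove D D' : move D D' \/ move D' D -> step used Still D D'
| StepBirth k D : k \notin used -> step used (Birth k) D ((k, [::]) :: D)
| StepDeath k D : step used (Death k) ((k, [::]) :: D) D
| StepSplit k k' u v R : k' \notin used ->
    step used (Split k k') ((k, u ++ v) :: R) ((k, u) :: (k', v) :: R)
| StepMerge k k' u v R :
    step used (Merge k k') ((k, u) :: (k', v) :: R) ((k, u ++ v) :: R).

Definition used_names (D : diagram) (es : seq event) : seq nat :=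
  names D ++ flatten [seq event_names e | e <- es].

Inductive movie (D0 : diagram) : seq event -> diagram -> Prop :=
| MovieStart : movie D0 [::] D0
| MovieStep es D e D' :
    movie D0 es D -> is_diagram D' -> step (used_names D0 es) e D D' ->
    movie D0 (rcons es e) D'.

Definition joins (k k' : nat) (e : event) : bool :=
  match e with
  | Split a b | Merge a b => (a == k) && (b == k')
  | _ => false
  end.

Definition same_sheet (es : seq event) : nat -> nat -> Prop :=
  clos_refl_sym_trans nat (fun k k' => has (joins k k') es).

(* [c k] is the component of the surface containing the sheet [k]. *)
Definition births (c : nat -> nat) (i : nat) (es : seq event) : nat :=
  count (fun e => if e is Birth k then c k == i else false) es.
Definition deaths (c : nat -> nat) (i : nat) (es : seq event) : nat :=
  count (fun e => if e is Death k then c k == i else false) es.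
Definition saddles (c : nat -> nat) (i : nat) (es : seq event) : nat :=
  count (fun e => match e with Split k _ | Merge k _ => c k == i
                             | _ => false end) es.

Definition name_curves (m : nat) (rho : 'I_m -> nat)
  (K : 'I_m -> seq letter) : diagram := [seq (rho i, K i) | i <- enum 'I_m].

Record link_diagram (m : nat) := LinkDiagram {
  curve :> 'I_m -> seq letter;
  link_diagramP : is_diagram (name_curves (@nat_of_ord m) curve)
}.

(* The surface has [m] connected components; the [i]-th one is bounded by the
   [i]-th curves of [L] and [L'] and has Euler characteristic 0. *)
Definition welded_concordant (m : nat) (L L' : link_diagram m) : Prop :=
  let D0 := name_curves (@nat_of_ord m) L in
  exists (es : seq event) (rho : 'I_m -> nat) (c : nat -> nat),
  [/\ movie D0 es (name_curves rho L'),
      forall k k', has (joins k k') es -> c k = c k',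
      forall i : 'I_m, c i = i /\ c (rho i) = i,
      forall k, k \in used_names D0 es -> c k < m /\ same_sheet es k (c k) &
      forall i : 'I_m,
        ((births c i es)%:Z - (saddles c i es)%:Z + (deaths c i es)%:Z = 0)%R].

(** * Words and longitudes

  Elements of free groups are given by (not necessarily reduced) words, a pair
  [(x, b)] standing for the generator [x] if [b] and for its inverse if not. *)

Definition word (T : Type) := seq (T * bool).

Definition winv (T : Type) (w : word T) : word T :=
  rev [seq (g.1, ~~ g.2) | g <- w].

Definition whom (T U : Type) (f : T -> word U) (w : word T) : word U :=
  flatten [seq if g.2 then f g.1 else winv (f g.1) | g <- w].

Definition wpow (T : Type) (x : T) (k : int) : word T :=
  nseq `|k|%N (x, (0 <= k)%R).

Section Longitudes.

(* [r i] chooses the starting point on the [i]-th curve, hence its first arc. *)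
Variables (m : nat) (L : link_diagram m) (r : 'I_m -> nat).

Definition based_curve (i : 'I_m) : seq letter := rot (r i) (L i).
Definition unders (i : 'I_m) : seq letter :=
  [seq l <- based_curve i | is_under l].

(* [(i, j)] is the arc a_{i,j+1}, with j taken modulo n_i. *)
Notation arc := ('I_m * nat)%type.

(* The arc containing the overcrossing [l] ([None] if there is no such [l]);
   note [x %% 0 = x]. *)
Definition arc_over (l : letter) : option arc :=
  omap (fun i : 'I_m =>
          let B := based_curve i in
          (i, count is_under (take (index l B) B) %% size (unders i)))
       [pick i : 'I_m | l \in based_curve i].

(* the word w_{i,j} contributed by an undercrossing *)
Definition under_word (l : letter) : word arc :=
  match l.2, arc_over (twin l) with
  | Under s, Some a => [:: (a, s)]
  | _, _ => [::]
  end.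

(* l_{i,j} *)
Definition partial_longitude (i : 'I_m) (j : nat) : word arc :=
  flatten [seq under_word l | l <- take j (unders i)].

(* total exponent of the arcs of the [i]-th curve *)
Definition exponent_sum (i : 'I_m) (w : word arc) : int :=
  (\sum_(g <- w | g.1.1 == i) (if g.2 then 1 else -1))%R.

Definition longitude (i : 'I_m) : word arc :=
  let l := partial_longitude i (size (unders i)) in
  l ++ wpow (i, 0) (- exponent_sum i l)%R.

(* [phi n] is phi^(n+1) on arcs; for [a.2 = 0] the conjugating word is empty. *)
Fixpoint phi (n : nat) (a : arc) : word 'I_m :=
  if n is n'.+1 then
    let l := whom (phi n') (partial_longitude a.1 a.2) in
    winv l ++ (a.1, true) :: l
  else [:: (a.1, true)].

End Longitudes.

(** * Magnus expansion and Milnor numbers *)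

(* Power series in non-commuting variables, as functions of the monomial. *)
Definition series (m : nat) := seq 'I_m -> int.

Definition series1 (m : nat) : series m := fun J => (J == [::])%:R%R.
Definition series_mul (m : nat) (f g : series m) : series m :=
  fun J => (\sum_(k < (size J).+1) f (take k J) * g (drop k J))%R.

(* 1 + a_i, and its inverse 1 - a_i + a_i^2 - ... *)
Definition magnus_gen (m : nat) (g : 'I_m * bool) : series m :=
  fun J => if g.2 then ((J == [::]) || (J == [:: g.1]))%:R%R
           else if all (pred1 g.1) J then ((-1) ^+ size J)%R else 0%R.

Definition magnus (m : nat) (w : word 'I_m) : series m :=
  foldr (fun g f => series_mul (magnus_gen g) f) (@series1 m) w.

(* For K = J|j with J of length s >= 1: the coefficient of J in the Magnus
   expansion of phi^(q)(lambda_j), with q = s + 1. *)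
Definition mu (m : nat) (L : link_diagram m) (r : 'I_m -> nat)
  (K : seq 'I_m) : int :=
  if K is x :: t then
    magnus (whom (phi L r (size t)) (longitude L r (last x t))) (belast x t)
  else 0%R.

(* The gcd over all choices [b] of the terms to keep (at least two, but not
   all of them) and all rotations. *)
Definition Delta (m : nat) (L : link_diagram m) (r : 'I_m -> nat)
  (J : seq 'I_m) : int :=
  \big[gcdz/0%R]_(b : (size J).-tuple bool | 1 < count id b < size J)
    \big[gcdz/0%R]_(k < count id b) mu L r (rot k (mask b J)).

(* Main.v *)
From HB Require Import structures.
From mathcomp Require Import all_boot all_order all_algebra.
From mathcomp Require Import ring zify.
From Stdlib Require Import Relation_Operators.
Require Import Defs.

Set Implicit Arguments.
Unset Strict Implicit.
Unset Printing Implicit Defensive.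

Import Order.TTheory GRing.Theory Num.Theory.

(** Write J|j for the index sequence, n for the length of J and Delta for the gcd
    attached to J|j.  Invariance is read off from colourings of diagrams by
    unitriangular integer matrices of size n + 1, where the [d]-th layer consists
    of the matrices congruent to 1 modulo Delta on the first [d] diagonals; this
    is a central series ([unitri_filtration]).

    Send a_i to the matrix [magnus_rep i] with an entry 1 above the diagonal
    wherever the letter i stands in J.  The image of a word then has as entries
    the Magnus coefficients of the subwords of J ([magnus_repE]), so that the
    Milnor number of J|j is the upper right entry of the image of the j-th
    longitude.  Divisibility of the shorter Milnor numbers by Delta says that
    this image is trivial except for its corner ([longitude_layer]) and, because
    cyclic permutations are allowed in Delta, that the images of the meridians
    commute modulo Delta with those of their longitudes ([longitude_commutes]).
    These are the relations needed to colour the whole diagram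
    ([valid_of_longitudes]).

    The arcs of the j-th component are not coloured by their meridians but by
    states [g], standing for the meridian [A ^ g] with [A] the image of a_j.
    Running once around the component multiplies the state by its twist, which
    is the value of the longitude ([twist_longitude]).  The other components
    carry their meridians.  Every move carries colourings to colourings with the
    same twists ([transportable_move]); the overpass move is harmless because
    undercrossings only read the colour of the overcrossing arc, and consecutive
    overcrossings have the same one.

    It remains to get across the saddles.  Each component of a concordance is
    connected of Euler characteristic 0, so its sheets, joined by its saddles,
    form a tree ([concordance_forest]).  The colouring is improved by one layer
    at a time.  Modulo the next layer twists are central, their sum is conserved,
    and a saddle merely moves twist from one sheet to another.  Since each
    saddle separates its tree, no twist can flow through it as long as the
    curves at the start have none ([climb_step]); and since trees have no cycles,
    the base colours of the sheets can be adjusted to agree where sheets merge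
    ([forest_solution]).  At the last layer the twist of the j-th component is the
    same at both ends ([evolution_transfer]), while the meridians found at the
    other end are conjugate to the original ones.

    A conjugate of [magnus_rep i] has the same entries next to the main diagonal
    ([conjugate_near]), and an entry further up vanishes unless i occurs in the
    corresponding subword of J ([conjugate_far]).  Hence the corner
    entry obtained from the second link differs from its Milnor number only by a
    combination of its Milnor numbers for proper subsequences of J
    ([corner_entry]), which Delta divides by induction on the length of J. *)

(** * Filtrations with central quotients *)

Section Filtrations.
Local Open Scope group_scope.

Record filtration (N : groupType) := Filtration {
  layer :> nat -> N -> Prop;
  layer0 x : layer 0 x;
  layer1 d : layer d 1;
  layerM d x y : layer d x -> layer d y -> layer d (x * y);
  layerV d x : layer d x -> layer d x^-1;
  layerW d x : layer d.+1 x -> layer d x;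
  layerR d x y : layer d x -> layer d.+1 [~ x, y]
}.

Section Congruence.
Variables (N : groupType) (K : filtration N).
Implicit Types (d : nat) (x y z : N).

Definition eqm d x y := K d (x^-1 * y).

Lemma layerJ d x y : K d x -> K d (x ^ y).
Proof.
move=> Kx; rewrite -[x ^ y](mulVKg x) -commgEl.
by apply: layerM => //; apply/layerW/layerR.
Qed.

Lemma eqm_refl d x : eqm d x x.
Proof. by rewrite /eqm mulVg; apply: layer1. Qed.
Hint Resolve eqm_refl : core.

Lemma eqm_sym d x y : eqm d x y -> eqm d y x.
Proof. by move/layerV; rewrite invgM invgK. Qed.

Lemma eqm_trans d x y z : eqm d x y -> eqm d y z -> eqm d x z.
Proof. by move=> xy /(layerM xy); rewrite -mulgA mulVKg. Qed.

Lemma eqmW d x y : eqm d.+1 x y -> eqm d x y.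
Proof. exact: layerW. Qed.

Lemma eqm_le d d' x y : d <= d' -> eqm d' x y -> eqm d x y.
Proof.
move=> /subnKC <-; elim: (d' - d)%N => [|n IH]; first by rewrite addn0.
by rewrite addnS => /eqmW.
Qed.

Lemma eqmMl d z x y : eqm d x y -> eqm d (z * x) (z * y).
Proof. by rewrite /eqm invgM -mulgA mulKg. Qed.

Lemma eqmMr d z x y : eqm d x y -> eqm d (x * z) (y * z).
Proof. by move/(layerJ z); rewrite /eqm invgM conjgE !mulgA. Qed.

Lemma eqmM d x x' y y' : eqm d x x' -> eqm d y y' -> eqm d (x * y) (x' * y').
Proof. by move=> /(eqmMr y) xx' /(eqmMl x'); apply: eqm_trans. Qed.

Lemma eqmV d x y : eqm d x y -> eqm d x^-1 y^-1.
Proof.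
move/(eqmMl x^-1)/(eqmMr y^-1); rewrite mulgK mulVg mul1g; exact: eqm_sym.
Qed.

Lemma eqmJ d x x' y y' : eqm d x x' -> eqm d y y' -> eqm d (x ^ y) (x' ^ y').
Proof. by move=> xx' yy'; exact: (eqmM (eqmV yy') (eqmM xx' yy')). Qed.

(** The layers form a central series, so a factor from layer [d] can be moved
    around freely as long as only the next layer is neglected. *)
Lemma eqm_central d x s : K d s -> eqm d.+1 (s * x) (x * s).
Proof.
move=> Ks; apply: eqm_sym; rewrite /eqm invgM -mulgA; exact: layerR.
Qed.

Lemma eqm_conj_layer d x s : K d s -> eqm d.+1 x (x ^ s).
Proof.
move=> Ks; rewrite /eqm -commgEl -invgR.
by apply/layerV/layerR.
Qed.

Lemma eqm_conj_central d x s : K d s -> eqm d.+1 s (s ^ x).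
Proof. by move=> Ks; rewrite /eqm -commgEl; apply: layerR. Qed.

Lemma eqmJr d x y y' : eqm d y y' -> eqm d.+1 (x ^ y) (x ^ y').
Proof.
move=> yy'; rewrite -[y'](mulVKg y) conjgM; exact: eqm_conj_layer.
Qed.

End Congruence.

End Filtrations.
#[global] Hint Resolve eqm_refl : core.

(** * The saddles of a concordance form a forest *)

Section Forests.
Implicit Types (E : seq (nat * nat)) (x y : nat).

(** Union-find: two vertices have the same representative exactly when the edges
    of [E] connect them. *)
Fixpoint root E x : nat :=
  if E is (p, q) :: E' then
    if root E' x == root E' q then root E' p else root E' x
  else x.

(** Representatives are reached along edges, so whatever is constant along edges
    does not see the difference. *)
Lemma root_inv (T : Type) (F : nat -> T) E x :
  (forall p, p \in E -> F p.1 = F p.2) -> F (root E x) = F x.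
Proof.
elim: E x => //= -[p q] E IH x H.
have HE r : r \in E -> F r.1 = F r.2 by move=> Er; apply: H; rewrite inE Er orbT.
case: eqP => [Ex|_]; last exact: IH.
rewrite (IH p HE) (H (p, q) (mem_head _ _)) /= -(IH q HE) -Ex; exact: IH.
Qed.

Lemma root_fine (T : Type) (F : nat -> T) E x y :
  (forall p, p \in E -> F p.1 = F p.2) -> root E x = root E y -> F x = F y.
Proof. by move=> H Exy; rewrite -(root_inv x H) -(root_inv y H) Exy. Qed.

Lemma root_edge E p : p \in E -> root E p.1 = root E p.2.
Proof.
elim: E => //= -[p1 q1] E IH; rewrite inE => /predU1P[->|/IH Ep] /=.
  by rewrite eqxx; case: eqP.
by rewrite Ep.
Qed.

(** Each edge lowers the number of classes by one at most. *)
Lemma classes_bound E (V : seq nat) :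
  size (undup V) <= size (undup (map (root E) V)) + size E.
Proof.
elim: E => [|[p q] E IH]; first by rewrite addn0 map_id_in.
apply: leq_trans IH _; rewrite /= addnS -addSn leq_add2r.
set W := map (root E) V; set W' := map _ V.
have sub : {subset undup W <= root E q :: undup W'}.
  move=> y; rewrite mem_undup => /mapP[x Vx ->]; rewrite inE mem_undup.
  case: eqP => //= nq; apply/mapP; exists x => //=.
  by case: eqP.
exact: uniq_leq_size (undup_uniq _) sub.
Qed.

(** Stated without paths: removing any edge disconnects its ends. *)
Definition forest E : Prop := forall E1 p q E2, E = E1 ++ (p, q) :: E2 ->
  root (E1 ++ E2) p != root (E1 ++ E2) q.

Lemma forest_tail p E : forest (p :: E) -> forest E.
Proof.
move=> fE E1 p1 q1 E2 EE; have := fE (p :: E1) p1 q1 E2.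
rewrite EE => /(_ erefl); apply: contraNneq => Er.
apply/eqP; apply: (root_fine (E := E1 ++ E2)) Er => r Er.
by apply: root_edge; rewrite /= inE Er orbT.
Qed.

(** A connected graph with one vertex more than edges per component is a
    forest: dropping a redundant edge would leave too few edges to connect the
    vertices. *)
Lemma forest_of_count E (V : seq nat) m (c : nat -> nat) :
  (forall x, x \in V -> c x < m) ->
  (forall (F : nat -> nat) x, (forall p, p \in E -> F p.1 = F p.2) ->
     x \in V -> F x = F (c x)) ->
  m + size E <= size (undup V) -> forest E.
Proof.
move=> cm conn count E1 p q E2 EE; apply/negP => /eqP Er.
have HF r : r \in E -> root (E1 ++ E2) r.1 = root (E1 ++ E2) r.2.
  rewrite EE mem_cat inE => /or3P[r1|/eqP->|r2] //=.
    by apply: root_edge; rewrite mem_cat r1.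
  by apply: root_edge; rewrite mem_cat r2 orbT.
have sub : {subset undup (map (root (E1 ++ E2)) V) <= map (root (E1 ++ E2)) (iota 0 m)}.
  move=> y; rewrite mem_undup => /mapP[x Vx ->]; rewrite (conn _ _ HF Vx).
  by apply: map_f; rewrite mem_iota add0n; apply: cm.
have := uniq_leq_size (undup_uniq _) sub; rewrite size_map size_iota.
have := classes_bound (E1 ++ E2) V; move: count.
rewrite EE !size_cat /=; lia.
Qed.

End Forests.

Section Counting.
Implicit Types (es : seq event) (D : diagram).

Definition saddle_list (es : seq event) : seq (nat * nat) :=
  pmap (fun ev => match ev with
        | Split k k' | Merge k k' => Some (k, k') | _ => None end) es.

Lemma saddle_list_rcons es ev : saddle_list (rcons es ev) = saddle_list es ++
  match ev with Split k k' | Merge k k' => [:: (k, k')] | _ => [::] end.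
Proof. by rewrite /saddle_list -cats1 pmap_cat; case: ev. Qed.

Lemma used_rcons D es ev :
  used_names D (rcons es ev) = used_names D es ++ event_names ev.
Proof. by rewrite /used_names map_rcons -cats1 flatten_cat /= cats0 catA. Qed.

Definition num_births es := count (fun e => if e is Birth _ then true else false) es.
Definition num_deaths es := count (fun e => if e is Death _ then true else false) es.
Definition num_splits es := count (fun e => if e is Split _ _ then true else false) es.
Definition num_merges es := count (fun e => if e is Merge _ _ then true else false) es.

Lemma undup_size_old (s : seq nat) t : {subset t <= s} ->
  size (undup (s ++ t)) = size (undup s).
Proof.
move=> ts; apply/perm_size/uniq_perm; rewrite ?undup_uniq // => x.
by rewrite !mem_undup mem_cat; case sx: (x \in s) => //=; apply: contraFF sx => /ts.
Qed.

Lemma undup_size_new (s t : seq nat) k : k \notin s -> {subset t <= s} ->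
  size (undup (s ++ rcons t k)) = (size (undup s)).+1.
Proof.
move=> nk ts; rewrite -[RHS]/(size (k :: undup s)).
apply/perm_size/uniq_perm; rewrite /= ?undup_uniq ?mem_undup ?nk // => x.
rewrite inE !mem_undup mem_cat mem_rcons inE.
by case: (x == k); case sx: (x \in s) => //=; rewrite ?orbT //; apply: contraFF sx => /ts.
Qed.

Lemma saddle_list_size es : size (saddle_list es) = num_splits es + num_merges es.
Proof. by elim: es => //= -[|k|k|k k'|k k'] es /= ->; rewrite /num_splits /num_merges /=; lia. Qed.

Lemma move_names D D' : move D D' -> perm_eq (names D) (names D').
Proof.
case=> {D D'} //=.
- move=> D D' [f [r [_ /(perm_map fst)]]]; rewrite -map_comp perm_sym.
  by rewrite (@eq_map _ _ _ fst).
- by move=> D l *; rewrite /names -map_comp; apply/permP => ?; congr count; apply: eq_map.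
- by move=> D *; rewrite /names -map_comp; apply/permP => ?; congr count; apply: eq_map.
- by move=> D *; rewrite /names -map_comp; apply/permP => ?; congr count; apply: eq_map.
- by move=> D *; rewrite /names -map_comp; apply/permP => ?; congr count; apply: eq_map.
- move=> k v v' u u' R R' _ _ /(congr1 names) /=.
  rewrite /names /erase /= -!map_comp.
  rewrite (@eq_map _ _ (fst \o _) fst) // [X in _ = _ :: X](@eq_map _ _ (fst \o _) fst) //.
  by case=> ->.
Qed.

(** Only births and splits introduce a name, and it is new each time; so the sheets
    are counted by the initial curves, the births and the splits. *)
Lemma movie_counts D0 es D : uniq (names D0) -> movie D0 es D ->
  [/\ {subset names D <= used_names D0 es},
      size (names D) + num_deaths es + num_merges es =
        size (names D0) + num_births es + num_splits es &
      size (undup (used_names D0 es)) =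
        size (names D0) + num_births es + num_splits es].
Proof.
move=> uD0; elim=> {es D}.
  split=> [k Dk||]; rewrite /used_names ?mem_cat ?Dk //= cats0.
  by rewrite undup_id // !addn0.
move=> es D ev D' mv [sD nD uE] _; rewrite used_rcons.
have cnt (a : pred event) : count a (rcons es ev) = count a es + a ev.
  by rewrite -cats1 count_cat /= addn0.
rewrite /num_births /num_deaths /num_splits /num_merges !cnt.
rewrite -!/(num_births _) -!/(num_deaths _) -!/(num_splits _) -!/(num_merges _).
move=> st; case: st sD nD uE => {ev D D' mv cnt} /=.
- move=> D D' mv sD nD uE; rewrite cats0 !addn0.
  have pD : perm_eq (names D) (names D').
    by case: mv => /move_names // ; rewrite perm_sym.
  by split=> //; [move=> k; rewrite -(perm_mem pD); apply: sD | rewrite -(perm_size pD)].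
- move=> k D nk sD nD uE; split=> [k1||].
  + by rewrite inE mem_cat inE => /orP[->|/sD->] //; rewrite orbT.
  + by move: nD; rewrite /names /=; lia.
  + by rewrite (@undup_size_new _ [::]) // uE; lia.
- move=> k D sD nD uE; split=> [k1 Dk1||].
  + by rewrite mem_cat sD // inE Dk1 orbT.
  + by move: nD; rewrite /names /=; lia.
  + rewrite undup_size_old //; last by move=> k1; rewrite inE => /eqP->; apply/sD/mem_head.
    by rewrite uE; lia.
- move=> k k' u v R nk' sD nD uE; split=> [k1||].
  + rewrite !inE mem_cat !inE => /or3P[->|->|k1R]; rewrite ?orbT //.
    by rewrite sD // inE k1R orbT.
  + by move: nD; rewrite /names /=; lia.
  + rewrite (@undup_size_new _ [:: k]) //; first by rewrite uE; lia.
    by move=> k1; rewrite inE => /eqP->; apply/sD/mem_head.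
- move=> k k' u v R sD nD uE; split=> [k1||].
  + rewrite inE mem_cat => /orP[k1k|k1R]; first by rewrite sD // inE k1k.
    by rewrite sD // !inE k1R !orbT.
  + by move: nD; rewrite /names /=; lia.
  + rewrite undup_size_old; first by rewrite uE; lia.
    by move=> k1; rewrite !inE => /orP[]/eqP->; apply: sD; rewrite !inE eqxx ?orbT.
Qed.

Lemma euler_count (m : nat) (c : nat -> nat) es :
  (forall k, k \in flatten [seq event_names e | e <- es] -> c k < m) ->
  [/\ \sum_(i < m) births c i es = num_births es,
      \sum_(i < m) deaths c i es = num_deaths es &
      \sum_(i < m) saddles c i es = num_splits es + num_merges es].
Proof.
have one k : c k < m -> \sum_(i < m) (c k == i) = 1.
  move=> ck; rewrite (bigD1 (Ordinal ck)) //= eqxx big1 // => i.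
  by rewrite -val_eqE /= eq_sym => /negPf->.
elim: es => [|e es IH] cm.
  by split; rewrite big1.
have [|Hb Hd Hs] := IH; first by move=> k esk; apply: cm; rewrite /= mem_cat esk orbT.
rewrite /births /deaths /saddles /num_births /num_deaths /num_splits /num_merges /=.
rewrite -!/(num_births _) -!/(num_deaths _) -!/(num_splits _) -!/(num_merges _).
rewrite !big_split /= -!/(births _ _ _) -!/(deaths _ _ _) -!/(saddles _ _ _) Hb Hd Hs.
case: e cm => [|k|k|k k'|k k'] cm; rewrite ?big1_eq ?add0n //;
  (rewrite one; last by apply: cm; rewrite /= ?inE eqxx);
  by split=> //; lia.
Qed.

End Counting.

(** * Colourings of diagrams *)

Section Colorings.
Local Open Scope group_scope.

Definition gpow (N : groupType) (x : N) (s : bool) : N := if s then x else x^-1.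

(** The crossing [c] stores in [over c] the colour of its upper strand, with a mark
    for the strands of the distinguished component; [base k] is the state at the
    starting point of the curve [k].  All other colours are computed from these. *)
Record coloring (N : groupType) := Coloring {
  over : nat -> N * bool;
  base : nat -> N
}.

Variables (N : groupType) (K : filtration N) (A : N) (ty : nat -> bool).
Implicit Types (e k : nat) (t : bool) (x y : N) (l : letter).
Implicit Types (w u v : seq letter).
Implicit Types (o : nat -> N * bool) (D X Y : diagram) (chi : coloring N).

(** What an undercrossing does to the state [x].  In the distinguished component
    ([t] true) the state [x] stands for the meridian [A ^ x], and each passage under
    that component itself is compensated by a factor [A]: it leaves the meridian
    alone and normalises the framing, so that the total is the longitude with
    exponent sum 0, and a curl changes nothing. *)
Definition pass o t x l : N :=
  match l.2 with
  | Under s => let p := o l.1 in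
      if t then (if p.2 then gpow A (~~ s) else 1) * x * gpow p.1 s
      else x ^ gpow p.1 s
  | _ => x
  end.

Definition run o t x w : N := foldl (pass o t) x w.

Definition meridian t x : N := if t then A ^ x else x.

(** States of the distinguished component are known to one layer less than
    meridians: this is what [A ^ x] modulo layer [e.+1] requires of [x]. *)
Definition level t e : nat := if t then e else e.+1.

Fixpoint overs_fit e o t x w : Prop :=
  if w is l :: w' then
    (if l.2 is Over _ then (o l.1).2 = t /\ eqm K e.+1 (meridian t x) (o l.1).1
     else True) /\ overs_fit e o t (pass o t x l) w'
  else True.

Definition fits e chi k w : Prop :=
  overs_fit e (over chi) (ty k) (base chi k) w /\
  eqm K (level (ty k) e) (base chi k) (run (over chi) (ty k) (base chi k) w).

(** At precision [e], every overcrossing shows the meridian of its arc and every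
    curve closes up. *)
Definition valid e D chi : Prop := forall k w, (k, w) \in D -> fits e chi k w.

(** The holonomy of a curve.  For a valid colouring it lies in the layer
    [level (ty k) e], and only its class modulo the next layer is meaningful. *)
Definition twist chi k w : N :=
  (base chi k)^-1 * run (over chi) (ty k) (base chi k) w.

Definition eqo e o o' : Prop :=
  forall c, (o c).2 = (o' c).2 /\ eqm K e.+1 (o c).1 (o' c).1.

(** Two colourings that differ by the central factors [s] on the curves. *)
Definition shifted e (s : nat -> N) chi chi' : Prop :=
  eqo e (over chi) (over chi') /\
  forall k, eqm K (level (ty k) e).+1 (base chi' k) (base chi k * s k).

Lemma eqm_gpow d x y s : eqm K d x y -> eqm K d (gpow x s) (gpow y s).
Proof. by case: s => //=; apply: eqmV. Qed.

Lemma gpowN x s : gpow x (~~ s) = (gpow x s)^-1.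
Proof. by case: s; rewrite /= ?invgK. Qed.

Lemma gpowJ x y s : gpow (x ^ y) s = gpow x s ^ y.
Proof. by case: s; rewrite /= ?conjVg. Qed.

Lemma meridian_eqm e t x y :
  eqm K (level t e) x y -> eqm K e.+1 (meridian t x) (meridian t y).
Proof. by case: t => //= /eqmJr; apply. Qed.

Lemma pass_eqm e o o' t x x' l : eqo e o o' -> eqm K (level t e) x x' ->
  eqm K (level t e) (pass o t x l) (pass o' t x' l).
Proof.
move=> oo' xx'; rewrite /pass; case: l.2 => // s.
have [<- cc'] := oo' l.1; case: t xx' => /= xx'.
  by apply: eqmM; [apply: eqmMl | apply/eqm_gpow/eqmW].
by apply: eqmJ => //; apply: eqm_gpow.
Qed.

Lemma run_eqm e o o' t x x' w : eqo e o o' -> eqm K (level t e) x x' ->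
  eqm K (level t e) (run o t x w) (run o' t x' w).
Proof. by move=> oo'; elim: w x x' => //= l w IH x x' /(pass_eqm l oo')/IH. Qed.

Lemma pass_shift e o o' t x x' s l : eqo e o o' -> K (level t e) s ->
  eqm K (level t e).+1 x' (x * s) ->
  eqm K (level t e).+1 (pass o' t x' l) (pass o t x l * s).
Proof.
move=> oo' Ks xx'; rewrite /pass; case: l.2 => // b.
have [<- cc'] := oo' l.1; case: t Ks xx' => /= Ks xx'.
  have {}cc' := eqm_sym (eqm_gpow b cc').
  apply: eqm_trans (eqmM (eqmMl _ xx') cc') _.
  by rewrite !mulgA -!(mulgA (_ * x)); apply/eqmMl/eqm_central.
have {}cc' := eqm_sym (eqm_gpow b cc').
apply: eqm_trans (eqmJr x' cc') _.
apply: eqm_trans (eqmJ xx' (eqm_refl _ _ _)) _.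
by rewrite conjMg; apply/eqmMl/eqm_sym/eqm_conj_central.
Qed.

(** The colours of the overcrossing arcs matter modulo one layer less than the
    state: they act by conjugation, or in the coset case they are one layer
    better known.  So changing the start by a central factor changes every later
    state by the same factor. *)
Lemma run_shift e o o' t x x' s w : eqo e o o' -> K (level t e) s ->
  eqm K (level t e).+1 x' (x * s) ->
  eqm K (level t e).+1 (run o' t x' w) (run o t x w * s).
Proof.
move=> oo' Ks; elim: w x x' => //= l w IH x x' /(pass_shift l oo' Ks).
exact: IH.
Qed.

Lemma run_cat o t x u v : run o t x (u ++ v) = run o t (run o t x u) v.
Proof. by rewrite /run foldl_cat. Qed.

Lemma run_over e o o' t x w : eqo e o o' ->
  eqm K (level t e).+1 (run o t x w) (run o' t x w).
Proof.
move=> oo'.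
rewrite -[run o t x w]mulg1; apply/eqm_sym/run_shift => //; first exact: layer1.
by rewrite mulg1.
Qed.

Lemma overs_fit_cat e o t x u v : overs_fit e o t x (u ++ v) <->
  overs_fit e o t x u /\ overs_fit e o t (run o t x u) v.
Proof.
elim: u x => [|l u IH] x /=; first by split=> [|[]].
have [IH1 IH2] := IH (pass o t x l).
by split=> [[lP /IH1[]]|[[lP uP] vP]] //; split=> //; apply: IH2.
Qed.

Lemma overs_fit_eqm e o o' t x x' w : eqo e o o' -> eqm K (level t e) x x' ->
  overs_fit e o t x w -> overs_fit e o' t x' w.
Proof.
move=> oo'; elim: w x x' => //= l w IH x x' xx' [lP wP]; split; last first.
  by apply: IH wP; apply: pass_eqm.
case: l.2 lP => // _ [lt lP]; have [tt' cc'] := oo' l.1.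
split; first by rewrite -tt'.
apply: eqm_trans cc'; apply: eqm_trans lP.
exact/eqm_sym/meridian_eqm.
Qed.

(** * Transporting colourings *)

(** What a move must provide to be used anywhere in a movie.  [tr_shift] makes it
    compatible with the later correction of base colours by central factors, and
    [tr_twist] makes twists an invariant.  Colourings are mapped by one function
    for all precisions, so that lifts of a colouring stay comparable. *)
Record transports (F : coloring N -> coloring N) D D' : Prop := Transports {
  tr_names : perm_eq (names D) (names D');
  tr_valid e chi : valid e D chi -> valid e D' (F chi);
  tr_shift e s chi chi' : valid e D chi -> valid e D chi' ->
    (forall k, K (level (ty k) e) (s k)) ->
    shifted e s chi chi' -> shifted e s (F chi) (F chi');
  tr_twist e chi k w w' : valid e D chi -> (k, w) \in D -> (k, w') \in D' ->
    eqm K (level (ty k) e).+1 (twist chi k w) (twist (F chi) k w');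
  tr_conj chi k : ty k = false -> exists g, base (F chi) k = base chi k ^ g
}.

Definition transportable D D' := exists F, transports F D D'.

Lemma names_mem D k : k \in names D -> exists w, (k, w) \in D.
Proof. by case/mapP=> [[k' w] Dw /= ->]; exists w. Qed.

Lemma mem_names D k w : (k, w) \in D -> k \in names D.
Proof. by move=> Dw; apply/mapP; exists (k, w). Qed.

Lemma curve_uniq D k w w' : uniq (names D) ->
  (k, w) \in D -> (k, w') \in D -> w = w'.
Proof.
elim: D => //= [[k0 w0] D] IH /= /andP[k0D uD]; rewrite !inE /=.
case/predU1P=> [[Ek Ew]|Dw]; case/predU1P=> [[Ek' Ew']|Dw'].
- by rewrite Ew Ew'.
- by rewrite -Ek (mem_names Dw') in k0D.
- by rewrite -Ek' (mem_names Dw) in k0D.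
- exact: IH Dw Dw'.
Qed.

Definition curve_named D k := nth [::] [seq z.2 | z <- D] (index k (names D)).

Lemma curve_namedE D k w : uniq (names D) -> (k, w) \in D -> curve_named D k = w.
Proof.
move=> uD Dw; have := mem_names Dw; rewrite -index_mem size_map => ik.
apply: (curve_uniq uD _ Dw); rewrite /curve_named (nth_map (k, w)) //.
have kE : (nth (k, w) D (index k (names D))).1 = k.
  by rewrite -(nth_map _ 0 fst) // nth_index // (mem_names Dw).
case E: (nth _ _ _) kE => [k' w'] /= <-; rewrite -E; exact: mem_nth.
Qed.

Lemma curve_letters_uniq D k w : uniq (letters D) -> (k, w) \in D -> uniq w.
Proof.
move=> uL Dw; apply: subseq_uniq uL.
case/path.splitPr: Dw => X Y; rewrite /letters map_cat flatten_cat /=.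
exact: subseq_trans (prefix_subseq _ _) (suffix_subseq _ _).
Qed.

Lemma shifted_base e s chi chi' k : K (level (ty k) e) (s k) ->
  shifted e s chi chi' -> eqm K (level (ty k) e) (base chi k) (base chi' k).
Proof.
move=> Ks [_ /(_ k)/eqmW bb]; apply: eqm_sym; apply: eqm_trans bb _.
by apply: eqm_sym; rewrite /eqm mulKg.
Qed.

Lemma transportable_trans D1 D2 D3 :
  transportable D1 D2 -> transportable D2 D3 -> transportable D1 D3.
Proof.
move=> [F [pF vF sF tF cF]] [G [pG vG sG tG cG]]; exists (G \o F); split=> /=.
- exact: perm_trans pF pG.
- by move=> e chi /vF/vG.
- by move=> e s chi chi' V V' Ks /(sF _ _ _ _ V V' Ks)/sG; apply => //; apply: vF.
- move=> e chi k w1 w3 V Dw1 Dw3.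
  have [w2 Dw2] : exists w, (k, w) \in D2.
    by apply: names_mem; rewrite (perm_mem pG); apply: mem_names Dw3.
  by apply: eqm_trans (tF _ _ _ _ _ V Dw1 Dw2) _; apply: tG => //; apply: vF.
- move=> chi k tk; have [g Eg] := cF chi k tk.
  have [h Eh] := cG (F chi) k tk.
  by exists (g * h); rewrite Eh Eg conjgM.
Qed.

(** If a colouring of the old diagram also fits the new curves, and each run ends
    up the same modulo the next layer, then the identity transports: the shift of
    both runs by a central factor is the same by [run_shift]. *)
Lemma transportable_same_colors D D' : uniq (names D) ->
  perm_eq (names D) (names D') ->
  (forall e chi k w w', valid e D chi -> (k, w) \in D -> (k, w') \in D' ->
     eqm K (level (ty k) e).+1 (run (over chi) (ty k) (base chi k) w)
       (run (over chi) (ty k) (base chi k) w') /\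
     overs_fit e (over chi) (ty k) (base chi k) w') ->
  transportable D D'.
Proof.
move=> uD pD H; exists id; split=> //.
- move=> e chi V k w' Dw'.
  have [w Dw] : exists w, (k, w) \in D.
    by apply: names_mem; rewrite (perm_mem pD); apply: mem_names Dw'.
  have [/eqmW E O] := H e chi k w w' V Dw Dw'; split=> //.
  exact: eqm_trans (V _ _ Dw).2 E.
- move=> e chi k w w' V Dw Dw'; apply: eqmMl.
  by have [] := H e chi k w w' V Dw Dw'.
- by move=> chi k; exists 1; rewrite conjg1.
Qed.

Lemma transportable_perm D D' : uniq (names D) -> perm_eq D D' ->
  transportable D D'.
Proof.
move=> uD pD; apply: transportable_same_colors => // [|e chi k w w' V Dw].
  exact: perm_map.
rewrite -(perm_mem pD) => Dw'; rewrite -(curve_uniq uD Dw Dw').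
by split=> //; apply: (V _ _ Dw).1.
Qed.

Lemma names_replace X Y k w w' :
  names (X ++ (k, w) :: Y) = names (X ++ (k, w') :: Y).
Proof. by rewrite /names !map_cat. Qed.

Lemma mem_replace X Y k w k1 w1 : uniq (names (X ++ (k, w) :: Y)) ->
  (k1, w1) \in X ++ (k, w) :: Y ->
  (k1 = k /\ w1 = w) \/
  [/\ k1 != k, (k1, w1) \in X ++ Y
    & forall w', (k1, w1) \in X ++ (k, w') :: Y].
Proof.
move=> uD Dw1; have [E|nE] := eqVneq k1 k.
  left; split=> //; subst k1; apply: curve_uniq uD Dw1 _.
  by rewrite mem_cat mem_head orbT.
right; move: Dw1; rewrite !mem_cat in_cons xpair_eqE (negPf nE) /= => Dw1.
by split=> // w'; rewrite mem_cat in_cons xpair_eqE (negPf nE).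
Qed.

(** The workhorse for moves that leave every colour in place. *)
Lemma transportable_local X Y k u v P P' :
  let D := X ++ (k, u ++ P ++ v) :: Y in
  uniq (names D) ->
  (forall e chi, valid e D chi ->
     let x := run (over chi) (ty k) (base chi k) u in
     overs_fit e (over chi) (ty k) x P ->
     eqm K (level (ty k) e).+1 (run (over chi) (ty k) x P)
       (run (over chi) (ty k) x P') /\
     overs_fit e (over chi) (ty k) x P') ->
  transportable D (X ++ (k, u ++ P' ++ v) :: Y).
Proof.
move=> D uD H; have uD' := uD; rewrite (names_replace _ _ _ _ (u ++ P' ++ v)) in uD'.
apply: transportable_same_colors => //.
  by rewrite /D (names_replace _ _ _ _ (u ++ P' ++ v)).
move=> e chi k1 w1 w1' V Dw1 /(mem_replace uD')[[Ek ->]|[nk _ Dw1']]; last first.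
  by rewrite (curve_uniq uD Dw1 (Dw1' _)); split=> //; apply: (V _ _ (Dw1' _)).1.
subst k1; have Dk : (k, u ++ P ++ v) \in D by rewrite mem_cat mem_head orbT.
have [Ok _] := V _ _ Dk.
have [Ou /overs_fit_cat[OP Ov]] := (overs_fit_cat _ _ _ _ _ _).1 Ok.
have {H}[E OP'] := H e chi V OP.
split.
  rewrite (curve_uniq uD Dw1 Dk) !run_cat -[X in eqm _ _ X _]mulg1; apply: eqm_sym.
  by apply: run_shift => //; [apply: layer1 | rewrite mulg1; apply: eqm_sym].
apply/overs_fit_cat; split=> //; apply/overs_fit_cat; split=> //.
by apply: overs_fit_eqm Ov => //; apply: eqmW.
Qed.

(** * Virtual crossings, new overcrossings and base points *)

Definition strip_virtual D : diagram :=
  [seq (c.1, [seq l <- c.2 | ~~ is_virtual l]) | c <- D].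

Lemma names_strip D : names (strip_virtual D) = names D.
Proof. by rewrite /names -map_comp; apply: eq_map. Qed.

Lemma run_strip o t x w : run o t x [seq l <- w | ~~ is_virtual l] = run o t x w.
Proof. by elim: w x => //= -[c [s|s|s]] w IH x /=; rewrite IH. Qed.

Lemma overs_fit_strip e o t x w :
  overs_fit e o t x [seq l <- w | ~~ is_virtual l] <-> overs_fit e o t x w.
Proof.
elim: w x => //= -[c [s|s|s]] w IH x /=.
- by have [IH1 IH2] := IH (pass o t x (c, Over s)); split=> [[H /IH1]|[H /IH2]].
- by have [IH1 IH2] := IH (pass o t x (c, Under s)); split=> [[_ /IH1]|[_ /IH2]].
- by have [IH1 IH2] := IH (pass o t x (c, Virtual s)); split=> [/IH1|[_ /IH2]].
Qed.

(** A virtual crossing does not change any colour. *)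
Lemma transportable_strip D : uniq (names D) ->
  transportable D (strip_virtual D) /\ transportable (strip_virtual D) D.
Proof.
move=> uD; split; apply: transportable_same_colors; rewrite ?names_strip //.
  move=> e chi k w w' V Dw /mapP[[k1 w1] Dw1 [Ek ->]] /=; subst k1.
  rewrite (curve_uniq uD Dw Dw1) run_strip; split=> //.
  exact/overs_fit_strip/(V _ _ Dw1).1.
move=> e chi k w w' V Dw Dw'; have /mapP[[k1 w1] Dw1 [Ek Ew]] := Dw; subst k1.
rewrite (curve_uniq uD Dw' Dw1) Ew /= run_strip; split=> //.
by apply/overs_fit_strip; rewrite -Ew; apply: (V _ _ Dw).1.
Qed.

Definition crossings D : seq nat := [seq l.1 | l <- letters D].

Lemma mem_letters D k w l : (k, w) \in D -> l \in w -> l \in letters D.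
Proof. by move=> Dw wl; apply/flattenP; exists w => //; apply/mapP; exists (k, w). Qed.

Lemma lettersP D l : reflect (exists k w, (k, w) \in D /\ l \in w) (l \in letters D).
Proof.
apply: (iffP flattenP) => [[w /mapP[[k w1] Dw ->] wl]|[k [w [Dw wl]]]].
  by exists k, w1.
by exists w => //; apply/mapP; exists (k, w).
Qed.

Lemma eq_pass o o' t x l : o l.1 = o' l.1 -> pass o t x l = pass o' t x l.
Proof. by rewrite /pass => ->. Qed.

Lemma eq_run o o' t x w : (forall l, l \in w -> o l.1 = o' l.1) ->
  run o t x w = run o' t x w.
Proof.
elim: w x => //= l w IH x oo'; rewrite (@eq_pass o o') ?oo' ?mem_head //.
by apply: IH => l' wl'; apply: oo'; rewrite in_cons wl' orbT.
Qed.

Lemma eq_overs_fit e o o' t x w : (forall l, l \in w -> o l.1 = o' l.1) ->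
  overs_fit e o t x w -> overs_fit e o' t x w.
Proof.
elim: w x => //= l w IH x oo' [lP wP].
rewrite -(@eq_pass o o') ?oo' ?mem_head //; split; last first.
  by apply: IH => // l' wl'; apply: oo'; rewrite in_cons wl' orbT.
by rewrite -(oo' l) // mem_head.
Qed.

(** A new overcrossing takes the colour of the strand it is put on. *)
Lemma transportable_new_over X Y k u v c b :
  let D := X ++ (k, u ++ v) :: Y in
  uniq (names D) -> c \notin crossings D ->
  transportable D (X ++ (k, u ++ (c, Over b) :: v) :: Y).
Proof.
move=> D uD cD; pose w' := u ++ (c, Over b) :: v.
have uD' : uniq (names (X ++ (k, w') :: Y)).
  by rewrite (names_replace _ _ _ _ (u ++ v)).
have Dk : (k, u ++ v) \in D by rewrite mem_cat mem_head orbT.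
pose x chi := run (over chi) (ty k) (base chi k) u.
pose ov chi c' := if c' == c then (meridian (ty k) (x chi), ty k) else over chi c'.
have ovE chi k1 w1 : (k1, w1) \in D -> forall l, l \in w1 ->
    over chi l.1 = ov chi l.1.
  move=> Dw1 l wl; rewrite /ov; case: eqP => // Ec; case/negP: cD; rewrite -Ec.
  exact/map_f/(mem_letters Dw1).
have ovE' chi l : l \in u ++ v -> over chi l.1 = ov chi l.1 by apply: (ovE _ _ _ Dk).
have runE chi y : run (ov chi) (ty k) y w' = run (over chi) (ty k) y (u ++ v).
  rewrite (eq_run _ _ (@ovE' chi)) !run_cat /=; congr run.
exists (fun chi => Coloring (ov chi) (base chi)); split.
- by rewrite /D (names_replace X Y k (u ++ v) w').
- move=> e chi V k1 w1 /(mem_replace uD')[[-> ->]|[_ _ /(_ (u ++ v)) Dw1]].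
    have [O C] := V _ _ Dk; split; last by rewrite /= runE.
    have [Ou Ov] := (overs_fit_cat _ _ _ _ _ _).1 (eq_overs_fit (@ovE' chi) O).
    apply/overs_fit_cat; split=> //=; split=> //.
    rewrite /ov eqxx /=; split=> //; rewrite -/(ov chi).
    rewrite -(eq_run (o := over chi)) // => l ul.
    by apply: ovE'; rewrite mem_cat ul.
  have [O C] := V _ _ Dw1; split=> /=; first exact: eq_overs_fit (ovE _ _ _ Dw1) O.
  by rewrite -(eq_run _ _ (ovE _ _ _ Dw1)).
- move=> e s chi chi' V V' Ks ss'; split; last exact: ss'.2.
  move=> c' /=; rewrite /ov; case: eqP => _; last exact: ss'.1.
  split=> //=; apply: meridian_eqm; apply: run_eqm; first exact: ss'.1.
  exact: shifted_base ss'.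
- move=> e chi k1 w1 w2 V Dw1 /(mem_replace uD')[[Ek ->]|[_ _ /(_ (u ++ v)) Dw2]].
    subst k1; rewrite (curve_uniq uD Dw1 Dk) /twist /= runE; exact: eqm_refl.
  rewrite (curve_uniq uD Dw1 Dw2) /twist /= -(eq_run _ _ (ovE _ _ _ Dw2)).
  exact: eqm_refl.
- by move=> chi k1 _; exists 1; rewrite conjg1.
Qed.

Lemma pass_conj o x l : exists g, pass o false x l = x ^ g.
Proof.
rewrite /pass; case: l.2 => [s|s|s]; try by exists 1; rewrite conjg1.
by exists (gpow (o l.1).1 s).
Qed.

(** Moving the base point over one letter replaces the base colour by the next
    state; the twist gets conjugated, which is invisible modulo the next layer. *)
Lemma transportable_rot1 X Y k l w :
  let D := X ++ (k, l :: w) :: Y in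
  uniq (names D) -> transportable D (X ++ (k, rcons w l) :: Y).
Proof.
move=> D uD; have uD' : uniq (names (X ++ (k, rcons w l) :: Y)).
  by rewrite (names_replace _ _ _ _ (l :: w)).
have Dk : (k, l :: w) \in D by rewrite mem_cat mem_head orbT.
pose x' chi := pass (over chi) (ty k) (base chi k) l.
exists (fun chi => Coloring (over chi)
  (fun k1 => if k1 == k then x' chi else base chi k1)); split.
- by rewrite /D (names_replace X Y k (l :: w) (rcons w l)).
- move=> e chi V k1 w1 /(mem_replace uD')[[-> ->]|[/negPf nk _ /(_ (l :: w)) Dw1]].
    have [[lP wP] C] := V _ _ Dk; rewrite /fits /= eqxx -cats1 run_cat.
    split; last exact: pass_eqm.
    apply/overs_fit_cat; split=> //.
    by apply: (@overs_fit_eqm _ (over chi)) C _.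
  by rewrite /fits /= nk; apply: V.
- move=> e s chi chi' V V' Ks ss'; split=> [|k1 /=]; first exact: ss'.1.
  case: eqP => [->|_]; last exact: ss'.2.
  by apply: pass_shift; [exact: ss'.1 | exact: Ks | exact: ss'.2].
- move=> e chi k1 w1 w2 V Dw1 /(mem_replace uD')[[Ek ->]|[nk _ /(_ (l :: w)) Dw2]].
    subst k1; rewrite (curve_uniq uD Dw1 Dk) /twist /= eqxx -cats1 run_cat /=.
    set z := run _ _ _ w; set a := base chi k; have [_ C] := V _ _ Dk.
    apply: eqm_sym; rewrite -(mulKg (x' chi) (a^-1 * z)); apply: eqmMl.
    by apply: pass_shift => //; rewrite mulVKg.
  rewrite (curve_uniq uD Dw1 Dw2) /twist /= (negPf nk); exact: eqm_refl.
- move=> chi k1 tk /=; case: eqP => [E|_]; last by exists 1; rewrite conjg1.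
  by subst k1; rewrite /x' tk; apply: pass_conj.
Qed.

Lemma transportable_refl D : uniq (names D) -> transportable D D.
Proof. by move=> uD; apply: transportable_perm. Qed.

Lemma transportable_rot X Y k n w : uniq (names (X ++ (k, w) :: Y)) ->
  transportable (X ++ (k, w) :: Y) (X ++ (k, rot n w) :: Y).
Proof.
move=> uD; have [wn|/rot_oversize->] := ltnP n (size w); last exact: transportable_refl.
elim: n wn => [|n IH] wn; first by rewrite rot0; apply: transportable_refl.
rewrite rotS ?(ltnW wn) //; apply: transportable_trans (IH (ltnW wn)) _.
have := ltnW wn; rewrite -(size_rot n); case: (rot n w) => // l w' _.
by rewrite rot1_cons; apply: transportable_rot1; rewrite (names_replace _ _ _ _ w).
Qed.

Lemma transportable_unrot X Y k n w : uniq (names (X ++ (k, w) :: Y)) ->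
  transportable (X ++ (k, rot n w) :: Y) (X ++ (k, w) :: Y).
Proof.
move=> uD; rewrite -[w in X in transportable _ X](rotK n) /rotr.
by apply: transportable_rot; rewrite (names_replace _ _ _ _ w).
Qed.

Definition rotate (r : nat -> nat) D : diagram :=
  [seq (c.1, rot (r c.1) c.2) | c <- D].

Lemma names_rotate r D : names (rotate r D) = names D.
Proof. by rewrite /names -map_comp; apply: eq_map. Qed.

Lemma transportable_rotate r D : uniq (names D) ->
  transportable D (rotate r D) /\ transportable (rotate r D) D.
Proof.
move=> uD; suff H X : uniq (names (X ++ D)) ->
    transportable (X ++ D) (X ++ rotate r D) /\
    transportable (X ++ rotate r D) (X ++ D) by exact: (H [::]).
elim: D X {uD} => [|[k w] D IH] X uX /=; first by split; apply: transportable_refl.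
have uX' : uniq (names (rcons X (k, rot (r k) w) ++ D)).
  by rewrite cat_rcons (names_replace _ _ _ _ w).
have [IH1 IH2] := IH _ uX'; rewrite !cat_rcons in IH1 IH2.
split; first exact: transportable_trans (transportable_rot _ uX) IH1.
exact: transportable_trans IH2 (transportable_unrot _ uX).
Qed.

Definition relabel_all (f : nat -> nat) D : diagram :=
  [seq (c.1, [seq relabel f l | l <- c.2]) | c <- D].

Lemma names_relabel f D : names (relabel_all f D) = names D.
Proof. by rewrite /names -map_comp; apply: eq_map. Qed.

Lemma run_relabel f o t x w :
  run o t x [seq relabel f l | l <- w] = run (o \o f) t x w.
Proof. by elim: w x => //= l w IH x; rewrite IH. Qed.

Lemma overs_fit_relabel f e o t x w :
  overs_fit e o t x [seq relabel f l | l <- w] <-> overs_fit e (o \o f) t x w.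
Proof.
elim: w x => //= l w IH x; have [IH1 IH2] := IH (pass (o \o f) t x l).
by split=> -[lP wP]; split=> //; [apply: IH1 | apply: IH2].
Qed.

Lemma transportable_unlabel f D : uniq (names D) ->
  transportable (relabel_all f D) D.
Proof.
move=> uD; have Df k w : (k, w) \in D ->
    (k, [seq relabel f l | l <- w]) \in relabel_all f D.
  by move=> Dw; apply/mapP; exists (k, w).
exists (fun chi => Coloring (over chi \o f) (base chi)); split.
- by rewrite names_relabel.
- move=> e chi V k w Dw; have [O C] := V _ _ (Df _ _ Dw).
  by split; [apply/overs_fit_relabel | rewrite -run_relabel].
- by move=> e s chi chi' _ _ _ [oo bb]; split=> // c; apply: oo.
- move=> e chi k w w' V Dw Dw'; have uf := uD; rewrite -(names_relabel f) in uf.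
  by rewrite (curve_uniq uf Dw (Df _ _ Dw')) /twist run_relabel.
- by move=> chi k _; exists 1; rewrite conjg1.
Qed.

(** Renaming is undone by an inverse of [f] on the crossings of [D], so one direction
    suffices. *)
Lemma transportable_relabel f D : uniq (names D) -> injective f ->
  transportable D (relabel_all f D).
Proof.
move=> uD f_inj.
pose cs := crossings D; pose g c := nth 0 cs (index c [seq f d | d <- cs]).
have gK c : c \in cs -> g (f c) = c.
  by move=> csc; rewrite /g index_map // nth_index.
have {1}-> : D = relabel_all g (relabel_all f D).
  rewrite /relabel_all -map_comp -[LHS]map_id; apply/eq_in_map => -[k w] Dw /=.
  rewrite -map_comp map_id_in // => -[c p] wl; congr pair; apply: gK.
  exact/(map_f (fun l : letter => l.1))/(mem_letters Dw wl).
by apply: transportable_unlabel; rewrite names_relabel.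
Qed.

(** * Sliding one strand under another *)

Section Substitution.
Variables (a c : nat) (d : bool).
Hypothesis neq_ac : a != c.

(** The undercrossing at [c] seen from the other side of the strand over [a]. *)
Definition detour_letter l : seq letter :=
  if is_under l && (l.1 == c) then [:: (a, Under (~~ d)); l; (a, Under d)]
  else [:: l].
Definition detour_word w : seq letter := flatten [seq detour_letter l | l <- w].
Definition detour_all D : diagram := [seq (z.1, detour_word z.2) | z <- D].

Definition recolor o : nat -> N * bool := fun c' =>
  if c' == c then ((o c).1 ^ (gpow (o a).1 d)^-1, (o c).2) else o c'.

Lemma detour_word_cat u v : detour_word (u ++ v) = detour_word u ++ detour_word v.
Proof. by rewrite /detour_word map_cat flatten_cat. Qed.

Lemma names_detour D : names (detour_all D) = names D.
Proof. by rewrite /names -map_comp; apply: eq_map. Qed.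

Lemma run_detour_letter o t x l :
  run (recolor o) t x (detour_letter l) = pass o t x l.
Proof.
rewrite /detour_letter; case: ifP => [/andP[]|]; last first.
  case: l => c' [s|s|s] //=; rewrite /pass /recolor /=.
  by case: eqP.
case: l => c' [s|s|s] //= _ /eqP->; rewrite /pass /recolor /= eqxx (negPf neq_ac).
case: t; last first.
  by rewrite -!conjgM gpowJ gpowN [gpow _ s ^ _]conjgE invgK -mulgA !mulgA mulVg mul1g mulgVK.
rewrite gpowJ [gpow (o a).1 (~~ d)]gpowN conjgE invgK.
move: (gpow (o a).1 d) (gpow (o c).1 s) => p q.
by case: (o a).2; case: (o c).2; case: d; case: s => /=; rewrite !gnorm.
Qed.

Lemma run_detour o t x w : run (recolor o) t x (detour_word w) = run o t x w.
Proof.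
elim: w x => //= l w IH x.
by rewrite -/(detour_word w) run_cat run_detour_letter IH.
Qed.

Lemma overs_fit_detour e o t x w : (forall b, (c, Over b) \notin w) ->
  overs_fit e o t x w -> overs_fit e (recolor o) t x (detour_word w).
Proof.
elim: w x => //= l w IH x cw [lP wP]; apply/overs_fit_cat; split; last first.
  rewrite run_detour_letter -/(detour_word w); apply: IH => // b.
  by apply: contra (cw b); rewrite in_cons => ->; rewrite orbT.
case: l cw lP {IH wP} => c' [s|s|s] cw lP; rewrite /detour_letter /=.
- split=> //; rewrite /recolor; case: eqP => // E; case/negP: (cw s).
  by rewrite E mem_head.
- by case: eqP.
- by [].
Qed.

Lemma eqo_recolor e o o' : eqo e o o' -> eqo e (recolor o) (recolor o').
Proof.
move=> oo' c'; rewrite /recolor; case: eqP => _; last exact: oo'.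
have [-> cc] := oo' c; have [_ aa] := oo' a.
by split=> //=; apply: eqmJ => //; apply/eqmV/eqm_gpow.
Qed.

(** Sliding the strand through [c] under the strand over [a] conjugates its
    colour there; undercrossings at [c] compensate by the detour. *)
Lemma transportable_detour X Y k u v P P' :
  let D := X ++ (k, u ++ P ++ v) :: Y in
  uniq (names D) ->
  (forall b, (c, Over b) \notin letters (X ++ (k, u ++ v) :: Y)) ->
  detour_word P' = P' ->
  (forall e o t x, overs_fit e o t x P ->
     run o t x P = run (recolor o) t x P' /\ overs_fit e (recolor o) t x P') ->
  transportable D (detour_all (X ++ (k, u ++ P' ++ v) :: Y)).
Proof.
move=> D uD cD EP' HP.
pose w' := detour_word u ++ P' ++ detour_word v.
have E' : detour_all (X ++ (k, u ++ P' ++ v) :: Y) =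
    detour_all X ++ (k, w') :: detour_all Y.
  by rewrite /detour_all map_cat /= !detour_word_cat EP'.
have nD : names (detour_all (X ++ (k, u ++ P' ++ v) :: Y)) = names D.
  by rewrite names_detour (names_replace _ _ _ _ (u ++ P ++ v)).
have uD' : uniq (names (detour_all X ++ (k, w') :: detour_all Y)) by rewrite -E' nD.
have Dk : (k, u ++ P ++ v) \in D by rewrite mem_cat mem_head orbT.
have other k1 w1 : (k1, w1) \in detour_all X ++ (k, w') :: detour_all Y ->
    k1 = k /\ w1 = w' \/
    exists2 w0, w1 = detour_word w0 & (k1, w0) \in D /\ (k1, w0) \in X ++ Y.
  case/(mem_replace uD') => [[-> ->]|[_ + _]]; first by left.
  rewrite -[detour_all X ++ _]map_cat => /mapP[[k0 w0] Dw0 [-> ->]].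
  right; exists w0 => //; split=> //; move: Dw0.
  by rewrite !mem_cat in_cons => /orP[->|->]; rewrite ?orbT.
have cXY k1 w0 b : (k1, w0) \in X ++ Y -> (c, Over b) \notin w0.
  move=> Dw0; apply: contra (cD b) => wc; apply/lettersP; exists k1, w0.
  by split=> //; move: Dw0; rewrite !mem_cat in_cons => /orP[->|->]; rewrite ?orbT.
have cuv b : (c, Over b) \notin u /\ (c, Over b) \notin v.
  have : (c, Over b) \notin u ++ v.
    apply: contra (cD b) => wc; apply/lettersP; exists k, (u ++ v).
    by rewrite mem_cat mem_head orbT.
  by rewrite mem_cat negb_or => /andP.
have runw' e chi : valid e D chi ->
    overs_fit e (recolor (over chi)) (ty k) (base chi k) w' /\
    run (recolor (over chi)) (ty k) (base chi k) w' =
    run (over chi) (ty k) (base chi k) (u ++ P ++ v).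
  move=> V; have [O _] := V _ _ Dk.
  have [Ou /overs_fit_cat[OP Ov]] := (overs_fit_cat _ _ _ _ _ _).1 O.
  have [EP OP'] := HP _ _ _ _ OP.
  rewrite !run_cat run_detour EP run_detour; split=> //.
  apply/overs_fit_cat; split; first by apply: overs_fit_detour Ou => b; case: (cuv b).
  rewrite run_detour; apply/overs_fit_cat; split=> //; rewrite -EP.
  by apply: overs_fit_detour Ov => b; case: (cuv b).
exists (fun chi => Coloring (recolor (over chi)) (base chi)); rewrite E'; split.
- by rewrite -E' nD.
- move=> e chi V k1 w1 /other[[-> ->]|[w0 -> [Dw0 XYw0]]]; rewrite /fits /=.
    by have [O ->] := runw' _ _ V; split=> //; apply: (V _ _ Dk).2.
  have [O C] := V _ _ Dw0; rewrite run_detour; split=> //.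
  by apply: overs_fit_detour O => b; apply: cXY XYw0.
- move=> e s chi chi' _ _ _ [oo bb]; split=> //; exact: eqo_recolor.
- move=> e chi k1 w1 w2 V Dw1 /other[[Ek ->]|[w0 -> [Dw0 XYw0]]]; rewrite /twist /=.
    by subst k1; rewrite (curve_uniq uD Dw1 Dk); have [_ ->] := runw' _ _ V.
  by rewrite run_detour (curve_uniq uD Dw1 Dw0).
- by move=> chi k1 _; exists 1; rewrite conjg1.
Qed.

End Substitution.

Definition swap (p q : letter) : letter -> letter :=
  [eta id with p |-> q, q |-> p].
Arguments swap : simpl never.

Definition map_letters (f : letter -> letter) D : diagram :=
  [seq (z.1, [seq f l | l <- z.2]) | z <- D].

Definition adjacent D p q : Prop := exists X k u v Y,
  D = X ++ (k, u ++ [:: p; q] ++ v) :: Y.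

Definition adjacent_if (b : bool) D p q : Prop :=
  if b then adjacent D p q else adjacent D q p.

Lemma names_map_letters f D : names (map_letters f D) = names D.
Proof. by rewrite /names -map_comp; apply: eq_map. Qed.

Lemma letters_map f D : letters (map_letters f D) = [seq f l | l <- letters D].
Proof. by rewrite /letters map_flatten -!map_comp. Qed.

Lemma map_letters_comp f g D :
  map_letters f (map_letters g D) = map_letters (f \o g) D.
Proof. by rewrite /map_letters -map_comp; apply: eq_map => -[k w] /=; rewrite -map_comp. Qed.

Lemma eq_map_letters f g D : {in letters D, f =1 g} -> map_letters f D = map_letters g D.
Proof.
move=> fg; apply/eq_in_map => -[k w] Dw /=; congr pair; apply/eq_in_map => l wl.
exact/fg/(mem_letters Dw).
Qed.

Lemma map_letters_id D : map_letters id D = D.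
Proof. by rewrite -[RHS]map_id; apply: eq_map => -[k w] /=; rewrite map_id. Qed.

Lemma adjacent_map f D p q : adjacent D p q -> adjacent (map_letters f D) (f p) (f q).
Proof.
move=> [X [k [u [v [Y ->]]]]].
exists (map_letters f X), k, (map f u), (map f v), (map_letters f Y).
by rewrite /map_letters map_cat /= map_cat.
Qed.

Lemma adjacent_if_map b f D p q :
  adjacent_if b D p q -> adjacent_if b (map_letters f D) (f p) (f q).
Proof. by case: b; apply: adjacent_map. Qed.

Lemma letters_cut X k u P v Y :
  perm_eq (letters (X ++ (k, u ++ P ++ v) :: Y))
          (P ++ letters (X ++ (k, u ++ v) :: Y)).
Proof.
rewrite /letters !map_cat !flatten_cat /= -!catA.
by rewrite catA perm_catCA -!catA.
Qed.

Lemma swap_id p q l : l != p -> l != q -> swap p q l = l.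
Proof. by rewrite /swap /= => /negPf-> /negPf->. Qed.

Lemma swapL p q : swap p q p = q. Proof. by rewrite /swap /= eqxx. Qed.
Lemma swapR p q : swap p q q = p.
Proof. by rewrite /swap /= eqxx; case: eqP. Qed.

Lemma swapK p q : involutive (swap p q).
Proof.
move=> l; have [->|lp] := eqVneq l p; first by rewrite swapL swapR.
have [->|lq] := eqVneq l q; first by rewrite swapR swapL.
by rewrite !swap_id.
Qed.

Lemma swapC p q : swap p q =1 swap q p.
Proof. by move=> l; rewrite /swap /=; do 2![case: eqP => //] => -> ->. Qed.

Lemma swap_adjacent X k u v Y p q : uniq (letters (X ++ (k, u ++ [:: p; q] ++ v) :: Y)) ->
  map_letters (swap p q) (X ++ (k, u ++ [:: p; q] ++ v) :: Y) =
  X ++ (k, u ++ [:: q; p] ++ v) :: Y.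
Proof.
rewrite (perm_uniq (letters_cut _ _ _ _ _ _)) /= !in_cons !negb_or -andbA => /and4P[_ pD qD _].
set D1 := X ++ _; set D2 := RHS; have id_on Z : {subset letters Z <= letters (X ++ (k, u ++ v) :: Y)} ->
    map_letters (swap p q) Z = Z.
  move=> sZ; rewrite -[RHS]map_letters_id; apply: eq_map_letters => l /sZ lD.
  by apply: swap_id; [apply: contraNneq pD | apply: contraNneq qD] => <-.
rewrite /D1 /D2 /map_letters map_cat /= map_cat /= swapL swapR.
have lE : letters (X ++ (k, u ++ v) :: Y) = letters X ++ u ++ v ++ letters Y.
  by rewrite /letters map_cat flatten_cat /= -catA.
rewrite -/(map_letters _ X) -/(map_letters _ Y) !id_on; last 2 first.
- by move=> l lY; rewrite lE !mem_cat lY !orbT.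
- by move=> l lX; rewrite lE !mem_cat lX.
congr (_ ++ (_, _ ++ [:: _, _ & _]) :: _).
  rewrite -[RHS]map_id; apply/eq_in_map => l ul; apply: swap_id.
    by apply: contraNneq pD => <-; rewrite lE !mem_cat ul orbT.
  by apply: contraNneq qD => <-; rewrite lE !mem_cat ul orbT.
rewrite -[RHS]map_id; apply/eq_in_map => l ul; apply: swap_id.
  by apply: contraNneq pD => <-; rewrite lE !mem_cat ul !orbT.
by apply: contraNneq qD => <-; rewrite lE !mem_cat ul !orbT.
Qed.

Lemma run_cancel o t x c s P :
  run o t x [:: (c, Under s), (c, Under (~~ s)) & P] = run o t x P.
Proof.
rewrite /= /pass /=; case: t; last by rewrite gpowN conjgK.
by case: (o c).2; case: s; rewrite /= ?gnorm.
Qed.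

Lemma overs_fit_unders e o t x w : all is_under w -> overs_fit e o t x w.
Proof. by elim: w x => //= -[c [s|s|s]] w IH x //= aw; split=> //; apply: IH. Qed.

(** An arc running over several crossings in a row has one colour. *)
Lemma adjacent_overs e D chi p q a s (y : nat) s' : valid e D chi -> adjacent D p q ->
  p = (a, Over s) -> q = (y, Over s') ->
  (over chi a).2 = (over chi y).2 /\ eqm K e.+1 (over chi a).1 (over chi y).1.
Proof.
move=> V [X [k [u [v [Y ED]]]]] Ep Eq; subst.
have [|O _] := V k (u ++ [:: (a, Over s); (y, Over s')] ++ v).
  by rewrite mem_cat mem_head orbT.
have [_ /= [[-> Ea] [[-> Ey] _]]] := (overs_fit_cat _ _ _ _ _ _).1 O.
by split=> //; apply: eqm_trans Ey; apply: eqm_sym.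
Qed.

Lemma adjacent_overs_if b e D chi a s (y : nat) s' : valid e D chi ->
  adjacent_if b D (a, Over s) (y, Over s') ->
  (over chi a).2 = (over chi y).2 /\ eqm K e.+1 (over chi a).1 (over chi y).1.
Proof.
case: b => V /(adjacent_overs V); first exact.
by case/(_ _ _ _ _ erefl erefl) => -> E; split=> //; apply: eqm_sym.
Qed.

Lemma meridian_pass o t x c s :
  meridian t (pass o t x (c, Under s)) = meridian t x ^ gpow (o c).1 s.
Proof.
case: t => //=; rewrite /pass /=; set z := if _ then _ else _.
have zA : A ^ z = A.
  by rewrite /z; case: (o c).2; case: s {z}; rewrite /= ?conjg1 // conjgE !gnorm.
by rewrite !conjgM zA.
Qed.

Lemma transportable_swap_overs f D a s (y : nat) s' : uniq (names D) -> uniq (letters D) ->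
  adjacent_if f D (a, Over s) (y, Over s') ->
  transportable D (map_letters (swap (a, Over s) (y, Over s')) D).
Proof.
wlog f1 : f a s y s' / f => [H|] uD uL.
  case: f => adj; first exact: (H true).
  have -> : map_letters (swap (a, Over s) (y, Over s')) D =
      map_letters (swap (y, Over s') (a, Over s)) D.
    by apply: eq_map_letters => l _; apply: swapC.
  exact: (H true).
case: f f1 => // _ [X [k [u [v [Y ED]]]]]; subst.
rewrite swap_adjacent //; apply: transportable_local => // e chi _ x.
by rewrite /= /pass /= => -[H1 [H2 _]]; split=> //; apply: eqm_refl.
Qed.

(** * The third Reidemeister move on words *)

Lemma adjacent_if_cut b D p q : adjacent_if b D p q -> exists X k u v Y,
  D = X ++ (k, u ++ (if b then [:: p; q] else [:: q; p]) ++ v) :: Y.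
Proof. by case: b => -[X [k [u [v [Y ->]]]]]; exists X, k, u, v, Y. Qed.

Lemma swap_adjacent_if b X k u v Y p q :
  uniq (letters (X ++ (k, u ++ (if b then [:: p; q] else [:: q; p]) ++ v) :: Y)) ->
  map_letters (swap p q)
    (X ++ (k, u ++ (if b then [:: p; q] else [:: q; p]) ++ v) :: Y) =
  X ++ (k, u ++ (if b then [:: q; p] else [:: p; q]) ++ v) :: Y.
Proof.
case: b => uD; first exact: swap_adjacent.
by rewrite -(swap_adjacent uD); apply: eq_map_letters => l _; apply: swapC.
Qed.

Lemma detour_word_id a c d w : (forall l, l \in w -> is_under l -> l.1 != c) ->
  detour_word a c d w = w.
Proof.
elim: w => // l w IH nw; rewrite /detour_word /= -/(detour_word _ _ _ w) IH.
  rewrite /detour_letter; case: ifP => // /andP[ul].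
  by rewrite (negPf (nw l _ ul)) ?mem_head.
by move=> l' wl'; apply: nw; rewrite in_cons wl' orbT.
Qed.

Lemma detour_all_cut a c d X k u Q v Y :
  (forall l, l \in letters (X ++ (k, u ++ v) :: Y) -> is_under l -> l.1 != c) ->
  detour_all a c d (X ++ (k, u ++ Q ++ v) :: Y) =
  X ++ (k, u ++ detour_word a c d Q ++ v) :: Y.
Proof.
rewrite /letters map_cat flatten_cat /= => nD.
have id_on Z : {subset letters Z <= letters X ++ letters Y} -> detour_all a c d Z = Z.
  move=> sZ; rewrite -[RHS]map_id; apply/eq_in_map => -[k1 w] Zw /=; congr pair.
  apply: detour_word_id => l wl; apply: nD; move: (sZ _ (mem_letters Zw wl)).
  by rewrite !mem_cat => /orP[]->; rewrite ?orbT.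
rewrite /detour_all map_cat /= !detour_word_cat -!/(detour_all _ _ _ _) !id_on.
- by rewrite (@detour_word_id _ _ _ u) ?(@detour_word_id _ _ _ v) // => l wl;
    apply: nD; rewrite !mem_cat wl ?orbT.
- by move=> l Yl; rewrite mem_cat Yl orbT.
- by move=> l Xl; rewrite mem_cat Xl.
Qed.

Lemma adjacent_detour_overs a c d D c1 s1 c2 s2 :
  adjacent D (c1, Over s1) (c2, Over s2) ->
  adjacent (detour_all a c d D) (c1, Over s1) (c2, Over s2).
Proof.
move=> [X [k [u [v [Y ->]]]]].
exists (detour_all a c d X), k, (detour_word a c d u), (detour_word a c d v),
  (detour_all a c d Y).
by rewrite /detour_all map_cat /= !detour_word_cat.
Qed.

(** The third Reidemeister move: the strand over [a] and [b] passes across the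
    crossing [c].  The booleans [f], [h], [g] tell the order of the crossings on
    the top, middle and bottom strand; the last two hypotheses are the only
    trace of the planar picture.  First the middle strand slides, at the price
    of a detour of the bottom strand at [c], which then cancels against its
    undercrossing at [b]. *)
Lemma transportable_triangle D f h g a b c sa sb sc :
  uniq (names D) -> uniq (letters D) -> uniq [:: a; b; c] ->
  {in letters D, forall l, l.1 = c -> l \in [:: (c, Over sc); (c, Under sc)]} ->
  adjacent_if f D (a, Over sa) (b, Over sb) ->
  adjacent_if h D (a, Under sa) (c, Over sc) ->
  adjacent_if g D (c, Under sc) (b, Under sb) ->
  (h == sa) = g (+) sb ->
  transportable D (map_letters (swap (a, Over sa) (b, Over sb))
    (map_letters (swap (c, Under sc) (b, Under sb))
      (map_letters (swap (a, Under sa) (c, Over sc)) D))).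
Proof.
move=> uD uL; rewrite /= !inE negb_or andbT => /andP[/andP[nab nac] nbc] cD.
move=> top mid bot sgn; pose d := h == sa.
have [ba [ca cb]] : (b == a) = false /\ (c == a) = false /\ (c == b) = false.
  by rewrite ![_ == a]eq_sym [c == b]eq_sym !(negPf nab, negPf nac, negPf nbc).
have [ou uo] : (forall s s', (Over s == Under s') = false) /\
    (forall s s', (Under s == Over s') = false).
  by split=> s s'; apply/eqP.
have neq := (ba, ca, cb, negPf nab, negPf nac, negPf nbc, ou, uo, andbF).
pose E := map_letters (swap (a, Under sa) (c, Over sc)) D.
have uE : uniq (names E) by rewrite names_map_letters.
have uLE : uniq (letters E).
  by rewrite letters_map map_inj_uniq //; apply/inv_inj/swapK.
have cE : {in letters E, forall l, l.1 = c -> l \in [:: (c, Over sc); (c, Under sc)]}.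
  rewrite letters_map => _ /mapP[l Dl ->]; rewrite /swap /=.
  case: eqP => [_ _|_]; first by rewrite mem_head.
  by case: eqP => [_ /= ac|_]; [rewrite ac eqxx in nac | apply: cD].
have tr1 : transportable D (detour_all a c d E).
  have [X [k [u [v [Y ED]]]]] := adjacent_if_cut mid; rewrite /E ED.
  rewrite swap_adjacent_if -?ED // ED; apply: transportable_detour => //.
  - by rewrite -ED.
  - move=> s; apply/negP => cl; have lD := letters_cut X k u _ v Y.
    have := uL; rewrite ED (perm_uniq (lD _)) cat_uniq => /and3P[_ /hasPn/(_ _ cl) + _].
    have : (c, Over s) \in letters D by rewrite ED (perm_mem (lD _)) mem_cat cl orbT.
    move/cD => /(_ erefl); rewrite !inE => /orP[/eqP->|/eqP//].
    by case: (h); rewrite !inE eqxx ?orbT.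
  - rewrite /detour_word /detour_letter.
    by case: (h); rewrite /= (negPf nac).
  - move=> e o t x; have ra : recolor a c d o a = o a by rewrite /recolor (negPf nac).
    have rc : recolor a c d o c = ((o c).1 ^ (gpow (o a).1 d)^-1, (o c).2).
      by rewrite /recolor eqxx.
    have rx y : pass (recolor a c d o) t y (a, Under sa) = pass o t y (a, Under sa).
      by apply: eq_pass.
    rewrite /d in ra rc rx *; case: (h) ra rc rx => /= ra rc rx.
      move=> [_ [[ct cP] _]]; rewrite rx rc /=; split=> //; split=> //; split=> //.
      move: cP; rewrite meridian_pass => /(eqmJ)/(_ (eqm_refl _ _ (gpow (o a).1 sa)^-1)).
      by rewrite conjgK; case: (sa).
    move=> [[ct cP] _]; rewrite !rx rc /=; split=> //; split=> //; split=> //; split=> //.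
    rewrite meridian_pass; apply: eqmJ => //; rewrite -gpowN.
    by case: (sa); exact: eqm_refl.
apply: transportable_trans tr1 _.
have botE : adjacent_if g E (c, Under sc) (b, Under sb).
  have := adjacent_if_map (swap (a, Under sa) (c, Over sc)) bot.
  by rewrite !swap_id // xpair_eqE !neq.
have topE : adjacent_if f E (a, Over sa) (b, Over sb).
  have := adjacent_if_map (swap (a, Under sa) (c, Over sc)) top.
  by rewrite !swap_id // xpair_eqE !neq.
rewrite -/E; set E2 := map_letters (swap (c, Under sc) (b, Under sb)) E.
have uE2 : uniq (names E2) by rewrite names_map_letters.
have uLE2 : uniq (letters E2).
  by rewrite letters_map map_inj_uniq //; apply/inv_inj/swapK.
have tr3 : transportable E2 (map_letters (swap (a, Over sa) (b, Over sb)) E2).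
  apply: (@transportable_swap_overs f) => //.
  have := adjacent_if_map (swap (c, Under sc) (b, Under sb)) topE.
  by rewrite !swap_id // xpair_eqE !neq.
apply: transportable_trans tr3.
have topE' : adjacent_if f (detour_all a c d E) (a, Over sa) (b, Over sb).
  by case: (f) topE; apply: adjacent_detour_overs.
have [X [k [u [v [Y EE]]]]] := adjacent_if_cut botE.
have {}tE : detour_all a c d E =
    X ++ (k, u ++ detour_word a c d (if g then [:: (c, Under sc); (b, Under sb)]
                          else [:: (b, Under sb); (c, Under sc)]) ++ v) :: Y.
  rewrite EE; apply: detour_all_cut => l ll ul; apply/eqP => lc.
  have lD := letters_cut X k u _ v Y.
  have := uLE; rewrite EE (perm_uniq (lD _)) cat_uniq => /and3P[_ /hasPn/(_ _ ll) + _].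
  have : l \in letters E by rewrite EE (perm_mem (lD _)) mem_cat ll orbT.
  move/cE => /(_ lc); rewrite !inE => /orP[/eqP El|/eqP->]; first by rewrite El in ul.
  by case: (g); rewrite !inE eqxx ?orbT.
have EE2 : E2 = X ++ (k, u ++ (if g then [:: (b, Under sb); (c, Under sc)]
                          else [:: (c, Under sc); (b, Under sb)]) ++ v) :: Y.
  by rewrite /E2 EE swap_adjacent_if // -EE.
rewrite tE EE2; apply: transportable_local.
  by rewrite -tE names_detour.
rewrite -tE => e chi V x _; split; last by case: (g); apply: overs_fit_unders.
have [tab Eab] := adjacent_overs_if V topE'.
(* Modulo the next layer the strand over [a] may be replaced by that over [b],
   and then the two extra undercrossings at [b] cancel. *)
pose o1 c1 := if c1 == a then over chi b else over chi c1.
have oo1 : eqo e (over chi) o1.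
  by move=> c1; rewrite /o1; case: eqP => // ->.
apply: eqm_trans (run_over _ _ _ oo1) _.
apply: eqm_trans (eqm_sym (run_over _ _ _ oo1)).
have -> : run o1 (ty k) x (detour_word a c d (if g then [:: (c, Under sc); (b, Under sb)]
      else [:: (b, Under sb); (c, Under sc)])) =
    run o1 (ty k) x (detour_word b c d (if g then [:: (c, Under sc); (b, Under sb)]
      else [:: (b, Under sb); (c, Under sc)])).
  have o1ab s z : pass o1 (ty k) z (a, Under s) = pass o1 (ty k) z (b, Under s).
    by rewrite /pass /o1 /= eqxx eq_sym (negPf nab).
  by case: (g); rewrite /detour_word /detour_letter /= eqxx (negPf nbc) /= !o1ab.
suff -> : run o1 (ty k) x (detour_word b c d (if g then [:: (c, Under sc); (b, Under sb)]
      else [:: (b, Under sb); (c, Under sc)])) =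
    run o1 (ty k) x (if g then [:: (b, Under sb); (c, Under sc)]
      else [:: (c, Under sc); (b, Under sb)]) by apply: eqm_refl.
rewrite /d sgn; case: (g); rewrite /detour_word /detour_letter /= eqxx (negPf nbc) /=.
  pose y := pass o1 (ty k) (pass o1 (ty k) x (b, Under (~~ ~~ sb))) (c, Under sc).
  by have := run_cancel o1 (ty k) y b (~~ sb) [::]; rewrite /y negbK.
exact: (run_cancel o1 (ty k) x b sb [:: (c, Under sc); (b, Under sb)]).
Qed.

(** * Cutting curves open away from given arcs *)

Lemma transportable_rotate_map (I : Type) (s : seq I) (n r : I -> nat)
    (g : I -> seq letter) :
  uniq (names [seq (n i, g i) | i <- s]) ->
  transportable [seq (n i, g i) | i <- s] [seq (n i, rot (r i) (g i)) | i <- s] /\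
  transportable [seq (n i, rot (r i) (g i)) | i <- s] [seq (n i, g i) | i <- s].
Proof.
move=> uD; suff H X : uniq (names (X ++ [seq (n i, g i) | i <- s])) ->
    transportable (X ++ [seq (n i, g i) | i <- s])
      (X ++ [seq (n i, rot (r i) (g i)) | i <- s]) /\
    transportable (X ++ [seq (n i, rot (r i) (g i)) | i <- s])
      (X ++ [seq (n i, g i) | i <- s]) by exact: (H [::]).
elim: s X {uD} => [|i s IH] X uX /=; first by split; apply: transportable_refl.
have uX' : uniq (names (rcons X (n i, rot (r i) (g i)) ++ [seq (n i, g i) | i <- s])).
  by rewrite cat_rcons (names_replace _ _ _ _ (g i)).
have [IH1 IH2] := IH _ uX'; rewrite !cat_rcons in IH1 IH2.
split; first exact: transportable_trans (transportable_rot _ uX) IH1.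
exact: transportable_trans IH2 (transportable_unrot _ uX).
Qed.

Definition keep (p : pred letter) D : diagram := [seq (z.1, filter p z.2) | z <- D].

Lemma names_keep p D : names (keep p D) = names D.
Proof. by rewrite /names -map_comp; apply: eq_map. Qed.

Lemma letters_keep p D : letters (keep p D) = filter p (letters D).
Proof.
rewrite /letters /keep -map_comp; elim: D => //= z D IH.
by rewrite filter_cat -IH.
Qed.

Lemma letters_rotate_perm r D : perm_eq (letters (rotate r D)) (letters D).
Proof.
rewrite /letters /rotate -map_comp; elim: D => //= z D IH.
by apply: perm_cat => //; rewrite perm_rot.
Qed.

Lemma filter_rot (T : Type) (p : pred T) n (s : seq T) :
  filter p (rot n s) = rot (size (filter p (take n s))) (filter p s).
Proof.
have := rot_size_cat (filter p (take n s)) (filter p (drop n s)).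
by rewrite -filter_cat cat_take_drop => ->; rewrite -filter_cat.
Qed.

(** Deleting letters before or after a change of base points differs by a change of
    base points. *)
Lemma transportable_keep_rotate p r D : uniq (names D) ->
  transportable (keep p D) (keep p (rotate r D)) /\
  transportable (keep p (rotate r D)) (keep p D).
Proof.
move=> uD.
have -> : keep p (rotate r D) = [seq (z.1, rot (size (filter p (take (r z.1) z.2)))
    (filter p z.2)) | z <- D].
  by rewrite /keep /rotate -map_comp; apply: eq_map => z /=; rewrite filter_rot.
by apply: transportable_rotate_map; rewrite names_keep.
Qed.

Lemma map_letters_rotate f r D :
  map_letters f (rotate r D) = rotate r (map_letters f D).
Proof.
by rewrite /map_letters /rotate -!map_comp; apply: eq_map => z /=; rewrite map_rot.
Qed.

Lemma curve_throughE D k w l : uniq (letters D) -> (k, w) \in D -> l \in w ->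
  curve_through D l = w.
Proof.
rewrite /curve_through /letters; elim: D => //= -[k0 w0] D IH.
rewrite cat_uniq => /and3P[_ /hasPn n0 uD]; rewrite in_cons => /predU1P[[_ <-] -> //|Dw wl].
have /n0 : l \in letters D by apply: mem_letters Dw wl.
by move/negPf=> -> /=; apply: IH.
Qed.

Lemma next_cut (T : eqType) (u v : seq T) (l : T) : uniq (u ++ l :: v) ->
  next (u ++ l :: v) l = head (head l u) v.
Proof.
move=> us; rewrite next_nth mem_cat mem_head orbT.
have lu : l \notin u.
  by move: us; rewrite cat_uniq /= negb_or => /and3P[_ /andP[]].
case: u lu {us} => [|y u] /= lu; first by rewrite eqxx; case: v.
rewrite in_cons negb_or eq_sym in lu; case/andP: lu => /negPf-> /negPf lu.
by rewrite index_cat lu /= eqxx addn0 nth_cat ltnNge leqnSn /= subSnn; case: v.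
Qed.

(** Base points can be chosen away from finitely many short arcs: start each
    curve at the beginning of one of them. *)
Lemma linearize D (P : seq (letter * letter)) : uniq (names D) -> uniq (letters D) ->
  (forall z, z \in P -> z.1 \in letters D /\ following D z.1 = z.2) ->
  (forall z z', z \in P -> z' \in P -> z.2 != z'.1) ->
  exists r, forall z, z \in P -> adjacent (rotate r D) z.1 z.2.
Proof.
move=> uD uL PD dP; pose F := [seq z.1 | z <- P].
exists (fun k => find (mem F) (curve_named D k)) => -[l l'] Pz /=.
have [/lettersP[k [w [Dw wl]]]] := PD _ Pz.
rewrite /following (curve_throughE uL Dw wl) /= => nl.
pose i := find (mem F) w.
have Fl : l \in F by apply/mapP; exists (l, l').
have iw : i < size w by rewrite -has_find; apply/hasP; exists l.
have uw : uniq w by exact: curve_letters_uniq uL Dw.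
have Ew : rot i w = nth l w i :: (drop i.+1 w ++ take i w).
  by rewrite /rot (drop_nth l iw).
have Fx : nth l w i \in F by have := nth_find l (a := mem F) (s := w); apply; rewrite has_find.
have uw' : uniq (rot i w) by rewrite rot_uniq.
have wl' : l \in rot i w by rewrite mem_rot.
have nl' : next (rot i w) l = l' by rewrite next_rot.
have [u [v Euv]] : exists u v, rot i w = u ++ l :: v.
  by case/path.splitPr: wl' => u v; exists u, v.
move: nl'; rewrite Euv next_cut -?Euv //.
have hu : head l u = nth l w i.
  by have : head l (rot i w) = nth l w i; [rewrite Ew | rewrite Euv; case: (u)].
rewrite hu; case: v Euv => [|y v] Euv /= El'.
  by case/mapP: Fx => z' Pz' Ez'; have := dP _ _ Pz Pz'; rewrite /= -El' Ez' eqxx.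
have Dr : (k, rot i w) \in rotate (fun k => find (mem F) (curve_named D k)) D.
  by apply/mapP; exists (k, w); rewrite //= (curve_namedE uD Dw).
rewrite Euv El' in Dr; case/path.splitPr: Dr => X Y.
by exists X, k, u, v, Y.
Qed.

(** * The first Reidemeister move *)

Lemma keep_cut (p : pred letter) X k u P v Y : ~~ has p P ->
  all p (letters (X ++ (k, u ++ v) :: Y)) ->
  keep p (X ++ (k, u ++ P ++ v) :: Y) = X ++ (k, u ++ v) :: Y.
Proof.
rewrite has_filter negbK /letters map_cat flatten_cat /= !all_cat.
move=> /eqP EP /andP[aX /andP[/andP[au av] aY]].
have id_on Z : all p (letters Z) -> keep p Z = Z.
  move=> aZ; rewrite -[RHS]map_id; apply/eq_in_map => -[k1 w] Zw /=; congr pair.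
  by apply/all_filterP/allP => l wl; apply: (allP aZ); apply: mem_letters wl; apply: Zw.
rewrite /keep map_cat /= !filter_cat EP -!/(keep _ _) !id_on //.
by rewrite !(all_filterP _).
Qed.

Lemma adjacent_keep (q : pred letter) D p1 p2 : adjacent D p1 p2 -> q p1 -> q p2 ->
  adjacent (keep q D) p1 p2.
Proof.
move=> [X [k [u [v [Y ->]]]]] q1 q2.
exists (keep q X), k, (filter q u), (filter q v), (keep q Y).
by rewrite /keep map_cat /= !filter_cat /= q1 q2.
Qed.

Lemma keep_keep p q D : keep p (keep q D) = keep [predI p & q] D.
Proof.
by rewrite /keep -map_comp; apply: eq_map => z /=; rewrite -filter_predI.
Qed.

Lemma eq_in_keep (p q : pred letter) D : {in letters D, p =1 q} -> keep p D = keep q D.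
Proof.
move=> pq; apply/eq_in_map => -[k w] Dw /=; congr pair; apply: eq_in_filter => l wl.
exact/pq/(mem_letters Dw).
Qed.

Lemma wf_cross D : well_formed D -> {in letters D &, forall l l',
  l.1 = l'.1 -> l' \in [:: l; twin l]}.
Proof.
case/and4P=> _ _ _ /allrelP H l l' Dl Dl' E.
by apply: (implyP (H l l' Dl Dl')); rewrite E.
Qed.

Lemma wf_twin D : well_formed D -> {in letters D, forall l, twin l \in letters D}.
Proof. by case/and4P=> _ _ /allP. Qed.

Lemma twinK : involutive twin.
Proof. by case=> c [s|s|s] //; rewrite /twin /= negbK. Qed.

Lemma twin_neq l : twin l != l.
Proof. by apply/eqP; case: l => c [s|s|s] // []; case: s. Qed.

(** An arc passing under itself: the conjugation does nothing to its own meridian,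
    and for a state [x] the compensating factor gives [A^-s x (A ^ x)^s = x]. *)
Lemma pass_self e o t x c s : (o c).2 = t -> eqm K e.+1 (meridian t x) (o c).1 ->
  eqm K (level t e).+1 (pass o t x (c, Under s)) x.
Proof.
rewrite /pass /= => ->; case: t => /= E.
  have {}E := eqm_gpow s (eqm_sym E); apply: eqm_trans (eqmMl _ E) _.
  rewrite gpowJ /conjg; case: s {E} => /=; rewrite !mulgA ?mulgK ?mulKg.
    by rewrite !gnorm.
  by rewrite !gnorm.
have {}E := eqm_gpow s (eqm_sym E); apply: eqm_trans (eqmJr x E) _.
by case: s {E} => /=; rewrite /conjg ?invgK !gnorm.
Qed.

Lemma kink_fits e o t x c s : (o c).2 = t -> eqm K e.+1 (meridian t x) (o c).1 ->
  eqm K e.+1 (meridian t (pass o t x (c, Under s))) (o c).1.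
Proof.
move=> ct E; apply: (eqm_trans _ E); apply: meridian_eqm; apply/eqmW.
exact: pass_self.
Qed.

Lemma kink_fitsV e o t x c s : (o c).2 = t ->
  eqm K e.+1 (meridian t (pass o t x (c, Under s))) (o c).1 ->
  eqm K e.+1 (meridian t x) (o c).1.
Proof.
rewrite meridian_pass => ct /(eqmJ)/(_ (eqm_refl _ _ (gpow (o c).1 s)^-1)).
rewrite conjgK => /eqm_trans; apply.
by rewrite /conjg; case: s => /=; rewrite ?invgK !gnorm.
Qed.

Lemma transportable_kink X Y k u v P c s :
  P = [:: (c, Over s); (c, Under s)] \/ P = [:: (c, Under s); (c, Over s)] ->
  uniq (names (X ++ (k, u ++ P ++ v) :: Y)) ->
  c \notin crossings (X ++ (k, u ++ v) :: Y) ->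
  transportable (X ++ (k, u ++ P ++ v) :: Y) (X ++ (k, u ++ v) :: Y) /\
  transportable (X ++ (k, u ++ v) :: Y) (X ++ (k, u ++ P ++ v) :: Y).
Proof.
move=> HP uD cD.
have uD1 : uniq (names (X ++ (k, u ++ [:: (c, Over s)] ++ v) :: Y)).
  by rewrite (names_replace _ _ _ _ (u ++ P ++ v)).
have uD2 : uniq (names (X ++ (k, u ++ v) :: Y)).
  by rewrite (names_replace _ _ _ _ (u ++ P ++ v)).
split.
  apply: (@transportable_trans _ (X ++ (k, u ++ [:: (c, Over s)] ++ v) :: Y)).
    apply: transportable_local => // e chi _ x.
    case: HP => -> /= [H].
      by move=> _; split=> //; apply: pass_self; case: H.
    case=> -[ct cE] _; have {}cE := kink_fitsV ct cE.
    by split=> //; apply: pass_self.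
  by rewrite -[v in X in transportable _ X]cat0s; apply: transportable_local.
apply: (@transportable_trans _ (X ++ (k, u ++ [:: (c, Over s)] ++ v) :: Y)).
  exact: transportable_new_over.
apply: transportable_local => // e chi _ x /= [[ct cE] _].
have sE := eqm_sym (pass_self s ct cE).
case: HP => -> /=; split=> //; split=> //; split=> //; split=> //.
exact: kink_fits ct cE.
Qed.

Lemma crossings_cut D X k u P v Y c : well_formed D ->
  perm_eq (letters (X ++ (k, u ++ P ++ v) :: Y)) (letters D) ->
  (exists2 l, l \in letters D & l.1 = c /\ {subset [:: l; twin l] <= P}) ->
  c \notin crossings (X ++ (k, u ++ v) :: Y).
Proof.
move=> wfD pD [l Dl [lc lP]]; apply/mapP => -[l' Dl' El].
have pL := letters_cut X k u P v Y; have [_ uL _ _] := and4P wfD.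
have Dl2 : l' \in letters D by rewrite -(perm_mem pD) (perm_mem pL) mem_cat Dl' orbT.
have /lP l'P : l' \in [:: l; twin l] by apply: (wf_cross wfD) => //; rewrite lc.
move: uL; rewrite -(perm_uniq pD) (perm_uniq pL) cat_uniq => /and3P[_ /hasPn/(_ _ Dl')].
by rewrite /= l'P.
Qed.

(** A curl carries one colour throughout, by [pass_self]; conversely the colour of a
    new curl is read off from the arc it is put on. *)
Lemma transportable_first D l : well_formed D -> l \in letters D -> ~~ is_virtual l ->
  following D l = twin l ->
  transportable D (erase [:: l.1] D) /\ transportable (erase [:: l.1] D) D.
Proof.
move=> wfD Dl nv fl; have [uD uL _ _] := and4P wfD.
have [||r adj] := @linearize D [:: (l, twin l)] uD uL.
- by move=> z; rewrite inE => /eqP->.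
- by move=> z z'; rewrite !inE => /eqP-> /eqP->; apply: twin_neq.
have {}adj := adj _ (mem_head _ _).
have [tr1 tr2] := transportable_rotate r uD.
pose q l' := l'.1 \notin [:: l.1].
have [tr3 tr4] := transportable_keep_rotate q r uD.
have [X [k [u [v [Y ED]]]]] : adjacent (rotate r D) l (twin l) := adj.
have uR : uniq (names (rotate r D)) by rewrite names_rotate.
have pR := letters_rotate_perm r D.
rewrite ED in uR pR.
have cD : l.1 \notin crossings (X ++ (k, u ++ v) :: Y).
  by apply: (crossings_cut wfD pR); exists l => //; split=> // z.
have cut_q : keep q (rotate r D) = X ++ (k, u ++ v) :: Y.
  rewrite ED; apply: keep_cut; first by rewrite /q /= !inE eqxx.
  by apply/allP => l' Dl'; rewrite /q inE; apply: contraNneq cD => <-; apply: map_f.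
have [c [s [cl HP]]] : exists c s, c = l.1 /\ (
    [:: l; twin l] = [:: (c, Over s); (c, Under s)] \/
    [:: l; twin l] = [:: (c, Under s); (c, Over s)]).
  by case: (l) nv => c [s|s|s] // _; exists c, s; split=> //; [left|right].
rewrite -cl in cD; have [tr5 tr6] := transportable_kink HP uR cD.
rewrite -{}cut_q -{}ED in tr5 tr6.
split; first exact: transportable_trans tr1 (transportable_trans tr5 tr4).
exact: transportable_trans tr3 (transportable_trans tr6 tr2).
Qed.

(** * The second Reidemeister move *)

(** Modulo the next layer the two upper colours may be taken equal, and then the two
    passages are mutually inverse. *)
Lemma run_cancel_unders e o t z a b s p q : (o a).2 = (o b).2 ->
  eqm K e.+1 (o a).1 (o b).1 ->
  (p = (a, Under s) /\ q = (b, Under (~~ s))) \/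
  (p = (b, Under (~~ s)) /\ q = (a, Under s)) ->
  eqm K (level t e).+1 (run o t z [:: p; q]) z.
Proof.
move=> tab Eab Hpq; pose o1 c1 := if c1 == a then o b else o c1.
have oo1 : eqo e o o1 by move=> c1; rewrite /o1; case: eqP => // ->.
apply: eqm_trans (run_over _ _ _ oo1) _.
suff -> : run o1 t z [:: p; q] = z by apply: eqm_refl.
have [/eqP E|nab] := eqVneq a b.
  case: Hpq => -[-> ->]; rewrite (eqP E); first exact: run_cancel.
  by have := run_cancel o1 t z b (~~ s) [::]; rewrite negbK.
have o1ab s' y : pass o1 t y (a, Under s') = pass o1 t y (b, Under s').
  by rewrite /pass /o1 /= eqxx eq_sym (negPf nab).
case: Hpq => -[-> ->]; rewrite /= !o1ab.
  exact: (run_cancel o1 t z b s [::]).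
by have := run_cancel o1 t z b (~~ s) [::]; rewrite negbK.
Qed.

(** Remove the two undercrossings first: they cancel because the two overcrossings
    are adjacent on one arc.  Then the two overcrossings affect no other colour. *)
Lemma transportable_second D a b s : well_formed D ->
  (a, Over s) \in letters D -> (b, Over (~~ s)) \in letters D ->
  following D (a, Over s) = (b, Over (~~ s)) ->
  following D (a, Under s) = (b, Under (~~ s)) \/
  following D (b, Under (~~ s)) = (a, Under s) ->
  transportable D (erase [:: a; b] D) /\ transportable (erase [:: a; b] D) D.
Proof.
move=> wfD Da Db fo fu; have [uD uL _ _] := and4P wfD.
have nab : a != b.
  apply/eqP => E; have := wf_cross wfD Da Db E.
  by rewrite !inE E => /orP[] /eqP[]; case: (s).
have Dua := wf_twin wfD Da; have Dub := wf_twin wfD Db.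
rewrite /twin /= in Dua Dub.
have [p [q [Hpq [Dp [fp npq]]]]] : exists p q,
    ((p = (a, Under s) /\ q = (b, Under (~~ s))) \/
    (p = (b, Under (~~ s)) /\ q = (a, Under s))) /\
    p \in letters D /\ following D p = q /\ q != p.
  case: fu => fu; [exists (a, Under s), (b, Under (~~ s)) |
    exists (b, Under (~~ s)), (a, Under s)]; rewrite fu xpair_eqE ?(negPf nab).
    by split; [left | rewrite eq_sym (negPf nab)].
  by split; [right | ].
have [up uq] : is_under p /\ is_under q by case: Hpq => -[-> ->].
pose Oa := (a, Over s) : letter; pose Ob := (b, Over (~~ s)) : letter.
have [||r adj] := @linearize D [:: (Oa, Ob); (p, q)] uD uL.
- by move=> z; rewrite !inE => /orP[]/eqP->.
- have neq_ou l l' : is_under l -> is_over l' -> l != l'.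
    by move=> ul ol; apply: contraTneq ul => ->; case: l' ol => c [].
  move=> z z'; rewrite !inE => /orP[]/eqP-> /orP[]/eqP-> //=.
  + by rewrite xpair_eqE eq_sym (negPf nab).
  + by rewrite eq_sym neq_ou.
  + by rewrite neq_ou.
have adjO : adjacent (rotate r D) Oa Ob by apply: (adj (Oa, Ob)); rewrite mem_head.
have adjU : adjacent (rotate r D) p q by apply: (adj (p, q)); rewrite !inE eqxx orbT.
have [tr1 tr2] := transportable_rotate r uD.
pose kill l := l.1 \notin [:: a; b].
have [tr3 tr4] := transportable_keep_rotate kill r uD.
have uR : uniq (names (rotate r D)) by rewrite names_rotate.
have pR := letters_rotate_perm r D.
have [X [k [u [v [Y ED]]]]] := adjU.
pose D1 := X ++ (k, u ++ v) :: Y.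
pose killU l := ~~ (is_under l && (l.1 \in [:: a; b])).
have D1E : keep killU (rotate r D) = D1.
  rewrite ED; apply: keep_cut.
    by case: Hpq => -[-> ->]; rewrite /= /killU /= !inE !eqxx ?orbT.
  apply/allP => l Dl; apply/negP => /andP[ul lab].
  have pL := letters_cut X k u [:: p; q] v Y.
  have Dl' : l \in letters D.
    by rewrite -(perm_mem pR) ED (perm_mem pL) mem_cat Dl orbT.
  have : l \in [:: p; q].
    move: lab; rewrite !inE => /orP[]/eqP lab.
      have := wf_cross wfD Dua Dl' (esym lab); rewrite !inE => /orP[]/eqP El.
        by case: Hpq => -[-> ->]; rewrite El eqxx ?orbT.
      by rewrite El in ul.
    have := wf_cross wfD Dub Dl' (esym lab); rewrite !inE => /orP[]/eqP El.
      by case: Hpq => -[-> ->]; rewrite El eqxx ?orbT.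
    by rewrite El in ul.
  move: uL; rewrite -(perm_uniq pR) ED (perm_uniq pL) cat_uniq => /and3P[_ /hasPn/(_ _ Dl)].
  by rewrite /= => /negPf->.
have adjO1 : adjacent D1 Oa Ob by rewrite -D1E; apply: adjacent_keep.
have uD1 : uniq (names D1) by rewrite -D1E names_keep.
have uX : uniq (names (X ++ (k, u ++ [:: p; q] ++ v) :: Y)) by rewrite -ED.
have [tr5 tr6] : transportable (rotate r D) D1 /\ transportable D1 (rotate r D).
  rewrite ED; split.
    rewrite /D1 -{2}[v]cat0s; apply: transportable_local => // e chi V x _; split=> //.
    rewrite -ED in V; have [tab Eab] := adjacent_overs V adjO erefl erefl.
    exact: run_cancel_unders tab Eab Hpq.
  rewrite /D1 -{1}[v]cat0s; apply: transportable_local => // e chi V x _; split=> //.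
    have [tab Eab] := adjacent_overs V adjO1 erefl erefl.
    by apply: eqm_sym; apply: run_cancel_unders tab Eab Hpq.
  by apply: overs_fit_unders; rewrite /= up uq.
have [X' [k' [u' [v' [Y' ED1]]]]] := adjO1.
pose D2 := X' ++ (k', u' ++ v') :: Y'.
have D2E : keep kill D1 = D2.
  rewrite ED1; apply: keep_cut; first by rewrite /= /kill !inE !eqxx ?orbT.
  apply/allP => l Dl; apply/negP => lab.
  have pL := letters_cut X' k' u' [:: Oa; Ob] v' Y'.
  have Dl1 : l \in letters D1 by rewrite ED1 (perm_mem pL) mem_cat Dl orbT.
  have /andP[lU Dl'] : killU l && (l \in letters D).
    by move: Dl1; rewrite -D1E letters_keep mem_filter (perm_mem pR).
  have : l \in [:: Oa; Ob].
    move: lab; rewrite !inE => /orP[]/eqP lab.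
      have := wf_cross wfD Da Dl' (esym lab); rewrite !inE => /orP[]/eqP El.
        by rewrite El eqxx.
      by move: lU; rewrite El /killU /= !inE eqxx.
    have := wf_cross wfD Db Dl' (esym lab); rewrite !inE => /orP[]/eqP El.
      by rewrite El eqxx orbT.
    by move: lU; rewrite El /killU /= !inE eqxx orbT.
  have : uniq (letters D1).
    by rewrite -D1E letters_keep filter_uniq // (perm_uniq pR).
  rewrite ED1 (perm_uniq pL) cat_uniq => /and3P[_ /hasPn/(_ _ Dl)].
  by rewrite /= => /negPf->.
have fresh c : c \in [:: a; b] -> c \notin crossings D2.
  rewrite -D2E => cab; apply/mapP => -[l]; rewrite letters_keep mem_filter => /andP[kl _] cl.
  by rewrite /kill -cl cab in kl.
have uX' : uniq (names (X' ++ (k', u' ++ [:: Oa; Ob] ++ v') :: Y')) by rewrite -ED1.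
have uX2 : uniq (names D2) by rewrite -D2E names_keep.
have [tr7 tr8] : transportable D1 D2 /\ transportable D2 D1.
  rewrite ED1; split.
    rewrite /D2 -{2}[v']cat0s; exact: transportable_local.
  apply: (@transportable_trans _ (X' ++ (k', u' ++ [:: Ob] ++ v') :: Y')).
  - by apply: transportable_new_over => //; apply: fresh; rewrite !inE eqxx orbT.
  - apply: transportable_new_over; first by rewrite (names_replace _ _ _ _ (u' ++ v')).
    apply/mapP => -[l]; rewrite (perm_mem (letters_cut _ _ _ [:: Ob] _ _)) mem_cat.
    rewrite inE => /orP[/eqP-> /= E|Dl E]; first by rewrite E eqxx in nab.
    by have := fresh a (mem_head _ _); rewrite E map_f.
have D2D : keep kill (rotate r D) = D2.
  rewrite -D2E -D1E keep_keep; apply: eq_in_keep => l _ /=.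
  rewrite /kill /killU; case E: (l.1 \in [:: a; b]);
    by rewrite ![l \in (fun _ => _)]unfold_in E ?andbF.
rewrite -D2D in tr7 tr8.
split; first exact: transportable_trans tr1 (transportable_trans tr5 (transportable_trans tr7 tr4)).
exact: transportable_trans tr3 (transportable_trans tr8 (transportable_trans tr6 tr2)).
Qed.

(** * Triangular faces, detours, and all moves *)

Lemma adjacent_ifN b D p q : adjacent_if (~~ b) D p q = adjacent_if b D q p.
Proof. by case: b. Qed.

Lemma swap_swap p q p' q' l : uniq [:: p; q; p'; q'] ->
  swap p q (swap p' q' l) = swap p' q' (swap p q l).
Proof.
rewrite /= !inE !negb_or -!andbA => /and5P[npq np np' nq /and3P[nq' npq' _]].
have [->|lp] := eqVneq l p; first by rewrite swapL !(@swap_id p' q') // swapL.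
have [->|lq] := eqVneq l q; first by rewrite swapR !(@swap_id p' q') // swapR.
rewrite (swap_id lp lq).
have [->|lp'] := eqVneq l p'; first by rewrite swapL swap_id // eq_sym.
have [->|lq'] := eqVneq l q'; first by rewrite swapR swap_id // eq_sym.
by rewrite !swap_id.
Qed.

Lemma transportable_swap_virtual b D p q : uniq (names D) -> uniq (letters D) ->
  is_virtual q -> ~~ is_over p -> adjacent_if b D p q ->
  transportable D (map_letters (swap p q) D).
Proof.
move=> uD uL vq op /adjacent_if_cut[X [k [u [v [Y ED]]]]]; subst.
rewrite swap_adjacent_if //; apply: transportable_local => // e chi _ x.
case: p q vq op {uD uL} => [c [s|s|s]] [c' [s'|s'|s']] // _ _; case: b => _;
  by split=> //; exact: (eqm_refl K _ _).
Qed.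

Definition slide3 (a b : nat) (sa sb : bool) (q : letter) : letter -> letter :=
  swap (a, Over sa) (b, Over sb) \o
  (swap (b, Under sb) q \o swap (twin q) (a, Under sa)).

(** The letter [q] and its twin are the crossing opposite to the top strand.  If it
    is classical, [transportable_triangle] applies with the middle strand being
    the one that passes over at [q]; if it is virtual, the three interchanges of
    adjacent letters are harmless one by one. *)
Lemma transportable_slide3 D a b sa sb q h0 h1 h2 :
  uniq (names D) -> uniq (letters D) -> uniq [:: a; b; q.1] ->
  {in letters D, forall l, l.1 = q.1 -> l \in [:: q; twin q]} ->
  adjacent_if h0 D (a, Over sa) (b, Over sb) ->
  adjacent_if h1 D (b, Under sb) q ->
  adjacent_if h2 D (twin q) (a, Under sa) ->
  h1 = (sb == ~~ h0) -> h0 = (sa == h2) ->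
  transportable D (map_letters (slide3 a b sa sb q) D).
Proof.
move=> uD uL uabc cD adj0 adj1 adj2 E1 E2.
have uabc' : uniq [:: b; a; q.1].
  by move: uabc; rewrite /= !inE !negb_or [b == a]eq_sym; case: eqP; case: eqP; case: eqP.
rewrite /slide3 -(map_letters_comp _ (swap _ _ \o swap _ _)) -(map_letters_comp (swap _ _) (swap _ _)).
have swC p p' D1 : map_letters (swap p p') D1 = map_letters (swap p' p) D1.
  by apply: eq_map_letters => l _; apply: swapC.
have uswap f D1 : uniq (letters D1) -> uniq (letters (map_letters (swap f.1 f.2) D1)).
  by rewrite letters_map map_inj_uniq //; apply/inv_inj/swapK.
have neq1 (l l' : letter) : l.1 != l'.1 -> l != l' by apply: contraNneq => ->.
have [nab [naq nbq]] : a != b /\ a != q.1 /\ b != q.1.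
  by move: uabc; rewrite /= !inE !negb_or andbT => /andP[/andP[]].
have dist : uniq [:: (b, Under sb); q; twin q; (a, Under sa)].
  have d1 : (b, Under sb) != q by apply: neq1.
  have d2 : (b, Under sb) != twin q by apply: neq1.
  have d3 : (b, Under sb) != (a, Under sa) by apply: neq1; rewrite eq_sym.
  have d4 : q != twin q by rewrite eq_sym twin_neq.
  have d5 : q != (a, Under sa) by apply: neq1; rewrite eq_sym.
  have d6 : twin q != (a, Under sa) by apply: neq1; rewrite eq_sym.
  by rewrite /= !inE !negb_or d1 d2 d3 d4 d5 d6.
case Eq: q => [c [sc|sc|sc]]; rewrite /twin /= -/(twin _).
- rewrite (swC (a, Over sa)); rewrite Eq /twin /= in uabc uabc' cD adj1 adj2 dist.
   have -> : map_letters (swap (b, Under sb) (c, Over sc))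
      (map_letters (swap (c, Under sc) (a, Under sa)) D) =
    map_letters (swap (c, Under sc) (a, Under sa))
      (map_letters (swap (b, Under sb) (c, Over sc)) D).
    by rewrite !map_letters_comp; apply: eq_map_letters => l _; apply: swap_swap.
  apply: (@transportable_triangle _ (~~ h0) h1 h2) => //.
    by rewrite adjacent_ifN.
  by move: E1 E2; case: (h0) (h1) (h2) (sa) (sb) => [] [] [] [] [].
- rewrite (swC (b, Under sb)) (swC (c, Over sc)).
  rewrite Eq /twin /= in uabc uabc' cD adj1 adj2 dist.
  apply: (@transportable_triangle _ h0 (~~ h2) (~~ h1)) => //.
  + by move=> l Dl /(cD l Dl); rewrite !inE orbC.
  + by rewrite adjacent_ifN.
  + by rewrite adjacent_ifN.
  + by move: E1 E2; case: (h0) (h1) (h2) (sa) (sb) => [] [] [] [] [].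
- rewrite (swC (c, Virtual (~~ sc))).
  rewrite Eq /twin /= in uabc uabc' cD adj1 adj2 dist naq nbq.
  have tr1 : transportable D (map_letters (swap (a, Under sa) (c, Virtual (~~ sc))) D).
    by apply: (@transportable_swap_virtual (~~ h2)) => //; rewrite adjacent_ifN.
  set D1 := map_letters _ D in tr1 *.
  have uD1 : uniq (names D1) by rewrite names_map_letters.
  have uL1 : uniq (letters D1) by apply: (uswap ((_, _), (_, _))).
  have adj01 : adjacent_if h0 D1 (a, Over sa) (b, Over sb).
    have := adjacent_if_map (swap (a, Under sa) (c, Virtual (~~ sc))) adj0.
    by rewrite !swap_id //; (try by apply/eqP => -[]);
      rewrite neq1 //= eq_sym.
  have adj11 : adjacent_if h1 D1 (b, Under sb) (c, Virtual sc).
    have := adjacent_if_map (swap (a, Under sa) (c, Virtual (~~ sc))) adj1.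
    by rewrite !swap_id //; (try by apply/eqP => -[]; case: (sc));
      rewrite neq1 //= eq_sym.
  have tr2 : transportable D1 (map_letters (swap (b, Under sb) (c, Virtual sc)) D1).
    exact: (@transportable_swap_virtual h1).
  apply: transportable_trans tr1 (transportable_trans tr2 _).
  apply: (@transportable_swap_overs h0); rewrite ?names_map_letters //.
    by apply: (uswap ((_, _), (_, _))).
  have := adjacent_if_map (swap (b, Under sb) (c, Virtual sc)) adj01.
  by rewrite !swap_id //; (try by apply/eqP => -[]); rewrite neq1 //= eq_sym.
Qed.

(** The other end of the edge leaving the crossing of [l] forwards or backwards. *)
Definition toward D h l := if h then following D l else preceding D l.

Lemma toward_letters D h l : uniq (letters D) -> l \in letters D ->
  toward D h l \in letters D /\
  (if h then following D l = toward D h l else following D (toward D h l) = l).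
Proof.
move=> uL Dl; have [k [w [Dw wl]]] := lettersP D l Dl.
have uw : uniq w by exact: curve_letters_uniq uL Dw.
rewrite /toward; case: h; rewrite /following /preceding (curve_throughE uL Dw wl).
  by split=> //; apply: mem_letters Dw _; rewrite mem_next.
have wp : prev w l \in w by rewrite mem_prev.
by rewrite (curve_throughE uL Dw wp) next_prev //; split=> //; apply: mem_letters Dw _.
Qed.

Lemma toward_outside D h l : l \notin letters D -> toward D h l = l.
Proof.
move=> nDl; have C : curve_through D l = [::].
  rewrite /curve_through nth_default // leqNgt -has_find.
  apply/hasP => -[w Dw wl]; case/negP: nDl; by apply/flattenP; exists w.
by rewrite /toward /following /preceding C; case: h.
Qed.

Lemma swap3_spec p0 q0 p1 q1 p2 q2 : uniq [:: p0; q0; p1; q1; p2; q2] ->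
  let s l := swap p0 q0 (swap p1 q1 (swap p2 q2 l)) in
  [/\ s p0 = q0 /\ s q0 = p0, s p1 = q1 /\ s q1 = p1, s p2 = q2 /\ s q2 = p2
    & involutive s].
Proof.
rewrite /= !inE !negb_or -!andbA.
case/and5P=> n1 n2 n3 n4 /and5P[n5 n6 n7 n8 /and5P[n9 n10 n11 n12 /and4P[n13 n14 n15 _]]].
pose ns := (n1, n2, n3, n4, n5, n6, n7, n8, (n9, n10, n11, n12, n13, n14, n15)).
have i2 l : l = p0 \/ l = q0 \/ l = p1 \/ l = q1 -> swap p2 q2 l = l.
  by case=> [->|[->|[->|->]]]; rewrite swap_id ?ns.
have i1 l : l = p0 \/ l = q0 \/ l = p2 \/ l = q2 -> swap p1 q1 l = l.
  by case=> [->|[->|[->|->]]]; rewrite swap_id ?ns // eq_sym ns.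
have i0 l : l = p1 \/ l = q1 \/ l = p2 \/ l = q2 -> swap p0 q0 l = l.
  by case=> [->|[->|[->|->]]]; rewrite swap_id ?ns // eq_sym ns.
have c01 l : swap p0 q0 (swap p1 q1 l) = swap p1 q1 (swap p0 q0 l).
  by apply: swap_swap; rewrite /= !inE !negb_or !ns.
have c02 l : swap p0 q0 (swap p2 q2 l) = swap p2 q2 (swap p0 q0 l).
  by apply: swap_swap; rewrite /= !inE !negb_or !ns.
have c12 l : swap p1 q1 (swap p2 q2 l) = swap p2 q2 (swap p1 q1 l).
  by apply: swap_swap; rewrite /= !inE !negb_or !ns.
split; first 3 last.
- by move=> l /=; rewrite -c02 -c01 swapK -c12 swapK swapK.
- by rewrite !(i2 p0, i2 q0) ?(i1 p0, i1 q0) ?swapL ?swapR; auto.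
- by rewrite !(i2 p1, i2 q1) ?swapL ?swapR ?(i0 p1, i0 q1); auto 6.
- by rewrite swapL swapR ?(i1 p2, i1 q2) ?(i0 p2, i0 q2); auto 6.
Qed.

Lemma edgeE D l h : edge D (l, h) = (toward D h l, ~~ h).
Proof. by case: h. Qed.

Lemma faceE D l h :
  face D (l, h) = (twin (toward D h l), goes_left (toward D h l) == ~~ h).
Proof. by rewrite /face edgeE. Qed.

(** Going around the face gives the signs and directions of the three strands, and
    the turning rule at the two upper crossings is all that is used of the planar
    picture.  The slid triangle is again one of this kind with all orders
    reversed, so the inverse move is covered too. *)
Lemma transportable_slide D d : well_formed D -> triangle D d -> top_edge D d ->
  transportable D (slide D d) /\ transportable (slide D d) D.
Proof.
case: d => l0 h0 wfD; rewrite /triangle /top_edge !faceE edgeE /=.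
set m0 := toward D h0 l0; pose h1 := goes_left m0 == ~~ h0; rewrite -/h1.
set m1 := toward D h1 (twin m0); pose h2 := goes_left m1 == ~~ h1; rewrite -/h2.
set m2 := toward D h2 (twin m1) => -[[m2E h0E]].
rewrite !inE !negb_or andbT => /andP[/andP[c01 c02] c12].
case/andP=> over0 over1; have [uD uL _ _] := and4P wfD.
have Dl0 : l0 \in letters D.
  by apply/negPn/negP => /(@toward_outside _ h0) nl; rewrite /m0 nl eqxx in c01.
have [Dm0 f0] := toward_letters h0 uL Dl0; rewrite -/m0 in Dm0 f0.
have Dl1 := wf_twin wfD Dm0.
have [Dm1 f1] := toward_letters h1 uL Dl1; rewrite -/m1 in Dm1 f1.
have Dl2 := wf_twin wfD Dm1.
have [Dm2 f2] := toward_letters h2 uL Dl2; rewrite -/m2 in Dm2 f2.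
have slE : slide D (l0, h0) = map_letters (fun l =>
    swap l0 m0 (swap (twin m0) m1 (swap (twin m1) m2 l))) D.
  by rewrite /slide /swap_ends !faceE !edgeE.
rewrite slE; have {}m2E : m2 = twin l0 by rewrite -m2E twinK.
clearbody m2; subst m2.
have [a [sa El0]] : exists a sa, l0 = (a, Over sa).
  by case: (l0) over0 => a [sa|sa|sa] // _; exists a, sa.
have [b [sb Em0]] : exists b sb, m0 = (b, Over sb).
  by case: (m0) over1 => b [sb|sb|sb] // _; exists b, sb.
have h1E : h1 = (sb == ~~ h0) by rewrite /h1 Em0.
have {}h0E : h0 = (sa == h2).
  by rewrite -[LHS]h0E El0 /goes_left /=; case: (sa); case: (h2).
clearbody m0 m1 h1 h2; subst m0 l0.
rewrite /twin /= -!/(twin _) in Dl0 Dm0 Dl1 Dm1 Dl2 Dm2 f0 f1 f2 c01 c02 c12 *.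
have nOU (l l' : letter) : l.1 != l'.1 -> l != l' by apply: contraNneq => ->.
have six : uniq [:: (a, Over sa); (b, Over sb); (b, Under sb); m1; twin m1; (a, Under sa)].
  have cm (l : letter) : l.1 = m1.1 -> [/\ (a, Over sa) != l, (b, Over sb) != l,
      (b, Under sb) != l & l != (a, Under sa)].
    by move=> lm; split; apply: nOU; rewrite /= ?lm // eq_sym.
  have [d1 d2 d3 d4] := cm m1 erefl; have [d5 d6 d7 d8] := cm (twin m1) erefl.
  have ou c s s' : ((c, Over s) : letter) != (c, Under s') by apply/eqP => -[].
  have e1 p p' : ((a, p) : letter) != (b, p') by apply: nOU.
  have e2 p p' : ((b, p) : letter) != (a, p') by apply: nOU; rewrite eq_sym.
  rewrite /= !inE !negb_or d1 d2 d3 d4 d5 d6 d7 d8 [m1 == _]eq_sym twin_neq.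
  by rewrite !e1 !e2 !ou.
have [r adj] : exists r, forall z, z \in
    [:: if h0 then ((a, Over sa), (b, Over sb)) else ((b, Over sb), (a, Over sa));
        if h1 then ((b, Under sb), m1) else (m1, (b, Under sb));
        if h2 then (twin m1, (a, Under sa)) else ((a, Under sa), twin m1)] ->
    adjacent (rotate r D) z.1 z.2.
  apply: linearize => //.
    move=> z; rewrite !inE => /or3P[] /eqP->.
    - by case: (h0) f0.
    - by case: (h1) f1.
    - by case: (h2) f2.
  have ne (x y : letter) : x != y -> y != x by rewrite eq_sym.
  move: six; rewrite /= !inE !negb_or -!andbA.
  case/and5P=> n1 n2 n3 n4 /and5P[n5 n6 n7 n8 /and5P[n9 n10 n11 n12 /and4P[n13 n14 n15 _]]].
  move=> z z'; rewrite !inE => /or3P[] /eqP-> /or3P[] /eqP->;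
    by case: (h0); case: (h1); case: (h2) => /=; auto.
have adj_if h p q : adjacent (rotate r D) (if h then (p, q) else (q, p)).1
    (if h then (p, q) else (q, p)).2 -> adjacent_if h (rotate r D) p q by case: h.
have A0 := adj_if _ _ _ (adj _ (mem_head _ _)).
have A1 : adjacent_if h1 (rotate r D) (b, Under sb) m1.
  by apply/adj_if/adj; rewrite !inE eqxx orbT.
have A2 : adjacent_if h2 (rotate r D) (twin m1) (a, Under sa).
  by apply/adj_if/adj; rewrite !inE eqxx !orbT.
pose s := slide3 a b sa sb m1; rewrite -/s -[map_letters _ D]/(map_letters s D).
have [[s0 s0'] [s1 s1'] [s2 s2'] sK] :
  [/\ s (a, Over sa) = (b, Over sb) /\ s (b, Over sb) = (a, Over sa),
      s (b, Under sb) = m1 /\ s m1 = (b, Under sb),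
      s (twin m1) = (a, Under sa) /\ s (a, Under sa) = twin m1
    & involutive s] := swap3_spec six.
have pR := letters_rotate_perm r D.
have uR : uniq (names (rotate r D)) by rewrite names_rotate.
have uLR : uniq (letters (rotate r D)) by rewrite (perm_uniq pR).
have cR : {in letters (rotate r D), forall l, l.1 = m1.1 -> l \in [:: m1; twin m1]}.
  by move=> l; rewrite (perm_mem pR) => Dl lm; apply: (wf_cross wfD).
have u3 : uniq [:: a; b; m1.1] by rewrite /= !inE negb_or c01 c02 c12.
have fw := transportable_slide3 uR uLR u3 cR A0 A1 A2 h1E h0E.
have bw : transportable (map_letters s (rotate r D)) (map_letters s (map_letters s (rotate r D))).
  apply: (@transportable_slide3 _ _ _ _ _ _ (~~ h0) (~~ h1) (~~ h2)) => //.
  - by rewrite names_map_letters.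
  - by rewrite letters_map map_inj_uniq //; apply: inv_inj sK.
  - rewrite letters_map => _ /mapP[l Rl ->] sl.
    suff : s l \in letters (rotate r D) by move/cR; apply.
    have Rsw p q l1 : p \in letters D -> q \in letters D -> l1 \in letters (rotate r D) ->
        swap p q l1 \in letters (rotate r D).
      rewrite !(perm_mem pR) /swap /= => Dp Dq Dl3.
      by case: eqP => //; case: eqP.
    by do 3![apply/Rsw => //].
  - by have := adjacent_if_map s A0; rewrite s0 s0' adjacent_ifN.
  - by have := adjacent_if_map s A1; rewrite s1 s1' adjacent_ifN.
  - by have := adjacent_if_map s A2; rewrite s2 s2' adjacent_ifN.
  - by rewrite h1E; case: (sb); case: (h0).
  - by rewrite h0E; case: (sa); case: (h2).
have ss : map_letters s (map_letters s (rotate r D)) = rotate r D.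
  by rewrite map_letters_comp -[RHS]map_letters_id; apply: eq_map_letters => l _; apply: sK.
rewrite ss in bw; rewrite map_letters_rotate in fw bw.
have [tr1 tr2] := transportable_rotate r uD.
have [|tr3 tr4] := @transportable_rotate r (map_letters s D).
  by rewrite names_map_letters.
split; first exact: transportable_trans tr1 (transportable_trans fw tr4).
exact: transportable_trans tr3 (transportable_trans bw tr2).
Qed.

Lemma strip_keep D : strip_virtual D = keep (fun l => ~~ is_virtual l) D.
Proof. by []. Qed.

(** Both diagrams become the same after dropping all virtual crossings. *)
Lemma transportable_virtual_detour D D' k v v' u u' R R' :
  well_formed D -> well_formed D' ->
  D = (k, v ++ u) :: R -> D' = (k, v' ++ u') :: R' ->
  all is_virtual v -> all is_virtual v' ->
  erase [seq l.1 | l <- v] ((k, u) :: R) =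
    erase [seq l.1 | l <- v'] ((k, u') :: R') ->
  transportable D D'.
Proof.
have stripE D1 v1 u1 R1 : well_formed D1 -> D1 = (k, v1 ++ u1) :: R1 ->
    all is_virtual v1 ->
    strip_virtual D1 = strip_virtual (erase [seq l.1 | l <- v1] ((k, u1) :: R1)).
  move=> wfD ED av; set V := [seq l.1 | l <- v1].
  have -> : strip_virtual D1 = strip_virtual (erase V D1).
    rewrite !strip_keep keep_keep; apply: eq_in_keep => l Dl /=.
    rewrite ![l \in (fun _ => _)]unfold_in.
    case vl: (is_virtual l) => //=; apply/esym/negP => /mapP[l1 vl1 El].
    have Dl1 : l1 \in letters D1 by rewrite ED /letters /= !mem_cat vl1.
    have := wf_cross wfD Dl1 Dl (esym El); rewrite !inE => /orP[]/eqP El'.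
      by move: vl; rewrite El' (allP av).
    by move: (allP av _ vl1) vl; rewrite El'; case: (l1) => c [].
  rewrite ED /erase /= filter_cat; congr (strip_virtual ((k, _) :: _)).
  rewrite -[RHS]cat0s; congr (_ ++ _); apply/eqP; rewrite -[_ == _]negbK -has_filter.
  by apply/hasPn => l vl; rewrite negbK map_f.
move=> wfD wfD' ED ED' av av' EE.
have [uD _ _ _] := and4P wfD; have [uD' _ _ _] := and4P wfD'.
have [tr1 _] := transportable_strip uD.
have [_ tr2] := transportable_strip uD'.
apply: transportable_trans tr1 _.
by rewrite (stripE _ _ _ _ wfD ED av) EE -(stripE _ _ _ _ wfD' ED' av').
Qed.

Lemma transportable_same_diagram D D' : well_formed D -> well_formed D' ->
  same_diagram D D' -> transportable D D' /\ transportable D' D.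
Proof.
move=> wfD wfD' [f [r [f_inj pD]]].
have [uD _ _ _] := and4P wfD; have [uD' _ _ _] := and4P wfD'.
have ER : [seq (z.1, [seq relabel f l | l <- rot (r z.1) z.2]) | z <- D] =
    relabel_all f (rotate r D) by rewrite /relabel_all /rotate -map_comp.
rewrite ER in pD; have [tr1 tr2] := transportable_rotate r uD.
have uR : uniq (names (rotate r D)) by rewrite names_rotate.
have tr3 := transportable_relabel uR f_inj.
have tr4 := transportable_unlabel f uR.
have tr5 := transportable_perm uD' pD.
split; last exact: transportable_trans tr5 (transportable_trans tr4 tr2).
apply: transportable_trans tr1 (transportable_trans tr3 _).
by apply: transportable_perm; rewrite ?names_relabel // perm_sym.
Qed.

Theorem transportable_move D D' : well_formed D -> well_formed D' -> move D D' ->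
  transportable D D' /\ transportable D' D.
Proof.
move=> wfD wfD' mv; case: mv wfD wfD' => {D D'}.
- by move=> D D' sD wfD wfD'; apply: transportable_same_diagram.
- by move=> D l Dl nv fl wfD _; apply: transportable_first.
- by move=> D a b s Da Db fo fu wfD _; apply: (transportable_second wfD Da Db fo fu).
- by move=> D d tD oD _ wfD _; apply: transportable_slide.
- by move=> D d tD oD _ wfD _; apply: transportable_slide.
- move=> k v v' u u' R R' av av' EE wfD wfD'.
  split; first exact: transportable_virtual_detour wfD wfD' erefl erefl av av' EE.
  exact: transportable_virtual_detour wfD' wfD erefl erefl av' av (esym EE).
Qed.

(** * Colourings of movies *)

(* Integer coordinates on the quotient of each layer by the next, whose
   congruences modulo [Delta] detect triviality.  Integers make it possible to
   add up twists of several curves. *)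
Variables (Delta : int) (I : Type) (coef : nat -> I -> N -> int).
Hypothesis coefM : forall d i x y, K d x -> K d y ->
  (Delta %| (coef d i (x * y)%g - (coef d i x + coef d i y))%R)%Z.
Hypothesis coefP : forall d x,
  K d.+1 x <-> K d x /\ forall i, (Delta %| coef d i x)%Z.

Lemma levelS t e : level t e.+1 = (level t e).+1.
Proof. by case: t. Qed.

Lemma coef0 d i x : K d.+1 x -> (Delta %| coef d i x)%Z.
Proof. by case/coefP. Qed.

Lemma coef_eqm d i x y : K d x -> eqm K d.+1 x y ->
  (Delta %| (coef d i y - coef d i x)%R)%Z.
Proof.
move=> Kx xy; have := coefM i Kx (layerW xy); rewrite mulVKg => H.
move: H (coef0 i xy); set a := coef d i y; set b := coef d i _; set c := coef d i _.
move=> H Hc; rewrite (_ : a - b = a - (b + c) + c)%R; last by ring.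
by rewrite rpredD.
Qed.

Lemma coefV d i x : K d x -> (Delta %| (coef d i x^-1%g + coef d i x)%R)%Z.
Proof.
move=> Kx; have := coefM i (layerV Kx) Kx; rewrite mulVg => H.
move: H (coef0 i (layer1 K d.+1)).
set a := coef d i 1; set b := coef d i _; set c := coef d i _ => H Ha.
by rewrite (_ : b + c = a - (a - (b + c)))%R; [rewrite rpredB | ring].
Qed.

Lemma valid_le e D chi : valid e.+1 D chi -> valid e D chi.
Proof.
move=> Vd k w Dw; have [O C] := Vd k w Dw; split; last first.
  by move: C; rewrite levelS => /eqmW.
elim: w (base chi k) O {Dw C} => //= l w IH x [lP wP]; split; last exact: IH.
by case: l.2 lP => // _ [-> /eqmW].
Qed.

Lemma twist_layer e D chi k w : valid e D chi -> (k, w) \in D ->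
  K (level (ty k) e) (twist chi k w).
Proof. by move=> Vd Dw; have [] := Vd _ _ Dw. Qed.

Definition set_base chi k x : coloring N :=
  Coloring (over chi) (fun k1 => if k1 == k then x else base chi k1).

(** A movie together with its effect on colourings: [f chi] is the colouring of the
    last diagram obtained from the colouring [chi] of the first one, and [g e chi]
    says that no obstruction is met at precision [e].  Obstructions only occur at
    saddles: when a curve splits, the first half has to close up by itself; when
    two curves merge, their base colours have to agree.  The base colour of a newborn
    curve is free and is taken from [chi] as well. *)
Inductive evolution D0 : seq event -> diagram ->
    (coloring N -> coloring N) -> (nat -> coloring N -> Prop) -> Prop :=
| EvoStart : uniq (names D0) ->
    evolution D0 [::] D0 id (fun e chi => valid e D0 chi)
| EvoStill es D D' f g F : evolution D0 es D f g -> uniq (names D') ->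
    transports F D D' ->
    evolution D0 (rcons es Still) D' (F \o f) g
| EvoBirth es D f g k : evolution D0 es D f g -> k \notin used_names D0 es ->
    evolution D0 (rcons es (Birth k)) ((k, [::]) :: D) f g
| EvoDeath es D f g k : evolution D0 es ((k, [::]) :: D) f g ->
    evolution D0 (rcons es (Death k)) D f g
| EvoSplit es R f g k k' u v : evolution D0 es ((k, u ++ v) :: R) f g ->
    k' \notin used_names D0 es -> ty k = ty k' ->
    evolution D0 (rcons es (Split k k')) ((k, u) :: (k', v) :: R)
      (fun chi => set_base (f chi) k' (base (f chi) k))
      (fun e chi => g e chi /\ eqm K (level (ty k) e) (base (f chi) k)
         (run (over (f chi)) (ty k) (base (f chi) k) u))
| EvoMerge es R f g k k' u v : evolution D0 es ((k, u) :: (k', v) :: R) f g ->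
    ty k = ty k' ->
    evolution D0 (rcons es (Merge k k')) ((k, u ++ v) :: R) f
      (fun e chi => g e chi /\
         eqm K (level (ty k) e) (base (f chi) k) (base (f chi) k')).

Lemma evolution_names D0 es D f g : evolution D0 es D f g ->
  uniq (names D) /\ {subset names D <= used_names D0 es}.
Proof.
elim=> {es D f g}.
- by move=> uD; split=> // k Dk; rewrite mem_cat Dk.
- move=> es D D' f g F _ [uD sD] uD' [pD _ _ _ _]; split=> // k.
  by rewrite -(perm_mem pD) => /sD uk; rewrite used_rcons mem_cat uk.
- move=> es D f g k _ [uD sD] nk; split=> /=.
    by rewrite uD andbT; apply: contra nk; apply: sD.
  by move=> k1; rewrite used_rcons mem_cat !inE => /orP[->|/sD->] //; rewrite orbT.
- move=> es D f g k _ [/= /andP[_ uD] sD]; split=> // k1 Dk1.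
  by rewrite used_rcons mem_cat sD // inE Dk1 orbT.
- move=> es R f g k k' u v _ [/= /andP[nkR uR] sD] nk' _; split=> /=.
    rewrite inE negb_or nkR uR !andbT.
    have nk'D : k' \notin k :: names R by apply: contra nk'; apply: sD.
    by move: nk'D; rewrite inE negb_or eq_sym.
  move=> k1; rewrite used_rcons mem_cat !inE => /or3P[->|->|k1R]; rewrite ?orbT //.
  by rewrite sD // inE k1R orbT.
- move=> es R f g k k' u v _ [/= /and3P[nkR nk'R uR] sD] _; split.
    by rewrite uR andbT; apply: contra nkR => kR; rewrite inE kR orbT.
  move=> k1; rewrite used_rcons mem_cat !inE => /orP[->|k1R]; rewrite ?orbT //.
  by rewrite sD // !inE k1R !orbT.
Qed.

Lemma evolution_valid D0 es D f g : evolution D0 es D f g ->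
  forall e chi, g e chi -> valid e D (f chi).
Proof.
elim=> {es D f g} //.
- move=> es D D' f g F _ IH _ [_ vF _ _ _] e chi /IH; exact: vF.
- move=> es D f g k ev IH nk e chi /IH Vd k1 w; rewrite inE => /predU1P[[-> ->]|/Vd] //.
- by move=> es D f g k ev IH e chi /IH Vd k1 w Dw; apply: Vd; rewrite inE Dw orbT.
- move=> es R f g k k' u v ev IH nk' tk e chi [/IH Vd C] k1 w.
  have [/= /andP[nkR uR] sD] := evolution_names ev.
  have nk'D : k' \notin k :: names R by apply: contra nk'; apply: sD.
  rewrite inE negb_or in nk'D; case/andP: nk'D => nkk' nk'R.
  have [Ok Ck] := Vd k (u ++ v) (mem_head _ _).
  have [Ou Ov] := (overs_fit_cat _ _ _ _ _ _).1 Ok.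
  rewrite !inE => /or3P[/eqP[-> ->]|/eqP[-> ->]|Rw].
  + by rewrite /fits /= eq_sym (negPf nkk').
  + rewrite /fits /= eqxx -tk; have C' := eqm_sym C; split.
      exact: overs_fit_eqm C' Ov.
    apply: eqm_trans Ck _; rewrite run_cat; exact: run_eqm.
  + have nk1 : k1 == k' = false by apply: contraNF nk'R => /eqP<-; apply: mem_names Rw.
    rewrite /fits /= nk1; apply: Vd; by rewrite inE Rw orbT.
- move=> es R f g k k' u v ev IH tk e chi [/IH Vd C] k1 w.
  have [Ok Ck] := Vd k u (mem_head _ _).
  have [Ok' Ck'] : fits e (f chi) k' v by apply: Vd; rewrite !inE eqxx orbT.
  rewrite inE => /predU1P[[-> ->]|Rw]; last by apply: Vd; rewrite !inE Rw !orbT.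
  rewrite -tk in Ok' Ck'; rewrite /fits run_cat; split.
    apply/overs_fit_cat; split=> //; apply: overs_fit_eqm Ok' => //.
    exact: eqm_trans (eqm_sym C) Ck.
  apply: (eqm_trans C); apply: (eqm_trans Ck'); apply: run_eqm => //.
  exact: eqm_trans (eqm_sym C) Ck.
Qed.

(** * Conservation of twist *)

(** Twists add up modulo the next layer because they are central there. *)
Lemma twist_cat e o t b u v : let T w := b^-1 * run o t b w in
  K (level t e) (T u) -> eqm K (level t e).+1 (T (u ++ v)) (T v * T u).
Proof.
move=> T Tu; rewrite /T run_cat -mulgA; apply: eqmMl.
by apply: run_shift => //; rewrite /T mulVKg.
Qed.

Lemma twist_base e o t b b' v : eqm K (level t e) b b' ->
  K (level t e) (b^-1 * run o t b v) ->
  eqm K (level t e).+1 (b'^-1 * run o t b' v) (b^-1 * run o t b v).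
Proof.
move=> bb' Kv; pose q := b^-1 * b'; have Eb : b' = b * q by rewrite /q mulVKg.
have H : eqm K (level t e).+1 (run o t b' v) (run o t b v * q).
  by apply: run_shift => //; rewrite -Eb.
apply: eqm_trans (eqmMl _ H) _; rewrite {1}Eb invgM.
have -> : q^-1 * b^-1 * (run o t b v * q) = (b^-1 * run o t b v) ^ q.
  by rewrite /conjg !mulgA.
exact/eqm_sym/eqm_conj_central.
Qed.

Definition twist_sum (S : pred nat) d i D chi : int :=
  (\sum_(z <- D | S z.1) coef d i (twist chi z.1 z.2))%R.

(* For each saddle [(k, k')] the twist that it moves from [k] to [k'], and the
   mismatch of the base colours that it identifies. *)
Notation saddle_data := (seq ((nat * nat) * (N * N))).

(** The twist flowing into the set [S] of sheets through the saddles. *)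
Definition jump (S : pred nat) d i (sad : saddle_data) : int :=
  (\sum_(x <- sad) ((S x.1.2)%:Z - (S x.1.1)%:Z) * coef d i x.2.1)%R.

(** Conservation of twist for every set [S] of sheets of one type: what is there at
    the end was there at the start or has come in through a saddle. *)
Definition balanced e D0 chi0 D chi sad : Prop :=
  forall t (S : pred nat) i, (forall k, S k -> ty k = t) ->
  (Delta %| (twist_sum S (level t e) i D chi
     - (twist_sum S (level t e) i D0 chi0 + jump S (level t e) i sad))%R)%Z.

Lemma twist_sum_names S d i D chi : uniq (names D) -> twist_sum S d i D chi =
  (\sum_(k <- names D | S k) coef d i (twist chi k (curve_named D k)))%R.
Proof.
move=> uD; rewrite big_map /twist_sum big_seq_cond [RHS]big_seq_cond.
by apply: eq_bigr => -[k w] /andP[Dw _]; rewrite (curve_namedE uD Dw).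
Qed.

Lemma twist_sum_still F t (S : pred nat) e i D D' chi : transports F D D' ->
  uniq (names D) -> uniq (names D') -> valid e D chi ->
  (forall k, S k -> ty k = t) ->
  (Delta %| (twist_sum S (level t e) i D' (F chi)
             - twist_sum S (level t e) i D chi)%R)%Z.
Proof.
move=> [pD vF _ tF _] uD uD' Vd St.
rewrite (twist_sum_names _ _ _ _ uD) (twist_sum_names _ _ _ _ uD').
rewrite (perm_big _ pD) /= -sumrB big_seq_cond; apply: rpred_sum => k /andP[D'k Sk].
have [w' Dw'] := names_mem D'k; rewrite -(perm_mem pD) in D'k.
have [w Dw] := names_mem D'k.
rewrite (curve_namedE uD Dw) (curve_namedE uD' Dw') -(St _ Sk); apply: coef_eqm.
  exact: twist_layer Vd Dw.
exact: tF Vd Dw Dw'.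
Qed.

Lemma twist_sum_trivial t (S : pred nat) e i D chi : valid e.+1 D chi ->
  (forall k, S k -> ty k = t) -> (Delta %| twist_sum S (level t e) i D chi)%Z.
Proof.
move=> Vd St; rewrite /twist_sum big_seq_cond; apply: rpred_sum => -[k w] /andP[Dw Sk].
by rewrite -(St k Sk); apply: coef0; rewrite -levelS; apply: twist_layer Vd Dw.
Qed.

(** The balance for the set of sheets consisting of [k] alone: nothing was there at
    the start, and nothing came in. *)
Lemma balanced_untwisted e D0 chi0 D chi sad : uniq (names D) ->
  balanced e D0 chi0 D chi sad -> valid e.+1 D0 chi0 -> valid e D chi ->
  (forall p, p \in sad -> ty p.1.1 = ty p.1.2) ->
  (forall p, p \in sad -> K (level (ty p.1.1) e).+1 p.2.1) ->
  forall k w, (k, w) \in D -> K (level (ty k) e).+1 (twist chi k w).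
Proof.
move=> uD bal V0 Vd ts triv k w Dw; apply/coefP; split; first exact: twist_layer Vd Dw.
move=> i; have St k1 : pred1 k k1 -> ty k1 = ty k by move/eqP->.
have := bal _ _ i St; have := twist_sum_trivial i V0 St.
have -> : twist_sum (pred1 k) (level (ty k) e) i D chi =
    coef (level (ty k) e) i (twist chi k w).
  rewrite (twist_sum_names _ _ _ _ uD) (big_rem k) ?(mem_names Dw) //= eqxx.
  rewrite (curve_namedE uD Dw) big_seq_cond big_pred0 ?addr0 // => k1.
  by rewrite (rem_filter _ uD) mem_filter /=; case: (k1 == k); rewrite ?andbF.
have : (Delta %| jump (pred1 k) (level (ty k) e) i sad)%Z.
  rewrite /jump big_seq; apply: rpred_sum => x sx.
  have [E1|n1] := eqVneq x.1.1 k.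
    by apply: dvdz_mull; apply: coef0; rewrite -E1; apply: triv.
  have [E2|n2] := eqVneq x.1.2 k.
    by apply: dvdz_mull; apply: coef0; rewrite -E2 -ts //; apply: triv.
  by rewrite /= (negPf n1) (negPf n2) subrr mul0r dvdz0.
set a := jump _ _ _ _; set b := twist_sum _ _ _ _ _; set c := coef _ _ _ => Ha Hb Hc.
rewrite (_ : c = (c - (b + a)) + (b + a))%R; last by ring.
by apply: rpredD => //; apply: rpredD.
Qed.

(** * Lifting a colouring by one layer *)

Lemma twist_sum_cons S d i k w D chi : twist_sum S d i ((k, w) :: D) chi =
  ((S k)%:Z * coef d i (twist chi k w) + twist_sum S d i D chi)%R.
Proof. by rewrite /twist_sum big_cons /=; case: (S k); rewrite ?mul1r ?mul0r ?add0r. Qed.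

Lemma jump_rcons S d i (sad : saddle_data) p : jump S d i (rcons sad p) =
  (jump S d i sad + ((S p.1.2)%:Z - (S p.1.1)%:Z) * coef d i p.2.1)%R.
Proof. by rewrite /jump big_rcons. Qed.

Lemma balanced_step e D0 chi0 D chi sad D' chi' sad' :
  balanced e D0 chi0 D chi sad ->
  (forall t (S : pred nat) i, (forall k, S k -> ty k = t) ->
    (Delta %| ((twist_sum S (level t e) i D' chi' - twist_sum S (level t e) i D chi)
      - (jump S (level t e) i sad' - jump S (level t e) i sad))%R)%Z) ->
  balanced e D0 chi0 D' chi' sad'.
Proof.
move=> bal H t S i St; move: (bal t S i St) (H t S i St).
set a := twist_sum _ _ _ D chi; set b := twist_sum _ _ _ D0 _.
set c := jump _ _ _ sad; set a' := twist_sum _ _ _ D' _; set c' := jump _ _ _ sad'.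
move=> H1 H2; rewrite (_ : a' - (b + c') = (a - (b + c)) + ((a' - a) - (c' - c)))%R; last by ring.
exact: rpredD H1 H2.
Qed.

Lemma layer_eqm d x y : K d x -> eqm K d x y -> K d y.
Proof. by move=> Kx /(layerM Kx); rewrite mulVKg. Qed.

Lemma layer_divl d x y : K d (x * y) -> K d x -> K d y.
Proof. by move=> Kxy /layerV/layerM/(_ Kxy); rewrite mulKg. Qed.

Lemma layer_divr d x y : K d (x * y) -> K d y -> K d x.
Proof. by move=> Kxy /layerV/(layerM Kxy); rewrite mulgK. Qed.

Lemma twist_sum_set_base S d i D chi k x : k \notin names D ->
  twist_sum S d i D (set_base chi k x) = twist_sum S d i D chi.
Proof.
move=> nk; rewrite /twist_sum big_seq_cond [RHS]big_seq_cond.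
apply: eq_bigr => -[k1 w] /andP[Dw _]; rewrite /twist /=.
by case: eqP => // E; rewrite -E (mem_names Dw) in nk.
Qed.

(** Going up one layer: twists are exchanged at saddles only, and if no saddle
    exchanges any, then the colouring lifts provided the mismatches found at the
    saddles are balanced by the shifts of the curves involved. *)
Lemma evolution_lift D0 es D f g : evolution D0 es D f g ->
  forall e chi, g e chi -> exists sad : saddle_data,
  [/\ [seq p.1 | p <- sad] = saddle_list es,
      forall p, p \in sad -> [/\ ty p.1.1 = ty p.1.2,
        K (level (ty p.1.1) e) p.2.1 & K (level (ty p.1.1) e) p.2.2],
      balanced e D0 chi D (f chi) sad &
      valid e.+1 D0 chi ->
      (forall p, p \in sad -> K (level (ty p.1.1) e).+1 p.2.1) ->
      forall s chi', (forall k, K (level (ty k) e) (s k)) ->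
      valid e.+1 D0 chi' -> shifted e s chi chi' ->
      (forall p, p \in sad ->
         eqm K (level (ty p.1.1) e).+1 (s p.1.1) (s p.1.2 * p.2.2)) ->
      g e.+1 chi' /\ shifted e s (f chi) (f chi')].
Proof.
elim=> {es D f g}.
- move=> uD e chi Vd; exists [::]; split=> // t S i St.
  by rewrite /jump big_nil addr0 subrr dvdz0.
- move=> es D D' f g F ev IH uD' tr e chi gE.
  have [uD _] := evolution_names ev; have Vd := evolution_valid ev gE.
  have [sad [Es sadP bal lift]] := IH e chi gE; exists sad; split=> //.
  + by rewrite saddle_list_rcons cats0.
  + apply: balanced_step bal _ => t S i St; rewrite subrr subr0.
    exact: (twist_sum_still i tr).
  + move=> V0 triv s chi' Ks V0' sh H.
    have [g' sh'] := lift V0 triv s chi' Ks V0' sh H; split=> //.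
    apply: (tr_shift tr) => //; apply: valid_le; exact: evolution_valid ev _ _ g'.
- move=> es D f g k ev IH nk e chi gE.
  have [sad [Es sadP bal lift]] := IH e chi gE; exists sad; split=> //.
    by rewrite saddle_list_rcons cats0.
  apply: balanced_step bal _ => t S i St; rewrite subrr subr0 twist_sum_cons addrK.
  by rewrite /twist /= mulVg; apply/dvdz_mull/coef0/layer1.
- move=> es D f g k ev IH e chi gE.
  have [sad [Es sadP bal lift]] := IH e chi gE; exists sad; split=> //.
    by rewrite saddle_list_rcons cats0.
  apply: balanced_step bal _ => t S i St; rewrite subrr subr0 twist_sum_cons.
  rewrite opprD addrCA subrr addr0 rpredN.
  by rewrite /twist /= mulVg; apply/dvdz_mull/coef0/layer1.
- move=> es R f g k k' u v ev IH nk' tk e chi [gE C].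
  have [uD sD] := evolution_names ev; have Vd := evolution_valid ev gE.
  have nk'D : k' \notin k :: names R by apply: contra nk'; apply: sD.
  rewrite inE negb_or in nk'D; case/andP: nk'D => nkk' nk'R.
  have [sad [Es sadP bal lift]] := IH e chi gE.
  set b := base (f chi) k in C *; set o := over (f chi) in C *.
  pose Tu := b^-1 * run o (ty k) b u; pose Tv := b^-1 * run o (ty k) b v.
  have Ku : K (level (ty k) e) Tu by [].
  have Euv : eqm K (level (ty k) e).+1 (twist (f chi) k (u ++ v)) (Tv * Tu).
    exact: twist_cat.
  have Kuv : K (level (ty k) e) (twist (f chi) k (u ++ v)).
    by apply: twist_layer Vd (mem_head _ _).
  have Kv : K (level (ty k) e) Tv.
    exact: layer_divr (layer_eqm Kuv (eqmW Euv)) Ku.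
  (* The new curve starts with the base colour of the old one, so there is no
     mismatch, and it takes away the twist of its half. *)
  exists (rcons sad ((k, k'), (Tv, 1))); split.
  + by rewrite map_rcons Es saddle_list_rcons cats1.
  + move=> p; rewrite mem_rcons inE => /predU1P[->|/sadP] //=.
    by split=> //; apply: layer1.
  + apply: balanced_step bal _ => t S i St; rewrite jump_rcons !twist_sum_cons /=.
    rewrite (twist_sum_set_base _ _ _ _ _ nk'R) /twist /= eqxx eq_sym (negPf nkk') -tk.
    rewrite -/b -/o -/Tu -/Tv -/(twist (f chi) k (u ++ v)).
    have H1 : S k -> (Delta %| (coef (level t e) i Tu + coef (level t e) i Tv
        - coef (level t e) i (twist (f chi) k (u ++ v)))%R)%Z.
      move=> Sk; rewrite -(St _ Sk); move: (coef_eqm i Kuv Euv) (coefM i Kv Ku).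
      set cuv := coef _ _ (twist _ _ _); set cm := coef _ _ (_ * _).
      set cu := coef _ _ Tu; set cv := coef _ _ Tv => G1 G2.
      rewrite (_ : _ + _ - _ = (cm - cuv) - (cm - (cv + cu)))%R; last by ring.
      exact: rpredB G1 G2.
    move: H1; set cuv := coef _ _ (twist _ _ _); set cu := coef _ _ Tu.
    set cv := coef _ _ Tv; set cR := twist_sum _ _ _ _ _; set cj := jump _ _ _ _ => H1.
    rewrite (_ : _ - _ = (S k)%:Z * (cu + cv - cuv))%R; last by ring.
    by case: (S k) H1 => H1; rewrite ?mul0r ?dvdz0 // mul1r; apply: H1.
  + move=> V0 triv s chi' Ks V0' sh H.
    have triv' p : p \in sad -> K (level (ty p.1.1) e).+1 p.2.1.
      by move=> sp; apply: triv; rewrite mem_rcons inE sp orbT.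
    have [|g' sh'] := lift V0 triv' s chi' Ks V0' sh.
      by move=> p sp; apply: H; rewrite mem_rcons inE sp orbT.
    have Kuv' : K (level (ty k) e).+1 (twist (f chi) k (u ++ v)).
      have ts p : p \in sad -> ty p.1.1 = ty p.1.2 by move=> /sadP[].
      exact: (balanced_untwisted uD bal V0 Vd ts triv' (mem_head _ _)).
    have Kv' : K (level (ty k) e).+1 Tv.
      by apply: (triv ((k, k'), (Tv, 1))); rewrite mem_rcons mem_head.
    have Ku' : K (level (ty k) e).+1 Tu.
      exact: layer_divl (layer_eqm Kuv' Euv) Kv'.
    have [oo bb] := sh'.
    split; first split=> //.
      rewrite levelS; apply: (eqm_trans (bb k)).
      apply: eqm_sym; apply: eqm_trans (run_shift u oo (Ks k) (bb k)) _.
      by apply/eqm_sym/eqmMr.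
    split=> //= k1; case: eqP => [->|_]; last exact: bb.
    have := H ((k, k'), (Tv, 1)); rewrite mem_rcons mem_head /= mulg1 tk => /(_ isT) ss.
    rewrite -tk in ss *; apply: (eqm_trans (bb k)); exact: eqmMl.
- move=> es R f g k k' u v ev IH tk e chi [gE C].
  have [uD sD] := evolution_names ev; have Vd := evolution_valid ev gE.
  have [sad [Es sadP bal lift]] := IH e chi gE.
  set b := base (f chi) k in C *; set b' := base (f chi) k' in C *.
  set o := over (f chi).
  pose Tu := b^-1 * run o (ty k) b u; pose Tv := b^-1 * run o (ty k) b v.
  have Ku : K (level (ty k) e) Tu by apply: (twist_layer Vd (mem_head _ _)).
  have Kv' : K (level (ty k) e) (twist (f chi) k' v).
    by rewrite tk; apply: (twist_layer Vd); rewrite !inE eqxx orbT.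
  have Kv : K (level (ty k) e) Tv.
    apply: (eqm_trans C); apply: (eqm_trans Kv'); rewrite -tk.
    by apply: run_eqm => //; apply: eqm_sym.
  have Ev : eqm K (level (ty k) e).+1 (twist (f chi) k' v) Tv.
    by rewrite /twist -tk; apply: twist_base.
  have Euv : eqm K (level (ty k) e).+1 (twist (f chi) k (u ++ v)) (Tv * Tu).
    exact: twist_cat.
  have Kuv : K (level (ty k) e) (twist (f chi) k (u ++ v)).
    exact: layer_eqm (layerM Kv Ku) (eqm_sym (eqmW Euv)).
  (* The curve [k] receives the twist of [k'], which is an inverse flow. *)
  exists (rcons sad ((k, k'), (Tv^-1, b^-1 * b'))); split.
  + by rewrite map_rcons Es saddle_list_rcons cats1.
  + move=> p; rewrite mem_rcons inE => /predU1P[->|/sadP] //=.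
    by split=> //; apply: layerV.
  + apply: balanced_step bal _ => t S i St; rewrite jump_rcons !twist_sum_cons /=.
    have H1 : S k -> (Delta %| (coef (level t e) i (twist (f chi) k (u ++ v))
        - coef (level t e) i Tu + coef (level t e) i Tv^-1)%R)%Z.
      move=> Sk; rewrite -(St _ Sk).
      move: (coef_eqm i Kuv Euv) (coefM i Kv Ku) (coefV i Kv).
      set cuv := coef _ _ (twist _ _ _); set cm := coef _ _ (_ * _).
      set cu := coef _ _ Tu; set cv := coef _ _ Tv; set cw := coef _ _ Tv^-1.
      move=> G1 G2 G3; rewrite (_ : _ + _ = (cw + cv) - (cm - cuv) + (cm - (cv + cu)))%R.
        by apply: rpredD => //; apply: rpredB.
      by ring.
    have H2 : S k' -> (Delta %| (coef (level t e) i (twist (f chi) k' v)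
        + coef (level t e) i Tv^-1)%R)%Z.
      move=> Sk'; rewrite -(St _ Sk') -tk.
      move: (coef_eqm i Kv' Ev) (coefV i Kv).
      set cv' := coef _ _ (twist _ _ _); set cv := coef _ _ Tv; set cw := coef _ _ Tv^-1.
      by move=> G1 G2; rewrite (_ : _ + _ = (cw + cv) - (cv - cv'))%R; [apply: rpredB|ring].
    rewrite -/Tu.
    have -> : twist (f chi) k u = Tu by [].
    move: H1 H2; set cuv := coef _ _ (twist _ _ (_ ++ _)); set cu := coef _ _ Tu.
    set cw := coef _ _ Tv^-1; set cv' := coef _ _ (twist _ _ _).
    set cR := twist_sum _ _ _ _ _; set cj := jump _ _ _ _ => H1 H2.
    rewrite (_ : _ - _ = (S k)%:Z * (cuv - cu + cw) - (S k')%:Z * (cv' + cw))%R; last by ring.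
    by apply: rpredB; [case: (S k) H1 | case: (S k') H2] => H;
      rewrite ?mul0r ?dvdz0 // mul1r; apply: H.
  + move=> V0 triv s chi' Ks V0' sh H.
    have triv' p : p \in sad -> K (level (ty p.1.1) e).+1 p.2.1.
      by move=> sp; apply: triv; rewrite mem_rcons inE sp orbT.
    have [|g' sh'] := lift V0 triv' s chi' Ks V0' sh.
      by move=> p sp; apply: H; rewrite mem_rcons inE sp orbT.
    have [oo bb] := sh'; split=> //; split=> //.
    have := H ((k, k'), (Tv^-1, b^-1 * b')); rewrite mem_rcons mem_head /= => /(_ isT) ss.
    rewrite levelS; apply: (eqm_trans (bb k)); apply: (eqm_trans (eqmMl _ ss)).
    have bb' := bb k'; rewrite -tk in bb'; apply: eqm_trans (eqm_sym bb').
    have Kq : K (level (ty k) e) (b^-1 * b') by [].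
    have := eqm_central (s k') Kq => /(eqmMl b)/eqm_sym H'.
    by apply: (eqm_trans H'); rewrite !mulgA mulgV mul1g.
Qed.

(** * Conjugate meridians and mismatched base colours *)

(** Meridians are only preserved up to this relation: base points move. *)
Definition conjugate e x y : Prop := exists g, eqm K e.+1 (x ^ g) y.

Lemma conjugate_eqm e x y : eqm K e.+1 x y -> conjugate e x y.
Proof. by move=> xy; exists 1; rewrite conjg1. Qed.

Lemma conjugate_sym e x y : conjugate e x y -> conjugate e y x.
Proof.
move=> [g xy]; exists g^-1; have := eqmJ (eqm_sym xy) (eqm_refl K _ g^-1).
by rewrite conjgK.
Qed.

Lemma conjugate_trans e x y z : conjugate e x y -> conjugate e y z -> conjugate e x z.
Proof.
move=> [g xy] [h yz]; exists (g * h); rewrite conjgM.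
exact: eqm_trans (eqmJ xy (eqm_refl K _ h)) yz.
Qed.

Lemma saddle_used es D p : p \in saddle_list es ->
  p.1 \in used_names D es /\ p.2 \in used_names D es.
Proof.
rewrite /used_names !mem_cat; suff H : p \in saddle_list es ->
    p.1 \in flatten [seq event_names ev | ev <- es] /\
    p.2 \in flatten [seq event_names ev | ev <- es].
  by case/H => -> ->; rewrite !orbT.
elim: es => //= ev es IH; rewrite !mem_cat; case: ev => [|k|k|k k'|k k'] /=;
  rewrite ?inE; try by case/IH=> -> ->; rewrite ?orbT.
  by case/predU1P=> [->|/IH[-> ->]] /=; rewrite ?eqxx ?orbT.
by case/predU1P=> [->|/IH[-> ->]] /=; rewrite ?eqxx ?orbT.
Qed.

(** Along a sheet a base colour only gets conjugated, and at a saddle two base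
    colours are identified.  So [a] assigns to every sheet a meridian that
    represents the conjugacy class of all its base colours. *)
Lemma evolution_conjugate D0 es D f g : evolution D0 es D f g ->
  forall e chi, g e chi -> exists a : nat -> N,
  [/\ forall k, k \in names D0 -> a k = base chi k,
      forall k, k \in names D -> ty k = false -> conjugate e (a k) (base (f chi) k) &
      forall p, p \in saddle_list es -> ty p.1 = false -> conjugate e (a p.1) (a p.2)].
Proof.
elim=> {es D f g}.
- move=> uD e chi Vd; exists (base chi); split=> // k _ _.
  exact/conjugate_eqm/eqm_refl.
- move=> es D D' f g F ev IH uD' [pD _ _ _ cF] e chi /IH[a [a0 aD aS]]; exists a.
  split=> // [k|p]; last by rewrite saddle_list_rcons cats0; apply: aS.
  rewrite -(perm_mem pD) => Dk tk; have [h ->] := cF (f chi) k tk.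
  apply: conjugate_trans (aD k Dk tk) _; exists h; exact: eqm_refl.
- move=> es D f g k ev IH nk e chi /IH[a [a0 aD aS]].
  have [_ sD] := evolution_names ev.
  exists (fun k1 => if k1 == k then base (f chi) k else a k1); split.
  + move=> k1 Dk1; case: eqP => [E|_]; last exact: a0.
    by case/negP: nk; rewrite -E mem_cat Dk1.
  + move=> k1; rewrite inE => /predU1P[->|Dk1] tk1.
      by rewrite eqxx; apply/conjugate_eqm/eqm_refl.
    by case: eqP => [->|_]; [apply/conjugate_eqm/eqm_refl | apply: aD].
  + move=> p; rewrite saddle_list_rcons cats0 => sp.
    have [u1 u2] := saddle_used D0 sp.
    do 2![case: eqP => [E|_]; first by rewrite -E ?u1 ?u2 in nk]; exact: aS.
- move=> es D f g k ev IH e chi /IH[a [a0 aD aS]]; exists a; split=> //.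
    by move=> k1 Dk1; apply: aD; rewrite inE Dk1 orbT.
  by move=> p; rewrite saddle_list_rcons cats0; apply: aS.
- move=> es R f g k k' u v ev IH nk' tk e chi [/IH[a [a0 aD aS]] C].
  have [_ sD] := evolution_names ev.
  have kk' : k != k'.
    by apply: contraNneq nk' => <-; apply/sD/mem_head.
  exists (fun k1 => if k1 == k' then base (f chi) k else a k1); split.
  + move=> k1 Dk1; case: eqP => [E|_]; last exact: a0.
    by case/negP: nk'; rewrite -E mem_cat Dk1.
  + move=> k1; rewrite /= !inE; case: (k1 =P k') => [->|nk1] /=.
      by move=> *; apply/conjugate_eqm/eqm_refl.
    by move=> H tk1; apply: aD => //; rewrite inE.
  + move=> p; rewrite saddle_list_rcons mem_cat inE => /orP[sp|/eqP->] /=.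
      have [u1 u2] := saddle_used D0 sp.
      do 2![case: eqP => [E|_]; first by rewrite -E ?u1 ?u2 in nk']; exact: aS.
    by rewrite eqxx (negPf kk') => tk1; apply: aD => //; apply: mem_head.
- move=> es R f g k k' u v ev IH tk e chi [/IH[a [a0 aD aS]] C]; exists a; split=> //.
    by move=> k1; rewrite inE => H; apply: aD; rewrite !inE; case/orP: H => ->; rewrite ?orbT.
  move=> p; rewrite saddle_list_rcons mem_cat inE => /orP[|/eqP->]; first exact: aS.
  move=> /= tk1; apply: conjugate_trans (aD k (mem_head _ _) tk1) _.
  rewrite tk1 /= in C; apply: conjugate_trans (conjugate_eqm C) _.
  by apply/conjugate_sym/aD; rewrite -?tk // !inE eqxx orbT.
Qed.

Lemma joins_saddle k k' es : has (joins k k') es = ((k, k') \in saddle_list es).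
Proof.
elim: es => //= ev es ->; case: ev => //= a b; by rewrite inE xpair_eqE !(eq_sym k, eq_sym k').
Qed.

Lemma movie_evolution D0 es D : is_diagram D0 -> movie D0 es D ->
  (forall p, p \in saddle_list es -> ty p.1 = ty p.2) ->
  well_formed D /\ exists f g, evolution D0 es D f g.
Proof.
move=> /andP[wf0 _]; elim=> {es D}.
  move=> _; split=> //; have [uD _ _ _] := and4P wf0.
  by exists id, (fun e chi => valid e D0 chi); constructor.
move=> es D ev D' mv IH /andP[wf' _] st ts; split=> //.
have [|wf [f [g evo]]] := IH.
  by move=> p sp; apply: ts; rewrite saddle_list_rcons mem_cat sp.
have [uD' _ _ _] := and4P wf'; case: st evo wf uD' wf' ts => {mv IH ev D D'}.
- move=> D D' mv evo wf uD' wf' _.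
  have [F tr] : transportable D D'.
    case: mv => mv; first by have [] := transportable_move wf wf' mv.
    by have [] := transportable_move wf' wf mv.
  by exists (F \o f), g; apply: EvoStill evo uD' tr.
- by move=> k D nk evo *; exists f, g; apply: EvoBirth.
- by move=> k D evo *; exists f, g; apply: EvoDeath.
- move=> k k' u v R nk' evo wf _ _ ts; do 2!eexists; apply: EvoSplit evo nk' _.
  by apply: (ts (k, k')); rewrite saddle_list_rcons mem_cat mem_head orbT.
- move=> k k' u v R evo wf _ _ ts; do 2!eexists; apply: EvoMerge evo _.
  by apply: (ts (k, k')); rewrite saddle_list_rcons mem_cat mem_head orbT.
Qed.

(** On a forest every family of mismatches is a coboundary: adding an edge, shift
    all vertices of the tree at one of its ends by the same factor. *)
Lemma forest_solution e (sad : saddle_data) :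
  forest [seq p.1 | p <- sad] ->
  (forall p, p \in sad -> ty p.1.1 = ty p.1.2 /\ K (level (ty p.1.1) e) p.2.2) ->
  exists s : nat -> N, (forall k, K (level (ty k) e) (s k)) /\
    forall p, p \in sad ->
      eqm K (level (ty p.1.1) e).+1 (s p.1.1) (s p.1.2 * p.2.2).
Proof.
elim: sad => [|[[p q] [h z]] sad IH] fE sadP.
  by exists (fun=> 1); split=> // k; apply: layer1.
have [||s [Ks sE]] := IH; first exact: forest_tail fE.
  by move=> r sr; apply: sadP; rewrite inE sr orbT.
pose E := [seq r.1 | r <- sad]; have npq : root E p != root E q := fE [::] p q E erefl.
have [/= tpq Kz] := sadP _ (mem_head _ _).
pose y := (s q)^-1 * s p * z^-1.
have Ky : K (level (ty q) e) y.
  rewrite /y; apply: layerM; last by rewrite -tpq; apply: layerV.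
  by apply: layerM; [apply: layerV | rewrite -tpq].
have tE r : r \in E -> ty r.1 = ty r.2.
  by case/mapP=> r' sr' ->; have [] := sadP r'; rewrite ?inE ?sr' ?orbT.
exists (fun k => if root E k == root E q then s k * y else s k); split.
  move=> k; case: eqP => // Ek; apply: layerM => //.
  by rewrite (root_fine tE Ek).
move=> r; rewrite inE => /predU1P[->|sr] /=.
  by rewrite (negPf npq) eqxx /y !mulgA mulgV mul1g mulgVK; apply: eqm_refl.
have <- : root E r.1.1 = root E r.1.2 by apply/root_edge/map_f.
case: eqP => [Er|_]; last exact: sE.
have Ky' : K (level (ty r.1.1) e) y by rewrite (root_fine tE Er).
move: y {Ky} Ky' => y Ky.
apply: eqm_trans (eqmMr _ (sE r sr)) _; rewrite -!mulgA; apply: eqmMl.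
exact/eqm_sym/eqm_central.
Qed.

(** * Climbing the filtration *)

Hypothesis K1 : forall x, K 1%N x.

Lemma evolution_zero D0 es D f g chi : evolution D0 es D f g ->
  valid 0 D0 chi -> g 0 chi.
Proof.
have K0 k x : K (level (ty k) 0) x by case: (ty k); [apply/layerW/K1 | apply: K1].
by move=> ev Vd; elim: ev => {es D f g} // *; split=> //; apply: K0.
Qed.

Lemma twist_sum_single (S : pred nat) d i D chi k w : uniq (names D) ->
  (k, w) \in D -> S k -> (forall k', k' \in names D -> S k' -> k' = k) ->
  twist_sum S d i D chi = coef d i (twist chi k w).
Proof.
move=> uD Dw Sk SD; rewrite (twist_sum_names _ _ _ _ uD) (big_rem k) ?(mem_names Dw) //=.
rewrite Sk (curve_namedE uD Dw) big_seq_cond big_pred0 ?addr0 // => k1.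
apply/negP => /andP[+ Sk1]; rewrite (rem_filter _ uD) mem_filter => /andP[/= /eqP nk Dk1].
exact/nk/SD.
Qed.

(* [c k] is the initial curve of the component of the sheet [k]. *)
Variable c : nat -> nat.

Section Climb.
Variables (D0 D : diagram) (es : seq event).
Variables (f : coloring N -> coloring N) (g : nat -> coloring N -> Prop).
Hypothesis ev : evolution D0 es D f g.
Hypothesis cE : forall p, p \in saddle_list es -> c p.1 = c p.2.
Hypothesis tyc : forall k k', c k = c k' -> ty k = ty k'.
Hypothesis c0 : forall k, k \in names D0 -> c k = k.
Hypothesis cu : forall k, k \in used_names D0 es -> c k \in names D0.
Hypothesis cD : {in names D &, injective c}.
Hypothesis fE : forest (saddle_list es).
Hypothesis connected : forall k, k \in used_names D0 es -> same_sheet es k (c k).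

Let tyE p : p \in saddle_list es -> ty p.1 = ty p.2.
Proof. by move/cE/tyc. Qed.

(** Twist is only exchanged between sheets of the same component. *)
Lemma component_jump k d i (sad : saddle_data) : [seq p.1 | p <- sad] = saddle_list es ->
  jump (fun n => c n == k) d i sad = 0%R.
Proof.
move=> Es; rewrite /jump big_seq big1 // => p sp.
by rewrite (cE (p := p.1)) ?subrr ?mul0r // -Es map_f.
Qed.

(** One more layer.  The curves at the end have no twist modulo the next layer, as
    each of them is the only one of its component.  For a saddle, apply the
    balance to one of the two sides into which it separates its tree: the only
    flow into that side is the twist moved by this saddle, which is therefore
    trivial.  Now [evolution_lift] applies, with base colours corrected by
    [forest_solution]; the correction is normalised to be trivial on the first
    diagram by dividing by its value there. *)
Lemma climb_step e chi : valid e.+1 D0 chi -> g e chi ->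
  exists chi', [/\ over chi' = over chi,
    forall k, k \in names D0 -> base chi' k = base chi k & g e.+1 chi'].
Proof.
move=> V1 gE; have [sad [Es sadP bal lift]] := evolution_lift ev gE.
have [uD sD] := evolution_names ev.
have uD0 : uniq (names D0) by elim: ev.
have Vd := evolution_valid ev gE.
have curve_trivial k w i : (k, w) \in D ->
    (Delta %| coef (level (ty k) e) i (twist (f chi) k w))%Z.
  move=> Dw; pose S (n : nat) := c n == c k.
  have St n : S n -> ty n = ty k by move/eqP/tyc.
  have := bal _ _ i St; rewrite (component_jump _ _ _ Es) addr0.
  rewrite (@twist_sum_single S _ _ _ _ k w) /S ?eqxx //; last first.
    by move=> k' Dk' /eqP/cD; apply=> //; apply: mem_names Dw.
  have := twist_sum_trivial i V1 St.
  set a := twist_sum _ _ _ _ _; set b := coef _ _ _ => Ha Hb.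
  by rewrite -(subrK a b); apply: rpredD.
have triv p : p \in sad -> K (level (ty p.1.1) e).+1 p.2.1.
  move=> sp; have [tp Kh _] := sadP p sp; apply/coefP; split=> // i.
  case/path.splitPr: sp Es bal tp Kh => sad1 sad2 Es bal tp Kh.
  case: p Es bal tp Kh => [[p q] [h z]] /= Es bal tp Kh.
  rewrite map_cat /= in Es.
  set E1 := [seq r.1 | r <- sad1] in Es; set E2 := [seq r.1 | r <- sad2] in Es.
  have npq := fE (esym Es).
  (* The side of [q] after removing the saddle [(p, q)]. *)
  pose S (n : nat) := root (E1 ++ E2) n == root (E1 ++ E2) q.
  have E12 r : r \in E1 ++ E2 -> r \in saddle_list es.
    by rewrite -Es !mem_cat inE => /orP[]->; rewrite ?orbT.
  have St n : S n -> ty n = ty p.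
    move/eqP => Sn; rewrite tp; apply: tyc.
    by apply: root_fine Sn => r /E12; apply: cE.
  have S12 r : r \in E1 ++ E2 -> S r.1 = S r.2.
    by move=> Er; rewrite /S (root_edge Er).
  have := bal _ _ i St; rewrite /jump big_cat big_cons /=.
  rewrite big_seq big1 ?add0r; last first.
    by move=> r sr; rewrite S12 ?subrr ?mul0r // mem_cat map_f.
  rewrite big_seq big1 ?addr0; last first.
    by move=> r sr; rewrite S12 ?subrr ?mul0r // mem_cat (map_f _ sr) orbT.
  rewrite /S (negPf npq) eqxx subr0 mul1r -/S.
  have := twist_sum_trivial i V1 St.
  have : (Delta %| twist_sum S (level (ty p) e) i D (f chi))%Z.
    rewrite /twist_sum big_seq_cond; apply: rpred_sum => -[k w] /andP[Dw Sk].
    by rewrite -(St k Sk); apply: curve_trivial.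
  set a := twist_sum _ _ _ D _; set b := twist_sum _ _ _ _ _; set d := coef _ _ _.
  move=> Ha Hb Hd; rewrite (_ : d = a - b - (a - (b + d)))%R; last by ring.
  by apply: rpredB => //; apply: rpredB.
have [||s [Ks sE]] := @forest_solution e sad.
- by rewrite Es.
- by move=> p /sadP[].
have us k : k \in names D0 -> k \in used_names D0 es by rewrite mem_cat => ->.
(* Dividing by the value at the initial curve of each component leaves the first
   diagram as it is; modulo the next layer this factor is central. *)
pose s1 k := if c k \in names D0 then s k * (s (c k))^-1 else 1.
have Ks1 k : K (level (ty k) e) (s1 k).
  rewrite /s1; case: ifP => [ck|_]; last exact: layer1.
  have tk : ty (c k) = ty k by apply: tyc; rewrite (c0 ck).
  by apply: layerM => //; rewrite -tk; apply: layerV.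
have s10 k : k \in names D0 -> s1 k = 1.
  by move=> Dk; rewrite /s1 c0 // Dk mulgV.
pose chi' := Coloring (over chi) (fun k => base chi k * s1 k).
have V1' : valid e.+1 D0 chi'.
  move=> k w Dw; rewrite /fits /= s10 ?mulg1; first exact: V1.
  exact: mem_names Dw.
have sh : shifted e s1 chi chi' by split=> // k; apply: eqm_refl.
have [|g' _] := lift V1 triv s1 chi' Ks1 V1' sh.
  move=> p sp; have Ep : p.1 \in saddle_list es by rewrite -Es map_f.
  rewrite /s1 -(cE Ep) cu; last by have [] := saddle_used D0 Ep.
  apply: eqm_trans (eqmMr _ (sE p sp)) _; rewrite -!mulgA; apply: eqmMl.
  have cp : c p.1.1 \in names D0 by apply: cu; have [] := saddle_used D0 Ep.
  have tp : ty (c p.1.1) = ty p.1.1 by apply: tyc; rewrite (c0 cp).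
  by apply/eqm_sym/eqm_central/layerV; rewrite -tp.
by exists chi'; split=> // k Dk; rewrite /= s10 ?mulg1.
Qed.

Lemma climb e chi : valid e D0 chi ->
  exists chi', [/\ over chi' = over chi,
    forall k, k \in names D0 -> base chi' k = base chi k & g e chi'].
Proof.
elim: e => [|e IH] Vd; first by exists chi; split=> //; apply: evolution_zero ev Vd.
have [chi1 [o1 b1 g1]] := IH (valid_le Vd).
have V1 : valid e.+1 D0 chi1.
  move=> k w Dw; have := Vd k w Dw.
  by rewrite /fits o1 b1 // (mem_names Dw).
have [chi2 [o2 b2 g2]] := climb_step V1 g1.
by exists chi2; split=> // [|k Dk]; rewrite ?o2 // b2 // b1.
Qed.

(** A colouring of one end extends over the whole movie; the total longitude of
    a component and the conjugacy classes of the meridians are the same at the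
    other end. *)
Theorem evolution_transfer e chi : valid e D0 chi -> exists chi',
  [/\ valid e D chi',
      forall k k' w w' i, (k, w) \in D0 -> (k', w') \in D -> c k' = k ->
        (Delta %| (coef (level (ty k) e) i (twist chi' k' w')
                   - coef (level (ty k) e) i (twist chi k w))%R)%Z &
      forall k, k \in names D -> ty k = false ->
        conjugate e (base chi (c k)) (base chi' k)].
Proof.
move=> Vd; have [chi1 [o1 b1 g1]] := climb Vd; exists (f chi1).
have [uD sD] := evolution_names ev.
have uD0 : uniq (names D0) by elim: ev.
split; first exact: evolution_valid ev _ _ g1.
  move=> k k' w w' i Dw Dw' ck'.
  have [sad [Es _ bal _]] := evolution_lift ev g1.
  pose S (n : nat) := c n == k.
  have St n : S n -> ty n = ty k.
    by move/eqP => cx; apply: tyc; rewrite cx c0 // (mem_names Dw).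
  have := bal _ _ i St; rewrite (component_jump _ _ _ Es) addr0.
  rewrite (twist_sum_single _ _ _ uD Dw') /S ?ck' //; last first.
    move=> k1 Dk1 /eqP ck1; apply: cD => //; first exact: mem_names Dw'.
    by rewrite ck1 ck'.
  rewrite (twist_sum_single _ _ _ uD0 Dw) /S ?c0 ?(mem_names Dw) //; last first.
    by move=> k1 Dk1; rewrite c0 // => /eqP.
  have -> : twist chi1 k w = twist chi k w.
    by rewrite /twist o1 b1 // (mem_names Dw).
  by rewrite -(St k') // /S ck'.
move=> k Dk tk; have [a [a0 aD aS]] := evolution_conjugate ev g1.
have uk := sD _ Dk; have ck := cu uk.
rewrite -b1 // -a0 //; apply: conjugate_trans (aD _ Dk tk).
suff [_ H] : ty k = ty (c k) /\ (ty k = false -> conjugate e (a k) (a (c k))).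
  exact/conjugate_sym/H.
elim: (connected uk) => [x y|x|x y _ [txy H]|x y z _ [txy H] _ [tyz H']].
- rewrite joins_saddle => sxy; split; first exact: (tyE sxy).
  by move=> tx; apply: (aS (x, y)).
- by split=> // _; apply/conjugate_eqm/eqm_refl.
- by split=> // ty'; apply/conjugate_sym/H; rewrite txy.
- split=> [|tx]; first by rewrite txy.
  by apply: conjugate_trans (H tx) (H' _); rewrite -txy.
Qed.

End Climb.

End Colorings.

(** * Unitriangular matrices *)

Section Unitriangular.
Variable n : nat.
Local Open Scope ring_scope.

Definition is_unitri (M : 'M[int]_n.+1) : bool :=
  [forall a : 'I_n.+1, forall b : 'I_n.+1, (b <= a)%N ==> (M a b == (a == b)%:R)].

Record unitri := Unitri { unitri_mx :> 'M[int]_n.+1; unitriP : is_unitri unitri_mx }.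
HB.instance Definition _ := [isSub for unitri_mx].
HB.instance Definition _ := [Choice of unitri by <:].

Lemma is_unitriP (M : 'M[int]_n.+1) :
  reflect (forall a b : 'I_n.+1, (b <= a)%N -> M a b = (a == b)%:R) (is_unitri M).
Proof.
apply: (iffP forallP) => [H a b ba|H a].
  by have /forallP/(_ b)/implyP/(_ ba)/eqP := H a.
by apply/forallP => b; apply/implyP => ba; rewrite H.
Qed.

Lemma unitri_low (x : unitri) (a b : 'I_n.+1) : (b < a)%N -> x a b = 0.
Proof.
move=> ba; have /is_unitriP -> := unitriP x; last exact: ltnW.
by rewrite -val_eqE gtn_eqF.
Qed.

Lemma unitri_diag (x : unitri) (a : 'I_n.+1) : x a a = 1.
Proof. by have /is_unitriP -> := unitriP x; rewrite ?leqnn // eqxx. Qed.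

Lemma unitri1_subproof : is_unitri 1%:M.
Proof. by apply/is_unitriP => a b _; rewrite mxE. Qed.
Definition unitri1 := Unitri unitri1_subproof.

Lemma unitriM_subproof (x y : unitri) : is_unitri (x *m y).
Proof.
apply/is_unitriP => a b ba; rewrite mxE.
have [<-|nab] := eqVneq a b.
  rewrite (bigD1 a) //= !unitri_diag mul1r big1 ?addr0 // => c ca.
  have [lca|] := ltnP c a; first by rewrite unitri_low // mul0r.
  by rewrite leq_eqVlt val_eqE eq_sym (negPf ca) /= => lac; rewrite (unitri_low y) ?mulr0.
have {nab}ba : (b < a)%N by rewrite ltn_neqAle ba andbT eq_sym.
rewrite big1 // => c _; have [lca|ac] := ltnP c a; first by rewrite unitri_low // mul0r.
by rewrite (unitri_low y) ?mulr0 // (leq_trans ba).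
Qed.
Definition unitriM x y := Unitri (unitriM_subproof x y).

Lemma unitri_unit (x : unitri) : unitri_mx x \in unitmx.
Proof.
rewrite unitmxE -det_tr det_trig; last first.
  by apply/is_trig_mxP => a b ab; rewrite mxE unitri_low.
by rewrite big1 ?unitr1 // => a _; rewrite mxE unitri_diag.
Qed.

Lemma unitriV_subproof (x : unitri) : is_unitri (invmx x).
Proof.
apply/is_unitriP => a; set y := invmx x.
have xy a1 b1 : \sum_c x a1 c * y c b1 = (a1 == b1)%:R.
  by have /matrixP/(_ a1 b1) := mulmxV (unitri_unit x); rewrite !mxE.
have [k] := ubnP (n - a); elim: k a => // k IH a ak b ba.
rewrite -xy (bigD1 a) //= unitri_diag mul1r big1 ?addr0 // => c ca.
have [lca|] := ltnP c a; first by rewrite unitri_low // mul0r.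
rewrite leq_eqVlt val_eqE eq_sym (negPf ca) /= => lac.
rewrite IH; first by rewrite -val_eqE gtn_eqF ?mulr0 // (leq_ltn_trans ba).
  by have := ltn_ord c; move: lac ak; lia.
exact: leq_trans ba (ltnW lac).
Qed.
Definition unitriV x := Unitri (unitriV_subproof x).

Lemma unitriMA : associative unitriM.
Proof. by move=> x y z; apply: val_inj; rewrite /= mulmxA. Qed.
Lemma unitri1M : left_id unitri1 unitriM.
Proof. by move=> x; apply: val_inj; rewrite /= mul1mx. Qed.
Lemma unitriM1 : right_id unitri1 unitriM.
Proof. by move=> x; apply: val_inj; rewrite /= mulmx1. Qed.
Lemma unitriVM : left_inverse unitri1 unitriV unitriM.
Proof. by move=> x; apply: val_inj; rewrite /= mulVmx ?unitri_unit. Qed.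
Lemma unitriMV : right_inverse unitri1 unitriV unitriM.
Proof. by move=> x; apply: val_inj; rewrite /= mulmxV ?unitri_unit. Qed.

HB.instance Definition _ := isGroup.Build unitri
  unitriMA unitri1M unitriM1 unitriVM unitriMV.

Lemma val_mul (x y : unitri) : unitri_mx (x * y)%g = unitri_mx x *m unitri_mx y.
Proof. by []. Qed.

Lemma val_one : unitri_mx 1%g = 1%:M.
Proof. by []. Qed.

Variable Delta : int.

(** Restricted to the first [d] diagonals, congruences are compatible with products
    of unitriangular matrices, and commutators gain one diagonal. *)
Definition cong_mx d (M M' : 'M[int]_n.+1) : Prop :=
  forall a b : 'I_n.+1, (b < a + d)%N -> (Delta %| M a b - M' a b)%Z.

Lemma cong_refl d M : cong_mx d M M.
Proof. by move=> a b _; rewrite subrr dvdz0. Qed.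

Lemma cong_sym d M M' : cong_mx d M M' -> cong_mx d M' M.
Proof. by move=> H a b ab; rewrite -opprB rpredN; apply: H. Qed.

Lemma cong_trans d M M' M'' : cong_mx d M M' -> cong_mx d M' M'' -> cong_mx d M M''.
Proof.
move=> H H' a b ab; rewrite -(subrKA (M' a b)).
by apply: rpredD; [apply: H | apply: H'].
Qed.

Lemma cong_mull d (x : unitri) M M' : cong_mx d M M' -> cong_mx d (x *m M) (x *m M').
Proof.
move=> H a b ab; rewrite !mxE -sumrB; apply: rpred_sum => c _.
rewrite -mulrBr; have [ca|ac] := ltnP c a; first by rewrite unitri_low // mul0r dvdz0.
by apply/dvdz_mull/H; apply: leq_trans ab _; rewrite leq_add2r.
Qed.

(** A commutator of matrices is that of their strictly triangular parts, where
    every product moves one diagonal further up. *)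
Lemma cong_comm d (x y : unitri) : cong_mx d x 1%:M -> cong_mx d.+1 (x *m y) (y *m x).
Proof.
move=> H a b ab; pose X := unitri_mx x - 1%:M; pose Y := unitri_mx y - 1%:M.
have -> : (x *m y) a b - (y *m x) a b = (X *m Y) a b - (Y *m X) a b.
  have -> : unitri_mx x = 1%:M + X by rewrite /X addrC subrK.
  have -> : unitri_mx y = 1%:M + Y by rewrite /Y addrC subrK.
  rewrite !mulmxDl !mulmxDr !mulmx1 !mul1mx !mxE; ring.
have strict (z : unitri) (i j : 'I_n.+1) : (j <= i)%N -> (unitri_mx z - 1%:M) i j = 0.
  by move=> ji; rewrite !mxE; have /is_unitriP -> := unitriP z; rewrite ?subrr.
have HX (i j : 'I_n.+1) : (j < i + d)%N -> (Delta %| X i j)%Z by move/H; rewrite /X !mxE.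
apply: rpredB; rewrite mxE; apply: rpred_sum => c _.
  have [bc|cb] := leqP b c; first by rewrite (strict y) // mulr0 dvdz0.
  by apply/dvdz_mulr/HX; apply: leq_trans cb _; rewrite -ltnS -addnS.
have [ca|ac] := leqP c a; first by rewrite (strict y) // mul0r dvdz0.
by apply/dvdz_mull/HX; apply: leq_trans ab _; rewrite addnS ltn_add2r.
Qed.

Definition unitri_layer d (x : unitri) : Prop := cong_mx d x 1%:M.

Lemma unitri_layer1 d : unitri_layer d 1%g. Proof. exact: cong_refl. Qed.

Lemma unitri_layerM d (x y : unitri) :
  unitri_layer d x -> unitri_layer d y -> unitri_layer d (x * y)%g.
Proof.
move=> Hx /(cong_mull x) Hy; apply: (cong_trans Hy).
by rewrite mulmx1.
Qed.

Lemma unitri_layerV d (x : unitri) : unitri_layer d x -> unitri_layer d x^-1%g.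
Proof.
move=> /(cong_mull (x^-1)%g); rewrite mulmx1 -val_mul mulVg val_one.
exact: cong_sym.
Qed.

Lemma unitri_layerW d (x : unitri) : unitri_layer d.+1 x -> unitri_layer d x.
Proof. by move=> H a b ab; apply: H; rewrite addnS ltnW. Qed.

Lemma unitri_layer_all (x : unitri) : unitri_layer 1 x.
Proof.
move=> a b; rewrite addn1 ltnS => ba; have /is_unitriP -> := unitriP x => //.
by rewrite mxE subrr dvdz0.
Qed.

Lemma unitri_layer0 (x : unitri) : unitri_layer 0 x.
Proof. exact/unitri_layerW/unitri_layer_all. Qed.

Lemma unitri_layerR d (x y : unitri) :
  unitri_layer d x -> unitri_layer d.+1 (commg x y).
Proof.
move=> Hx; have -> : commg x y = ((y * x)^-1 * (x * y))%g.
  by rewrite commgEl /conjg invgM !mulgA.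
have := cong_mull ((y * x)^-1)%g (cong_comm y Hx).
by rewrite -!val_mul mulVg.
Qed.

Definition unitri_filtration : filtration unitri :=
  Filtration unitri_layer0 unitri_layer1 unitri_layerM unitri_layerV
    unitri_layerW unitri_layerR.

Lemma eqm_unitri d (x y : unitri) : eqm unitri_filtration d x y <-> cong_mx d y x.
Proof.
split=> [/(cong_mull x)|/(cong_mull (x^-1)%g)]; rewrite -!val_mul ?mulmx1.
  by rewrite mulVKg.
by rewrite mulVg.
Qed.

(** The guard leaves out the main diagonal, whose entries are all 1. *)
Definition diag_coef d (i : 'I_n.+1 * 'I_n.+1) (x : unitri) : int :=
  if (i.1 < i.2)%N && (i.2 == i.1 + d :> nat)%N then x i.1 i.2 else 0.

Lemma diag_coefP d (x : unitri) : unitri_filtration d.+1 x <->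
  unitri_filtration d x /\ forall i, (Delta %| diag_coef d i x)%Z.
Proof.
split=> [H|[H1 H2] a b].
  split=> [|[a b]]; first exact: unitri_layerW.
  rewrite /diag_coef /=; case: ifP => [/andP[ab /eqP E]|_]; last exact: dvdz0.
  have := H a b; rewrite E addnS ltnSn mxE -val_eqE (ltn_eqF ab) subr0; exact.
rewrite addnS ltnS leq_eqVlt => /orP[/eqP E|]; last exact: H1.
have [ab|ba] := ltnP a b; last first.
  by have /is_unitriP -> := unitriP x => //; rewrite mxE subrr dvdz0.
have := H2 (a, b); rewrite /diag_coef /= ab E eqxx mxE -val_eqE (ltn_eqF ab) subr0.
exact.
Qed.

Lemma diag_coefM d i (x y : unitri) : unitri_filtration d x -> unitri_filtration d y ->
  (Delta %| (diag_coef d i (x * y)%g - (diag_coef d i x + diag_coef d i y))%R)%Z.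
Proof.
move=> Hx _; rewrite /diag_coef; case: ifP => [/andP[ab /eqP E]|_]; last first.
  by rewrite (_ : _ - _ = 0) ?dvdz0.
case: i ab E => a b /= ab E; rewrite mxE (bigD1 a) //= unitri_diag mul1r.
rewrite (bigD1 b) /=; last by rewrite -val_eqE gtn_eqF.
rewrite unitri_diag mulr1; set s := \sum_(_ | _) _.
rewrite (_ : _ - _ = s); last by ring.
apply: rpred_sum => c /andP[ca cb]; have [lca|lac] := ltnP c a.
  by rewrite unitri_low // mul0r dvdz0.
have [lbc|lcb] := ltnP b c; first by rewrite (unitri_low y) // mulr0 dvdz0.
have := Hx a c; rewrite mxE eq_sym (negPf ca) subr0 => H; apply/dvdz_mulr/H.
by rewrite -E ltn_neqAle lcb val_eqE cb.
Qed.

End Unitriangular.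

(** * Magnus expansion and matrices *)

Section WordValue.
Local Open Scope group_scope.
Variables (N : groupType) (K : filtration N).

Definition value (T : Type) (h : T -> N) (w : word T) : N :=
  foldr (fun g x => gpow (h g.1) g.2 * x) 1 w.

Lemma value_cat T (h : T -> N) u v : value h (u ++ v) = value h u * value h v.
Proof. by elim: u => [|g u IH] /=; rewrite ?mul1g // IH mulgA. Qed.

Lemma value_winv T (h : T -> N) w : value h (winv w) = (value h w)^-1.
Proof.
elim: w => [|[x b] w IH] /=; first by rewrite invg1.
rewrite /winv /= rev_cons -cats1 value_cat -/(winv w) IH invgM /= mulg1.
by rewrite gpowN.
Qed.

Lemma value_whom T U (f : T -> word U) (h : U -> N) w :
  value h (whom f w) = value (value h \o f) w.
Proof.
elim: w => //= -[x b] w IH; rewrite /whom /= value_cat -/(whom f w) IH /=.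
by case: b; rewrite ?value_winv.
Qed.

Lemma value_eqm (T : Type) d (h h' : T -> N) w :
  (forall x, eqm K d (h x) (h' x)) -> eqm K d (value h w) (value h' w).
Proof.
by move=> hh; elim: w => //= g w IH; apply: eqmM => //; apply: eqm_gpow.
Qed.

End WordValue.

Section MagnusRecursion.
Variable m : nat.
Local Open Scope ring_scope.
Implicit Types (f : series m) (I : seq 'I_m) (w : word 'I_m).

Definition gen_times (i : 'I_m) f : series m :=
  fun I => if I is x :: I' then if x == i then f I' else 0 else 0.

Lemma magnus_true i w I :
  magnus ((i, true) :: w) I = magnus w I + gen_times i (magnus w) I.
Proof.
rewrite /= /series_mul; case: I => [|x I].
  by rewrite big_ord_recl big_ord0 /= mul1r.
rewrite !big_ord_recl /= mul1r; congr (_ + _).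
rewrite big1 => [|k _]; last first.
  by rewrite /magnus_gen /= /bump /= add1n; case: I k => [[]|y I k] //=;
    rewrite ?eqseq_cons ?andbF ?mul0r.
by rewrite addr0 /magnus_gen /= take0 drop0 eqseq_cons andbT; case: eqP; rewrite ?mul1r ?mul0r.
Qed.

Lemma magnus_false i w I :
  magnus w I = magnus ((i, false) :: w) I + gen_times i (magnus ((i, false) :: w)) I.
Proof.
rewrite /= /series_mul; case: I => [|x I].
  by rewrite big_ord_recl big_ord0 /= mul1r !addr0.
rewrite big_ord_recl /= mul1r -addrA -[LHS]addr0; congr (_ + _).
case: ifP => [xi|xi].
  rewrite -big_split /= big1 // => k _.
  rewrite /magnus_gen /= xi /=; case: ifP => _; last by rewrite !mul0r addr0.
  by rewrite exprS mulN1r mulNr addNr.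
by rewrite addr0 big1 // => k _; rewrite /magnus_gen /= xi mul0r.
Qed.

End MagnusRecursion.

Section Substitution.
Variables (m n : nat).
Local Open Scope ring_scope.
Implicit Types (f g : series m) (I : seq 'I_m) (w : word 'I_m).
Implicit Types (a b c : 'I_n.+1).

(** The homogeneous part of degree [k] of [f], evaluated at the matrices [P i];
    the recursion splits off the first variable of each monomial. *)
Fixpoint degree_part (P : 'I_m -> 'M[int]_n.+1) k f : 'M[int]_n.+1 :=
  if k is k'.+1 then \sum_i P i *m degree_part P k' (fun I => f (i :: I))
  else (f [::])%:M.

Section Strict.
Variable P : 'I_m -> 'M[int]_n.+1.
Hypothesis strictP : forall i a b, (b <= a)%N -> P i a b = 0.

Lemma eq_degree_part k f g : f =1 g -> degree_part P k f = degree_part P k g.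
Proof.
elim: k f g => [|k IH] f g fg /=; first by rewrite fg.
by apply: eq_bigr => i _; rewrite (IH _ (fun I => g (i :: I))).
Qed.

Lemma degree_part_add k f g :
  degree_part P k (fun I => f I + g I) = degree_part P k f + degree_part P k g.
Proof.
elim: k f g => [|k IH] f g /=; first by rewrite raddfD.
by rewrite -big_split /=; apply: eq_bigr => i _; rewrite IH mulmxDr.
Qed.

Lemma degree_part_zero k : degree_part P k (fun=> 0) = 0.
Proof.
elim: k => [|k IH] /=; first by rewrite raddf0.
by rewrite big1 // => i _; rewrite IH mulmx0.
Qed.

Lemma degree_part_low k f a b : (b < a + k)%N -> degree_part P k f a b = 0.
Proof.
elim: k f a b => [|k IH] f a b /=.
  by rewrite addn0 mxE => ba; rewrite -val_eqE gtn_eqF.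
move=> ab; rewrite summxE big1 // => i _; rewrite mxE big1 // => c _.
have [ca|ac] := leqP c a; first by rewrite strictP // mul0r.
by rewrite IH ?mulr0 //; apply: leq_trans ab _; rewrite addnS -addSn leq_add2r.
Qed.

Lemma degree_part_gen_times i k f :
  degree_part P k.+1 (gen_times i f) = P i *m degree_part P k f.
Proof.
rewrite /= (bigD1 i) //= (@eq_degree_part k _ f) => [|I]; last by rewrite eqxx.
rewrite big1 ?addr0 // => j ji; rewrite (@eq_degree_part k _ (fun=> 0)) => [|I].
  by rewrite degree_part_zero mulmx0.
by rewrite (negPf ji).
Qed.

(** Products of more than [n] strictly triangular matrices vanish, so degrees up to
    [n] suffice. *)
Definition substituted f : 'M[int]_n.+1 := \sum_(k < n.+1) degree_part P k f.

Lemma substituted_mul i f g : (forall I, g I = f I + gen_times i f I) ->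
  substituted g = (1%:M + P i) *m substituted f.
Proof.
move=> gE; rewrite mulmxDl mul1mx /substituted.
rewrite (eq_bigr (fun k : 'I__ => degree_part P k f + degree_part P k (gen_times i f))).
  rewrite big_split /=; congr (_ + _); rewrite big_ord_recl /= raddf0 add0r.
  rewrite mulmx_sumr big_ord_recr /=.
  have -> : P i *m degree_part P n f = 0.
    apply/matrixP => a b; rewrite -degree_part_gen_times degree_part_low ?mxE //.
    by rewrite addnS ltnS (leq_trans _ (leq_addl _ _)) // -ltnS ltn_ord.
  by rewrite addr0; apply: eq_bigr => k _; rewrite -degree_part_gen_times.
move=> k _; rewrite -degree_part_add; exact: eq_degree_part.
Qed.

Lemma substituted_one : substituted (@series1 m) = 1%:M.
Proof.
rewrite /substituted big_ord_recl /= /series1 eqxx big1 ?addr0 // => k _.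
rewrite big1 // => i _; rewrite (@eq_degree_part _ _ (fun=> 0)) //.
by rewrite degree_part_zero mulmx0.
Qed.

End Strict.

(** Substituting unitriangular matrices for the generators of a word amounts to
    substituting their strictly triangular parts in its Magnus expansion. *)
Lemma value_substituted (h : 'I_m -> unitri n) w :
  unitri_mx (value h w) = substituted (fun i => unitri_mx (h i) - 1%:M) (magnus w).
Proof.
set P := fun i => _.
have strictP i a b : (b <= a)%N -> P i a b = 0.
  by move=> ba; rewrite !mxE; have /is_unitriP -> := unitriP (h i); rewrite ?subrr.
have hP i : unitri_mx (h i) = 1%:M + P i by rewrite addrC subrK.
elim: w => [|[i b] w IH]; first by rewrite substituted_one.
case: b; rewrite [value _ _]/= val_mul IH.
  rewrite hP; symmetry; apply: substituted_mul => // I; exact: magnus_true.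
have -> : substituted P (magnus w) = unitri_mx (h i) *m substituted P (magnus ((i, false) :: w)).
  by rewrite hP; apply: substituted_mul => // I; apply: magnus_false.
by rewrite mulmxA -val_mul mulVg val_one mul1mx.
Qed.

Section Coefficients.
Variable J : seq 'I_m.
Hypothesis sizeJ : size J = n.

Definition subword (a b : nat) : seq 'I_m := take (b - a) (drop a J).

Lemma size_subword (a b : nat) : (b <= n)%N -> size (subword a b) = (b - a)%N.
Proof. by move=> bn; rewrite size_take size_drop sizeJ; case: ltnP => //; lia. Qed.

Lemma subword_cat (a c b : nat) : (a <= c <= b)%N ->
  subword a b = subword a c ++ subword c b.
Proof.
move=> /andP[ac cb]; rewrite /subword.
have -> : drop c J = drop (c - a) (drop a J) by rewrite drop_drop subnK.
have -> : (b - a = (c - a) + (b - c))%N by lia.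
by rewrite takeD.
Qed.

Lemma subword_all : subword 0 n = J.
Proof. by rewrite /subword subn0 drop0 -sizeJ take_size. Qed.

Lemma subword0 (a b : nat) : (b <= a)%N -> subword a b = [::].
Proof. by rewrite /subword -subn_eq0 => /eqP->; rewrite take0. Qed.

Lemma subword1 (a : nat) : (a < n)%N -> exists x, subword a a.+1 = [:: x].
Proof.
move=> an; have := @size_subword a a.+1 an; rewrite subSnn.
by case: (subword a a.+1) => [|x [|y s]] // _; exists x.
Qed.

Definition meridian_mx (i : 'I_m) : 'M[int]_n.+1 :=
  \matrix_(a, b) (((a == b) || ((b == a.+1 :> nat) && (subword a b == [:: i])))%:R).

Lemma meridian_subproof i : is_unitri (meridian_mx i).
Proof.
apply/is_unitriP => a b ba; rewrite mxE; case: eqP => //= _.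
by case: eqP ba => //= ->; rewrite ltnn.
Qed.

(** The representation whose matrix entries are the Magnus coefficients of the
    subwords of [J]. *)
Definition magnus_rep i : unitri n := Unitri (meridian_subproof i).

Lemma magnus_rep_sub1 i (a b : 'I_n.+1) : (unitri_mx (magnus_rep i) - 1%:M) a b =
  ((b == a.+1 :> nat) && (subword a b == [:: i]))%:R.
Proof.
rewrite !mxE; case: eqP => [->|_] /=; last by rewrite subr0.
by rewrite (ltn_eqF (ltnSn _)) /= subrr.
Qed.

Lemma magnus_repE (w : word 'I_m) a b : (a <= b)%N ->
  value magnus_rep w a b = magnus w (subword a b).
Proof.
move=> ab; rewrite value_substituted; set P := fun i => _.
have PE i (a1 b1 : 'I_n.+1) : P i a1 b1 = ((b1 == a1.+1 :> nat) && (subword a1 b1 == [:: i]))%:R.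
  exact: magnus_rep_sub1.
have partE k f (a1 b1 : 'I_n.+1) :
    degree_part P k f a1 b1 = if (b1 == a1 + k :> nat)%N then f (subword a1 b1) else 0.
  elim: k f a1 b1 => [|k IH] f a1 b1 /=.
    rewrite mxE addn0 val_eqE eq_sym; case: eqP => // ->.
    by rewrite subword0.
  rewrite summxE; under eq_bigr => i _ do rewrite mxE.
  have [an|na] := ltnP a1 n; last first.
    have -> : (b1 == a1 + k.+1 :> nat)%N = false.
      by apply/eqP; have := ltn_ord b1; lia.
    rewrite big1 // => i _; rewrite big1 // => c _; rewrite PE.
    have -> : (c == a1.+1 :> nat) = false by apply/eqP; have := ltn_ord c; lia.
    by rewrite mul0r.
  have a1n : (a1.+1 < n.+1)%N by [].
  have [x Ex] := subword1 an.
  rewrite (bigD1 x) //= [X in _ + X]big1 ?addr0; last first.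
    move=> i ix; rewrite big1 // => c _; rewrite PE.
    by case: eqP => [->|_]; rewrite ?mul0r // Ex eqseq_cons eq_sym (negPf ix) mul0r.
  rewrite (bigD1 (Ordinal a1n)) //= big1 ?addr0; last first.
    move=> c; rewrite -val_eqE /= => /negPf ca; by rewrite PE ca mul0r.
  rewrite PE /= eqxx Ex eqxx mul1r IH /= addSnnS.
  by case: eqP => // E; rewrite (@subword_cat a1 a1.+1 b1) ?Ex // leqnSn E; lia.
rewrite summxE; under eq_bigr => k _ do rewrite partE.
have ban : (b - a < n.+1)%N by have := ltn_ord b; lia.
rewrite (bigD1 (Ordinal ban)) //= subnKC // eqxx big1 ?addr0 // => k.
rewrite -val_eqE /= => /eqP kE; case: eqP => // E; case: kE; lia.
Qed.

(** Expand the corner entry over chains from [0] to [n].  A step from [a] to [b]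
    contributes a letter occurring between the places [a] and [b] of [J], so a
    chain spells a subsequence of [J]; the chains of [n] steps are unit steps and
    spell [J] itself. *)
Lemma corner_entry (Delta : int) (P : 'I_m -> 'M[int]_n.+1) f :
  (0 < n)%N ->
  (forall i a b, (b <= a)%N -> P i a b = 0) ->
  (forall i a b, i \notin subword a b -> (Delta %| P i a b)%Z) ->
  (forall i a b, b = a.+1 :> nat ->
     (Delta %| (P i a b - (subword a b == [:: i])%:R)%R)%Z) ->
  (forall I, (0 < size I < n)%N -> subseq I J -> (Delta %| f I)%Z) ->
  (Delta %| (substituted P f ord0 ord_max - f J)%R)%Z.
Proof.
move=> n0 strictP farP nearP fJ.
have part0 k g a b :
    (forall I, size I = k -> subseq I (subword a b) -> (Delta %| g I)%Z) ->
    (Delta %| degree_part P k g a b)%Z.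
  elim: k g a b => [|k IH] g a b gE /=.
    rewrite mxE; case: eqP => _; rewrite ?mulr0n ?dvdz0 // mulr1n.
    by apply: gE => //; apply: sub0seq.
  rewrite summxE; apply: rpred_sum => i _; rewrite mxE; apply: rpred_sum => c _.
  have [ca|ac] := leqP c a; first by rewrite strictP // mul0r dvdz0.
  have [bc|cb] := ltnP b c.
    by rewrite (@degree_part_low _ strictP) ?mulr0 ?dvdz0 // ltn_addr.
  have [ic|nic] := boolP (i \in subword a c); last by apply/dvdz_mulr/farP.
  apply/dvdz_mull/IH => I sI subI; apply: gE; first by rewrite /= sI.
  rewrite (@subword_cat a c b) ?(ltnW ac) //.
  by apply: (@cat_subseq _ [:: i]); rewrite ?sub1seq.
have partE k g a b : b = (a + k)%N :> nat ->
    (Delta %| (degree_part P k g a b - g (subword a b))%R)%Z.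
  elim: k g a b => [|k IH] g a b E /=.
    rewrite addn0 in E; rewrite mxE -val_eqE /= E eqxx mulr1n subword0 ?E //.
    by rewrite subrr dvdz0.
  have an : (a < n)%N by have := ltn_ord b; lia.
  have a1n : (a.+1 < n.+1)%N by [].
  have [x Ex] := subword1 an; pose a1 := Ordinal a1n : 'I_n.+1.
  rewrite summxE (eq_bigr (fun i => P i a a1 * degree_part P k (fun I => g (i :: I)) a1 b)).
    rewrite (bigD1 x) //= (@subword_cat a a1 b) ?Ex /= ?leqnSn ?E; last lia.
    set s := \sum_(_ | _) _; set p := P x a a1; set q := degree_part _ _ _ _ _.
    set r := g _; rewrite (_ : _ - _ = (p - 1) * q + (q - r) + s)%R; last by ring.
    apply: rpredD; last first.
      apply: rpred_sum => i ix; apply: dvdz_mulr.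
      have := nearP i a a1 erefl; rewrite Ex eqseq_cons eq_sym (negPf ix) subr0; exact.
    apply: rpredD; last first.
      by rewrite /r -E; apply: (IH (fun I => g (x :: I)) a1 b); rewrite E /=; lia.
    by apply: dvdz_mulr; have := nearP x a a1 erefl; rewrite Ex eqxx.
  move=> i _; rewrite mxE (bigD1 a1) //= big1 ?addr0 // => c; rewrite -val_eqE /= => ca.
  have [lca|ac] := leqP c a; first by rewrite strictP // mul0r.
  rewrite (@degree_part_low _ strictP) ?mulr0 // E.
  by move/eqP: ca; lia.
rewrite /substituted summxE (bigD1 (ord_max : 'I_n.+1)) //=.
set s := \sum_(_ | _) _; set p := degree_part _ _ _ _ _.
rewrite (_ : _ - _ = (p - f J) + s)%R; last by ring.
apply: rpredD; first by have := partE n f ord0 ord_max erefl; rewrite /= subword_all.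
apply: rpred_sum => k; rewrite -val_eqE /= => kn.
have {kn} kn : (k < n)%N by have := ltn_ord k; move/eqP: kn; lia.
have [k0|k0] := posnP k; last first.
  by apply: part0 => I sI; rewrite /= subword_all => IJ; apply: fJ; rewrite ?sI ?k0.
by rewrite k0 /= mxE -val_eqE /= (ltn_eqF n0) mulr0n dvdz0.
Qed.

End Coefficients.
End Substitution.

(** * Colourings and longitudes *)

Section Links.
Local Open Scope group_scope.

Section IntegerPowers.
Variable N : groupType.
Implicit Types (x g : N) (k : int).

Definition zpow x k : N := value (fun=> x) (wpow tt k).

Lemma value_wpow (T : Type) (h : T -> N) a k : value h (wpow a k) = zpow (h a) k.
Proof. by rewrite /zpow /wpow; elim: `|k|%N => //= n ->. Qed.

Lemma value_nseq x n b : value (fun=> x) (nseq n (tt, b)) = gpow x b ^+ n.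
Proof. by elim: n => //= n ->; rewrite expgS. Qed.

Lemma zpow0 x : zpow x 0 = 1. Proof. by []. Qed.

Lemma zpowE x k : zpow x k = if (0 <= k)%R then x ^+ `|k| else x^-1 ^+ `|k|.
Proof. by rewrite /zpow /wpow value_nseq; case: (0 <= k)%R. Qed.

Lemma zpowSr x k b : zpow x k * gpow x b = zpow x (k + (if b then 1 else -1))%R.
Proof.
rewrite !zpowE; case: k => n; case: b.
- have -> : (Posz n + 1)%R = Posz n.+1 by lia.
  by rewrite /= expgSr.
- case: n => [|n]; first by rewrite expg0 mul1g.
  have -> : (Posz n.+1 + -1)%R = Posz n by lia.
  by rewrite /= expgSr mulgK.
- case: n => [|n]; first by rewrite /= expg1 mulVg.
  have -> : (Negz n.+1 + 1 = Negz n)%R by rewrite !NegzE; lia.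
  by rewrite /= [x^-1 ^+ n.+2]expgSr mulgVK.
- have -> : (Negz n + -1 = Negz n.+1)%R by rewrite !NegzE; lia.
  by rewrite /= -expgSr.
Qed.

Lemma zpowJ x g k : zpow (x ^ g) k = zpow x k ^ g.
Proof. by rewrite !zpowE -conjVg -!conjXg; case: ifP. Qed.

Lemma zpow_fix x k : x ^ zpow x k = x.
Proof.
have C n : commute x (x ^+ n) by apply: commuteX.
apply/conjg_fixP/commgP; rewrite zpowE; case: ifP => _; first exact: C.
by rewrite expVgn; apply/commuteV/C.
Qed.

End IntegerPowers.

Section Runs.
Variables (N : groupType) (K : filtration N) (A : N).
Implicit Types (o : nat -> N * bool) (w : seq letter) (x : N).

Definition passed o w : N :=
  foldr (fun l x => (if l.2 is Under s then gpow (o l.1).1 s else 1) * x) 1 w.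

Definition self_passed o w : int := (\sum_(l <- w)
  if l.2 is Under s then if (o l.1).2 then if s then 1 else -1 else 0 else 0)%R.

Lemma meridian_run o t x w :
  meridian A t (run A o t x w) = meridian A t x ^ passed o w.
Proof.
elim: w x => [|[c [s|s|s]] w IH] x /=; rewrite ?conjg1 // IH /= ?mul1g //.
by rewrite meridian_pass -conjgM.
Qed.

Lemma run_true o x w :
  run A o true x w = zpow A (- self_passed o w)%R * x * passed o w.
Proof.
elim: w x => [|[c [s|s|s]] w IH] x /=.
- by rewrite /self_passed big_nil oppr0 zpow0 mul1g mulg1.
- by rewrite IH /self_passed big_cons /= add0r mul1g.
- rewrite IH /self_passed big_cons /= /pass /= opprD addrC !mulgA; congr (_ * _ * _ * _).
  case: (o c).2; last by rewrite mulg1 oppr0 addr0.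
  by rewrite zpowSr; case: s; rewrite ?opprK.
- by rewrite IH /self_passed big_cons /= add0r mul1g.
Qed.

Lemma run_false o x w : run A o false x w = x ^ passed o w.
Proof. exact: (meridian_run o false). Qed.

Lemma passed_cat o u v : passed o (u ++ v) = passed o u * passed o v.
Proof. by elim: u => [|l u IH] /=; rewrite ?mul1g // IH mulgA. Qed.

Lemma passed_unders o w : passed o [seq l <- w | is_under l] = passed o w.
Proof. by elim: w => //= -[c [s|s|s]] w IH /=; rewrite IH ?mul1g. Qed.

Lemma self_passed_unders o w : self_passed o [seq l <- w | is_under l] = self_passed o w.
Proof.
rewrite /self_passed big_filter big_mkcond /=; apply: eq_bigr => -[c [s|s|s]] _ //.
Qed.

(** Meridians along a run are conjugates of the initial one by the product of the
    upper colours passed so far, for both types of components. *)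
Lemma overs_fitP e o t x w : overs_fit K A e o t x w <->
  forall u c s v, w = u ++ (c, Over s) :: v ->
    (o c).2 = t /\ eqm K e.+1 (meridian A t x ^ passed o u) (o c).1.
Proof.
elim: w x => [|l w IH] x /=; first by split=> // _ [].
have [IH1 IH2] := IH (pass A o t x l).
have E u : meridian A t x ^ passed o (l :: u) =
    meridian A t (pass A o t x l) ^ passed o u.
  by rewrite -cat1s passed_cat conjgM -(meridian_run o t x [:: l]).
split.
  move=> [lP wP] [|l' u] c s v /= [El Ew]; first by rewrite El /= conjg1 in lP *.
  by rewrite -El E; apply: IH1 Ew.
move=> H; split.
  case: l H {IH IH1 IH2 E} => c [s|s|s] // H.
  by have := H [::] c s w erefl; rewrite /= conjg1.
by apply: IH2 => u c s v Ew; have := H (l :: u) c s v; rewrite Ew E; apply.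
Qed.

End Runs.

Section Arcs.
Variables (m : nat) (L : link_diagram m) (r : 'I_m -> nat).
Local Notation B := (based_curve L r).

Lemma link_wf : well_formed (name_curves (@nat_of_ord m) L).
Proof. by have /andP[] := link_diagramP L. Qed.

Lemma mem_name_curves rho (C : 'I_m -> seq letter) k w :
  (k, w) \in name_curves rho C -> exists i, k = rho i /\ w = C i.
Proof. by case/mapP=> i _ [-> ->]; exists i. Qed.

Lemma name_curves_mem rho (C : 'I_m -> seq letter) i : (rho i, C i) \in name_curves rho C.
Proof. by apply/mapP; exists i; rewrite ?mem_enum. Qed.

Lemma based_letters i l : l \in B i -> l \in letters (name_curves (@nat_of_ord m) L).
Proof. by rewrite mem_rot => Ll; apply: mem_letters Ll; apply: name_curves_mem. Qed.

Lemma letters_based l : l \in letters (name_curves (@nat_of_ord m) L) -> exists i, l \in B i.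
Proof.
case/lettersP=> k [w [/mem_name_curves[i [_ ->]] wl]]; exists i.
by rewrite mem_rot.
Qed.

Lemma based_unique i i' l : l \in B i -> l \in B i' -> i = i'.
Proof.
have [uN uL _ _] := and4P link_wf; rewrite !mem_rot => Li Li'.
have E := curve_throughE uL (name_curves_mem (@nat_of_ord m) L i) Li.
have E' := curve_throughE uL (name_curves_mem (@nat_of_ord m) L i') Li'.
apply/eqP/negPn/negP => nii.
have LL : L i = L i' by rewrite -E -E'.
have := uL; rewrite /letters /name_curves -map_comp => uf.
have : count_mem l (flatten [seq L i | i <- enum 'I_m]) <= 1.
  by rewrite count_uniq_mem ?leq_b1 //; move: uf; congr (uniq (flatten _)); apply: eq_map.
rewrite count_flatten -map_comp sumnE big_map -[enum _]/(enum 'I_m) big_enum /=.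
rewrite (bigD1 i) //= (bigD1 i') //=; last by rewrite eq_sym.
have c1 k : l \in L k -> 0 < count_mem l (L k) by rewrite -has_count has_pred1.
rewrite leqNgt => /negP; apply.
exact: leq_add (c1 _ Li) (leq_trans (c1 _ Li') (leq_addr _ _)).
Qed.

Definition arc_pos i (l : letter) : nat :=
  count is_under (take (index l (B i)) (B i)) %% size (unders L r i).

Lemma arc_overE i l : l \in B i -> arc_over L r l = Some (i, arc_pos i l).
Proof.
move=> Bl; rewrite /arc_over; case: pickP => [i' Bl' /=|/(_ i)]; last by rewrite Bl.
by rewrite (based_unique Bl' Bl).
Qed.

Lemma under_wordE i c s : (c, Under s) \in B i ->
  exists i', (c, Over s) \in B i' /\
    under_word L r (c, Under s) = [:: ((i', arc_pos i' (c, Over s)), s)].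
Proof.
move=> /based_letters/(wf_twin link_wf)/letters_based[i' Bl].
by exists i'; split=> //; rewrite /under_word /= (arc_overE Bl).
Qed.

Variables (N : groupType) (K : filtration N).
Implicit Types (o : nat -> N * bool) (h : 'I_m * nat -> N).

(** Both sides multiply the upper colours met along the curve, once as arcs and once
    as crossings. *)
Lemma value_partial h o d i p :
  (forall i' c s, (c, Over s) \in B i' ->
     eqm K d (h (i', arc_pos i' (c, Over s))) (o c).1) ->
  eqm K d (value h (partial_longitude L r i p)) (passed o (take p (unders L r i))).
Proof.
move=> H; rewrite /partial_longitude.
have sub : {subset take p (unders L r i) <= unders L r i} by apply: mem_take.
elim: (take p _) sub => //= l w IH sub.
have : l \in unders L r i by apply: sub; rewrite mem_head.
rewrite mem_filter => /andP[ul Bl]; case: l ul Bl sub => c [s|s|s] // _ Bl sub.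
have [i' [Bl' ->]] := under_wordE Bl; rewrite value_cat /= mulg1.
apply: eqmM; first exact/eqm_gpow/H.
by apply: IH => l' wl'; apply: sub; rewrite inE wl' orbT.
Qed.

Lemma exponent_partial (j : 'I_m) o i :
  (forall i' c s, (c, Over s) \in B i' -> (o c).2 = (i' == j)) ->
  exponent_sum j (partial_longitude L r i (size (unders L r i))) =
  self_passed o (unders L r i).
Proof.
move=> H; rewrite /partial_longitude take_size /exponent_sum /self_passed.
have sub : {subset unders L r i <= unders L r i} by [].
elim: {1 3 4}(unders L r i) sub => [|l w IH] sub; first by rewrite /= !big_nil.
have : l \in unders L r i by apply: sub; rewrite mem_head.
rewrite mem_filter => /andP[ul Bl]; case: l ul Bl sub => c [s|s|s] // _ Bl sub.
have [i' [Bl' E]] := under_wordE Bl; rewrite /= E big_cons big_cons /= (H _ _ _ Bl').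
have -> := IH (fun l' wl' => sub l' (mem_behead (s := _ :: _) wl')).
by case: (i' == j); rewrite ?add0r.
Qed.

Local Notation phi := (phi L r).
Local Notation longitude := (longitude L r).
Local Notation unders := (unders L r).
Hypothesis K1 : forall x, K 1%N x.

Lemma value_phiS (Q : 'I_m -> N) n a : value Q (phi n.+1 a) =
  Q a.1 ^ value (value Q \o phi n) (partial_longitude L r a.1 a.2).
Proof.
rewrite /= value_cat value_winv /= value_whom; by [].
Qed.

Lemma value_phi_first (Q : 'I_m -> N) n i : value Q (phi n (i, 0%N)) = Q i.
Proof.
case: n => [|n]; first by rewrite /= mulg1.
by rewrite value_phiS /partial_longitude /= take0 /= conjg1.
Qed.

(** Each stage of [phi] gains one layer: conjugating by an element known modulo
    layer [d] gives a result known modulo layer [d.+1]. *)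
Lemma phi_stable (Q : 'I_m -> N) n a :
  eqm K n.+2 (value Q (phi n a)) (value Q (phi n.+1 a)).
Proof.
elim: n a => [|n IH] a; rewrite [X in eqm _ _ _ X]value_phiS.
  by rewrite /= mulg1; apply: eqm_conj_layer.
by rewrite value_phiS; apply/eqmJr/value_eqm => a1; apply: IH.
Qed.

Lemma phi_stable_le (Q : 'I_m -> N) n n' a : n <= n' ->
  eqm K n.+2 (value Q (phi n a)) (value Q (phi n' a)).
Proof.
move/subnKC <-; elim: (n' - n)%N => [|k IH]; first by rewrite addn0.
apply: (eqm_trans IH); rewrite addnS; apply: eqm_le (phi_stable Q _ a).
by rewrite !ltnS leq_addr.
Qed.

Lemma based_uniq i : uniq (B i).
Proof.
rewrite rot_uniq; have [_ uL _ _] := and4P link_wf.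
exact: curve_letters_uniq uL (name_curves_mem (@nat_of_ord m) L i).
Qed.

Lemma arc_posE i u c s v : B i = u ++ (c, Over s) :: v ->
  let p := count is_under u in
  [/\ [seq l <- u | is_under l] = take p (unders i), p <= size (unders i) &
      arc_pos i (c, Over s) = p %% size (unders i)].
Proof.
move=> EB p; have uE : unders i = [seq l <- u | is_under l] ++ [seq l <- v | is_under l].
  by rewrite /Defs.unders EB filter_cat.
have su : size [seq l <- u | is_under l] = p by rewrite size_filter.
split; first by rewrite uE -su take_size_cat.
  by rewrite uE size_cat su leq_addr.
rewrite /arc_pos; congr (count _ _ %% _).
have := based_uniq i; rewrite EB cat_uniq /= negb_or => /and3P[_ /andP[nu _] _].
by rewrite index_cat (negPf nu) /= eqxx addn0 take_size_cat.
Qed.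

Lemma arc_pos_split i c s : (c, Over s) \in B i ->
  exists u v, B i = u ++ (c, Over s) :: v.
Proof. by case/path.splitPr => u v; exists u, v. Qed.

Lemma modn_cases p n : p <= n -> p %% n = p \/ p = n /\ p %% n = 0.
Proof.
rewrite leq_eqVlt => /predU1P[->|pn]; last by left; rewrite modn_small.
by right; rewrite modnn.
Qed.

Variables (j : 'I_m) (A : N) (ty : nat -> bool) (rho : 'I_m -> nat).
Hypothesis tyE : forall i, ty (rho i) = (i == j).

Section FromColoring.
Variables (e : nat) (chi : coloring N).
Hypothesis Vd : valid K A ty e (name_curves rho B) chi.

Definition end_meridian i : N := meridian A (i == j) (base chi (rho i)).

Definition arc_color (a : 'I_m * nat) : N :=
  end_meridian a.1 ^ passed (over chi) (take a.2 (unders a.1)).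

Lemma curve_closes i : eqm K e.+1 (arc_color (i, size (unders i))) (arc_color (i, 0%N)).
Proof.
have [_ C] := Vd (name_curves_mem rho B i); rewrite tyE in C.
rewrite /arc_color /= take_size take0 /= conjg1 passed_unders.
by have := meridian_eqm A C; rewrite meridian_run; apply: eqm_sym.
Qed.

Lemma arc_color_over i c s : (c, Over s) \in B i ->
  (over chi c).2 = (i == j) /\ eqm K e.+1 (arc_color (i, arc_pos i (c, Over s))) (over chi c).1.
Proof.
move=> /arc_pos_split[u [v EB]]; have [Eu pn ->] := arc_posE EB.
have [O _] := Vd (name_curves_mem rho B i); rewrite tyE in O.
have [ct cE] := (overs_fitP _ _ _ _ _ _ _).1 O u c s v EB.
split=> //; rewrite -passed_unders Eu in cE; apply: (eqm_trans _ cE).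
have [->|[pE ->]] := modn_cases pn; first exact: eqm_refl.
by apply: eqm_sym; rewrite {1}pE; apply: curve_closes.
Qed.

(** The arcs of a coloured link satisfy the recursion defining [phi], and each stage
    gains one layer until the precision of the colouring is reached. *)
Lemma phi_arc_color n a :
  eqm K (minn n.+2 e.+1) (value end_meridian (phi n a)) (arc_color a).
Proof.
elim: n a => [|n IH] [i p].
  rewrite /= mulg1; apply: (@eqm_le _ _ _ 2); first exact: geq_minl.
  exact: eqm_conj_layer.
rewrite value_phiS /arc_color /=; set d := minn n.+2 e.+1 in IH.
apply: (@eqm_le _ _ _ d.+1); first by rewrite /d; lia.
apply: eqmJr; apply: (@eqm_trans _ _ _ _ (value arc_color (partial_longitude L r i p))).
  by apply: value_eqm => a; apply: IH.
apply: value_partial => i' c s Bc; apply: (@eqm_le _ _ _ e.+1); first exact: geq_minr.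
by have [] := arc_color_over Bc.
Qed.

(** By [run_true] the twist is a power of the meridian times the upper colours
    passed; up to a conjugation, which is invisible since the twist is central,
    this is the word defining the longitude. *)
Lemma twist_longitude : eqm K e.+1 (twist A ty chi (rho j) (B j))
  (value end_meridian (whom (phi e) (longitude j))).
Proof.
have [_ C] := Vd (name_curves_mem rho B j); rewrite tyE eqxx /= in C.
have Kt : K e (twist A ty chi (rho j) (B j)) by rewrite /twist tyE eqxx.
pose full := passed (over chi) (unders j).
pose k := exponent_sum j (partial_longitude L r j (size (unders j))).
have kE : self_passed (over chi) (B j) = k.
  rewrite /k (exponent_partial (o := over chi)); last by move=> i c s /arc_color_over[].
  by rewrite self_passed_unders.
have tE : twist A ty chi (rho j) (B j) = zpow (end_meridian j) (- k)%R * full.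
  rewrite /twist tyE eqxx run_true kE /full passed_unders /end_meridian eqxx /=.
  by rewrite zpowJ /conjg !mulgA.
set z := zpow _ _ in tE; apply: eqm_trans (eqm_conj_central z Kt) _.
have -> : twist A ty chi (rho j) (B j) ^ z = full * z.
  by rewrite tE /conjg -mulgA mulKg.
rewrite value_whom /Defs.longitude value_cat value_wpow /= value_phi_first -/k -/z.
apply: eqmMr; apply: eqm_sym.
apply: (@eqm_trans _ _ _ _ (value arc_color (partial_longitude L r j (size (unders j))))).
  apply: value_eqm => a; apply: eqm_le (phi_arc_color e a).
  by rewrite leq_min leqnSn leqnn.
rewrite /full -[X in passed _ X]take_size; apply: value_partial => i c s Bc.
by have [] := arc_color_over Bc.
Qed.

End FromColoring.

Section ToColoring.
Variables (e : nat) (Q : 'I_m -> N).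
Hypothesis e0 : 0 < e.
Hypothesis QA : Q j = A.
Let longitude_value i := value Q (whom (phi e) (longitude i)).
Hypothesis commuting : forall i, eqm K e.+1 (Q i ^ longitude_value i) (Q i).
Hypothesis longitude_small : K e (longitude_value j).

(** The name of a crossing does not tell its sign, so both are tried. *)
Definition crossing_color c : N * bool :=
  if arc_over L r (c, Over true) is Some a then (value Q (phi e a), a.1 == j)
  else if arc_over L r (c, Over false) is Some a then (value Q (phi e a), a.1 == j)
  else (1, false).

Lemma crossing_colorE i c s : (c, Over s) \in B i ->
  crossing_color c = (value Q (phi e (i, arc_pos i (c, Over s))), i == j).
Proof.
move=> Bc; rewrite /crossing_color; case: s Bc => Bc; first by rewrite (arc_overE Bc).
rewrite (arc_overE Bc) /arc_over; case: pickP => // i' Bc'.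
have := wf_cross link_wf (based_letters Bc) (based_letters Bc') erefl.
by rewrite !inE => /orP[] /eqP[].
Qed.

(** The state [1] stands for the meridian [A] itself. *)
Definition base_color (i : 'I_m) : N := if i == j then 1 else Q i.

Lemma crossing_color_eqm d i c s : (c, Over s) \in B i ->
  eqm K d (value Q (phi e (i, arc_pos i (c, Over s)))) (crossing_color c).1.
Proof. by move=> Bc; rewrite (crossing_colorE Bc); apply: eqm_refl. Qed.

Let full i := passed crossing_color (unders i).

Lemma full_longitude d i :
  eqm K d (longitude_value i) (full i * zpow (Q i) (- exponent_sum i
    (partial_longitude L r i (size (unders i))))%R).
Proof.
rewrite /longitude_value value_whom /Defs.longitude value_cat value_wpow /= value_phi_first.
apply: eqmMr; rewrite /full -[X in passed _ X]take_size.
by apply: value_partial => i' c s Bc; apply: crossing_color_eqm.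
Qed.

Lemma full_commutes i : eqm K e.+1 (Q i ^ full i) (Q i).
Proof.
set z := zpow (Q i) (- exponent_sum i (partial_longitude L r i (size (unders i))))%R.
have E : eqm K e.+1 (full i) (longitude_value i * z^-1).
  by rewrite -[full i](mulgK z); apply/eqmMr/eqm_sym/full_longitude.
apply: eqm_trans (eqmJ (eqm_refl _ _ _) E) _; rewrite conjgM.
apply: eqm_trans (eqmJ (commuting i) (eqm_refl _ _ _)) _.
rewrite -[X in X ^ z^-1](zpow_fix (Q i) (- exponent_sum i
  (partial_longitude L r i (size (unders i))))%R) conjgK.
exact: eqm_refl.
Qed.

(** Stage [e] of [phi] describes the meridians along the curve, except that after the
    last undercrossing it starts again with [Q i]; there the commutation enters. *)
Lemma phi_color i p : p <= size (unders i) ->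
  eqm K e.+1 (Q i ^ passed crossing_color (take p (unders i)))
    (value Q (phi e (i, p %% size (unders i)))).
Proof.
move=> pn; have [->|[pE ->]] := modn_cases pn; last first.
  rewrite value_phi_first pE take_size; exact: full_commutes.
rewrite -[in phi e](prednK e0) value_phiS /=; apply: eqmJr; apply: eqm_sym.
apply: (@eqm_trans _ _ _ _ (value (value Q \o phi e) (partial_longitude L r i p))).
  apply: value_eqm => a /=; apply: (@eqm_le _ _ _ (e.-1).+2); first by rewrite prednK.
  by apply: phi_stable_le; apply: leq_pred.
by apply: value_partial => i' c s Bc; apply: crossing_color_eqm.
Qed.

(** The arcs are coloured by stage [e] of [phi].  The relation at the end of each
    curve is not built into [phi]: for the curve [j] it holds because its
    longitude lies in layer [e], for the others because meridian and longitude
    commute. *)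
Lemma valid_of_longitudes chi : over chi = crossing_color ->
  (forall i, base chi (rho i) = base_color i) ->
  valid K A ty e (name_curves rho B) chi.
Proof.
move=> oE bE k w /mem_name_curves[i [-> ->]].
have mE : meridian A (i == j) (base_color i) = Q i.
  by rewrite /base_color; case: eqP => //= ->; rewrite conjg1.
rewrite /fits tyE oE bE; split.
  apply/overs_fitP => u c s v EB; have [Eu pn pE] := arc_posE EB.
  have Bc : (c, Over s) \in B i by rewrite EB mem_cat mem_head orbT.
  rewrite (crossing_colorE Bc) /=; split=> //.
  by rewrite mE -passed_unders Eu pE; apply: phi_color.
have [Ei|ni] := eqVneq i j; last first.
  rewrite run_false /base_color (negPf ni) -passed_unders; apply: eqm_sym.
  exact: full_commutes.
rewrite /= run_true /base_color Ei eqxx mulg1 -passed_unders -self_passed_unders.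
rewrite /eqm invg1 mul1g.
have -> : self_passed crossing_color (unders j) =
    exponent_sum j (partial_longitude L r j (size (unders j))).
  rewrite (exponent_partial (o := crossing_color)) // => i' c s Bc.
  by rewrite (crossing_colorE Bc).
set z := zpow _ _.
have EQ : z = zpow (Q j) (- exponent_sum j (partial_longitude L r j (size (unders j))))%R.
  by rewrite QA.
have -> : z * passed crossing_color (unders j) = (passed crossing_color (unders j) * z) ^ z^-1.
  by rewrite /conjg invgK !mulgA mulgK.
apply: layerJ; have := full_longitude e j; rewrite -EQ => /(layerM longitude_small).
by rewrite mulVKg.
Qed.

End ToColoring.

End Arcs.

End Links.

(** * Transfer along a concordance *)

Section ConcordanceTransfer.
Local Open Scope group_scope.
Variables (m : nat) (L L' : link_diagram m).
Hypothesis concordant : welded_concordant L L'.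
Variables (r r' : 'I_m -> nat) (j : 'I_m).
Local Notation D0 := (name_curves (@nat_of_ord m) L).

Lemma names_name_curves (rho : 'I_m -> nat) (C : 'I_m -> seq letter) :
  names (name_curves rho C) = map rho (enum 'I_m).
Proof. by rewrite /names /name_curves -map_comp; apply: eq_map. Qed.

(** Each component of the concordance is a connected surface of Euler
    characteristic zero with one curve at either end, so it has one saddle less
    than sheets: besides the initial curve there is one sheet for each birth and
    for each split, and comparing the numbers of curves at both ends gives as
    many births as merges and as many deaths as splits. *)
Lemma concordance_forest es (rho : 'I_m -> nat) c :
  movie D0 es (name_curves rho L') ->
  (forall k, k \in used_names D0 es -> c k < m /\ same_sheet es k (c k)) ->
  (forall i : 'I_m,
     ((births c i es)%:Z - (saddles c i es)%:Z + (deaths c i es)%:Z = 0)%R) ->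
  forest (saddle_list es).
Proof.
move=> mv conn euler; have /andP[/and4P[uD0 _ _ _] _] := link_diagramP L.
have [_ nE uE] := movie_counts uD0 mv.
have [|bE dE sE] := @euler_count m c es.
  by move=> k esk; have [] := conn k; rewrite /used_names ?mem_cat ?esk ?orbT.
have bal : num_births es + num_deaths es = num_splits es + num_merges es.
  rewrite -bE -dE -sE -big_split /=; apply: eq_bigr => i _.
  by have := euler i; lia.
apply: (@forest_of_count _ (used_names D0 es) m c).
- by move=> k /conn[].
- move=> F k FE /conn[_]; elim=> // [x y|x y z _ -> _ ->] //.
  by rewrite joins_saddle => /FE.
- have sizes (r0 : 'I_m -> nat) (C : 'I_m -> seq letter) : size (names (name_curves r0 C)) = m.
    by rewrite names_name_curves size_map size_enum_ord.
  move: nE uE; rewrite !sizes saddle_list_size => nE ->; lia.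
Qed.

(** [evolution_transfer] for a concordance, with the distinguished sheets being those
    of the [j]-th component, and with arbitrary base points at both ends. *)
Lemma concordance_transfer : exists (ty : nat -> bool) (rho : 'I_m -> nat),
  [/\ forall i : 'I_m, ty i = (i == j), forall i, ty (rho i) = (i == j) &
  forall (N : groupType) (K : filtration N) (A : N) (Delta : int) (I : Type)
    (coef : nat -> I -> N -> int),
  (forall d i x y, K d x -> K d y ->
    (Delta %| (coef d i (x * y)%g - (coef d i x + coef d i y))%R)%Z) ->
  (forall d x, K d.+1 x <-> K d x /\ forall i, (Delta %| coef d i x)%Z) ->
  (forall x, K 1%N x) ->
  forall e chi,
  valid K A ty e (name_curves (@nat_of_ord m) (based_curve L r)) chi ->
  exists chi', [/\ valid K A ty e (name_curves rho (based_curve L' r')) chi',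
    forall i, (Delta %| (coef e i (twist A ty chi' (rho j) (based_curve L' r' j))
      - coef e i (twist A ty chi j (based_curve L r j)))%R)%Z &
    forall i : 'I_m, i != j -> conjugate K e (base chi i) (base chi' (rho i))]].
Proof.
have [es [rho [c [mv cE cP conn euler]]]] := concordant.
have fE := concordance_forest mv conn euler.
have cS p : p \in saddle_list es -> c p.1 = c p.2.
  by move=> sp; apply: cE; rewrite joins_saddle -surjective_pairing.
pose ty k := c k == j; exists ty, rho; split.
- by move=> i; have [ci _] := cP i; rewrite /ty ci val_eqE.
- by move=> i; have [_ ci] := cP i; rewrite /ty ci val_eqE.
move=> N K A Delta I coef coefM coefP K1 e chi V0.
have d0 := link_diagramP L; have uD0 : uniq (names D0) by case/andP: d0 => /and4P[].
have [|wf' [f [g ev]]] := @movie_evolution N K A ty D0 es _ d0 mv.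
  by move=> p /cS; rewrite /ty => ->.
have uD' : uniq (names (name_curves rho L')) by case/and4P: wf'.
have [_ [F tF]] := transportable_rotate_map K A ty r uD0.
have [[F' tF'] _] := transportable_rotate_map K A ty r' uD'.
rewrite -/(name_curves (@nat_of_ord m) (based_curve L r)) in tF.
have V1 := tr_valid tF V0.
have [|||||chi2 [V2 tw2 cj2]] :=
  evolution_transfer coefM coefP K1 ev cS _ _ _ _ fE _ V1.
- by move=> k k'; rewrite /ty => ->.
- by move=> k; rewrite names_name_curves => /mapP[i _ ->]; case: (cP i).
- move=> k /conn[ck _]; rewrite names_name_curves; apply/mapP.
  by exists (Ordinal ck); rewrite ?mem_enum.
- move=> k k'; rewrite names_name_curves => /mapP[i _ ->] /mapP[i' _ ->].
  by have [_ ->] := cP i; have [_ ->] := cP i' => /val_inj->.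
- by move=> k /conn[].
have V3 := tr_valid tF' V2; exists (F' chi2); split; first exact: V3.
  move=> i; have tyj : ty j = true by have [cj _] := cP j; rewrite /ty cj eqxx.
  have tyj' : ty (rho j) = true by have [_ cj] := cP j; rewrite /ty cj eqxx.
  have Dj := name_curves_mem (@nat_of_ord m) (based_curve L r) j.
  have Dj0 := name_curves_mem (@nat_of_ord m) L j.
  have Dj' := name_curves_mem rho L' j.
  have Dj1 := name_curves_mem rho (based_curve L' r') j.
  have t0 := tr_twist tF V0 Dj Dj0; have t2 := tr_twist tF' V2 Dj' Dj1.
  have [_ K0] := V0 _ _ Dj; have [_ K2] := V2 _ _ Dj'.
  have [_ cj] := cP j.
  have := tw2 j (rho j) _ _ i Dj0 Dj' cj.
  rewrite tyj /= in t0 K0 *; rewrite tyj' /= in t2 K2 *.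
  have T0 : K e (twist A ty chi j (based_curve L r j)) by rewrite /twist tyj.
  have T2 : K e (twist A ty chi2 (rho j) (L' j)) by rewrite /twist tyj'.
  move=> H1; have H2 := coef_eqm coefM coefP i T0 t0; have H3 := coef_eqm coefM coefP i T2 t2.
  have := rpredD (rpredD H1 H2) H3; set x := coef _ _ _; set y := coef _ _ _.
  set z := coef _ _ _; set v := coef _ _ _.
  by rewrite (_ : _ - _ + _ + _ = v - z)%R //; ring.
move=> i ij; have ti : ty i = false by have [ci _] := cP i; rewrite /ty ci val_eqE (negPf ij).
have ti' : ty (rho i) = false by have [_ ci] := cP i; rewrite /ty ci val_eqE (negPf ij).
have [g0 E0] := tr_conj tF chi ti.
have [g2 E2] := tr_conj tF' chi2 ti'.
apply: (@conjugate_trans _ K e _ (base (F chi) i)).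
  by exists g0; rewrite E0; apply: eqm_refl.
have [_ ci] := cP i; apply: (@conjugate_trans _ K e _ (base chi2 (rho i))).
  rewrite -{1}ci; apply: cj2 => //; apply: mem_names; exact: name_curves_mem rho L' i.
by exists g2; rewrite E2; apply: eqm_refl.
Qed.

End ConcordanceTransfer.

(** * Milnor numbers as matrix entries *)

Section Gcd.
Variables (I : Type) (P : pred I) (F : I -> int).
Local Open Scope ring_scope.

Lemma big_gcdz_dvd (s : seq I) d : (forall i, P i -> (d %| F i)%Z) ->
  (d %| \big[gcdz/0]_(i <- s | P i) F i)%Z.
Proof.
by move=> H; elim/big_ind: _ => [|x y dx dy|//]; rewrite ?dvdz0 // dvdz_gcd dx.
Qed.

End Gcd.

Lemma dvd_big_gcdz (I : eqType) (P : pred I) (F : I -> int) (s : seq I) i :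
  i \in s -> P i -> (\big[gcdz/0%R]_(i <- s | P i) F i %| F i)%Z.
Proof.
elim: s => // x s IH; rewrite inE big_cons => /predU1P[<- Pi|/IH{}IH /IH H].
  by rewrite Pi dvdz_gcdl.
by case: ifP => // _; apply: dvdz_trans (dvdz_gcdr _ _) H.
Qed.

Section Milnor.
Variables (m : nat) (L : link_diagram m) (r : 'I_m -> nat).
Implicit Types (I J K : seq 'I_m) (i j : 'I_m).

Lemma mu_rcons I j :
  mu L r (rcons I j) = magnus (whom (phi L r (size I)) (longitude L r j)) I.
Proof. by case: I => [|x I] //=; rewrite size_rcons last_rcons belast_rcons. Qed.

(** Passing to a deeper stage of the reduction only changes the arcs by elements
    invisible to the coefficients of the given length. *)
Lemma mu_stable I j n : size I <= n ->
  magnus (whom (phi L r n) (longitude L r j)) I = mu L r (rcons I j).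
Proof.
move=> In; rewrite mu_rcons; set s := size I in In *.
pose Q := magnus_rep s I; pose long k := value Q (whom (phi L r k) (longitude L r j)).
have entry k : magnus (whom (phi L r k) (longitude L r j)) I = long k ord0 ord_max.
  by rewrite (magnus_repE erefl) //= subword_all.
have : eqm (unitri_filtration s 0) s.+2 (long s) (long n).
  rewrite /long !value_whom; apply: value_eqm => a /=.
  exact: (@phi_stable_le _ L r _ (unitri_filtration s 0) (@unitri_layer_all s 0) Q _ _ a In).
move/eqm_unitri/(_ ord0 ord_max); rewrite /= add0n => /(_ (leqnSn _)).
by rewrite dvd0z subr_eq0 -!entry => /eqP.
Qed.

Lemma Delta_dvd_mu I K k : subseq I K -> 1 < size I < size K -> k < size I ->
  (Delta L r K %| mu L r (rot k I))%Z.
Proof.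
case/subseqP=> b sb ->; rewrite size_mask // => sI kI.
have sb' : size b == size K by apply/eqP.
apply: dvdz_trans (dvd_big_gcdz (i := Tuple sb') _ _ _) _ => //.
  by rewrite mem_index_enum.
pose F (k0 : 'I_(count id b)) := mu L r (rot k0 (mask b K)).
exact: (@dvd_big_gcdz _ xpredT F _ (Ordinal kI) (mem_index_enum _) isT).
Qed.

Lemma Delta_dvd_sub K K' : subseq K' K -> size K' < size K ->
  (Delta L r K %| Delta L r K')%Z.
Proof.
move=> sub sK; apply: big_gcdz_dvd => b /andP[b1 bK].
apply: big_gcdz_dvd => k _; apply: Delta_dvd_mu.
- exact: subseq_trans (mask_subseq _ _) sub.
- by rewrite size_mask ?size_tuple // b1 (ltn_trans bK).
- by rewrite size_mask ?size_tuple.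
Qed.

End Milnor.

Section Representation.
Variables (m : nat) (J : seq 'I_m) (j : 'I_m).
Local Notation n := (size J).
Local Notation K := (rcons J j).
Local Notation Q := (magnus_rep n J).
Local Notation subword := (subword J).
Implicit Types (i : 'I_m) (a b : 'I_n.+1).
Local Open Scope ring_scope.

Lemma subword_sub (a b : nat) : subseq (subword a b) J.
Proof. exact: subseq_trans (take_subseq _ _) (drop_subseq _ _). Qed.

Section Longitudes.
Variables (L : link_diagram m) (r : 'I_m -> nat).
Let Delta := Delta L r K.
Local Notation F := (unitri_filtration n Delta).
Let Lam i : unitri n := value Q (whom (phi L r n) (longitude L r i)).

Lemma longitude_entry i a b : (a <= b)%N -> Lam i a b = mu L r (rcons (subword a b) i).
Proof.
move=> ab; rewrite /Lam (magnus_repE erefl) // mu_stable //.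
have bn : (b <= n)%N by rewrite -ltnS.
by rewrite (size_subword erefl) // (leq_trans (leq_subr _ _) bn).
Qed.

(** Below the corner the entries are Milnor numbers of proper subsequences of
    [rcons J j]. *)
Lemma longitude_layer : F n (Lam j).
Proof.
move=> a b ban; have [ba|ab] := leqP b a.
  by have /is_unitriP -> := unitriP (Lam j) => //; rewrite mxE subrr dvdz0.
rewrite mxE -val_eqE (ltn_eqF ab) subr0 longitude_entry ?(ltnW ab) //.
have bn : (b <= n)%N by rewrite -ltnS.
rewrite -[rcons _ j]rot0; apply: Delta_dvd_mu; rewrite ?size_rcons //.
  by rewrite -!cats1 cat_subseq ?subword_sub.
by rewrite (size_subword erefl) //; lia.
Qed.

(** The two products differ at [(a, b)] by at most two terms: if [i] is the last
    letter of [subword a b], the Milnor number of [subword a b] itself, and if it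
    is the first letter, the Milnor number of [subword a b] with this letter
    moved to the end.  Both are among the numbers whose gcd is [Delta]. *)
Lemma longitude_commutes i : eqm F n.+1 (Q i ^ Lam i)%g (Q i).
Proof.
suff H : eqm F n.+1 (Q i * Lam i)%g (Lam i * Q i)%g.
  by have := eqmMl (Lam i)^-1%g H; rewrite mulKg.
apply/eqm_unitri => a b _; have [ba|ab] := ltnP b a.+2.
  have /cong_comm H := @unitri_layer_all n Delta (Lam i).
  by have := H (Q i) a b; rewrite addn2; apply.
set P := unitri_mx (Q i) - 1%:M; rewrite !val_mul.
have -> : unitri_mx (Q i) = P + 1%:M by rewrite subrK.
rewrite mulmxDl mulmxDr mulmx1 mul1mx; set X := P *m _; set Y := _ *m P.
rewrite (_ : _ - _ = Y a b - X a b); last by rewrite mxE [X in _ - X]mxE; ring.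
have bn : (b <= n)%N by rewrite -ltnS.
have sub : (size (subword a b) = b - a)%N by rewrite (size_subword erefl).
have good k : (k < 2)%N -> (Delta %| mu L r (rot k (subword a b)))%Z.
  move=> k2; apply: Delta_dvd_mu; rewrite ?size_rcons ?sub; last by lia.
    exact: subseq_trans (subword_sub _ _) (subseq_rcons _ _).
  by lia.
apply: rpredB; rewrite mxE; apply: rpred_sum => c _; rewrite magnus_rep_sub1.
  case: eqP => [cb|_]; last by rewrite mulr0 dvdz0.
  case: eqP => [sc|_]; last by rewrite mulr0 dvdz0.
  rewrite mulr1 longitude_entry; last by lia.
  have := good 0%N isT; rewrite rot0 -cats1 -sc -(@subword_cat _ _ _ erefl) //.
  by lia.
case: eqP => [ca|_]; last by rewrite mul0r dvdz0.
case: eqP => [sc|_]; last by rewrite mul0r dvdz0.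
rewrite mul1r longitude_entry; last by lia.
have := good 1%N isT; rewrite (@subword_cat _ _ _ erefl a c b) ?sc /= ?rot1_cons //.
by lia.
Qed.

End Longitudes.

(** In the product of [g^-1], [Q i - 1] and [g] the middle factor only steps over
    letters [i], and the outer ones move up. *)
Lemma conjugate_far (Delta : int) i x : conjugate (unitri_filtration n Delta) n (Q i) x ->
  forall a b, i \notin subword a b -> (Delta %| (unitri_mx x - 1%:M) a b)%Z.
Proof.
case=> g /eqm_unitri xE a b nab.
have := xE a b; rewrite addnS ltnS (leq_trans _ (leq_addl _ _)) => [|]; last by rewrite -ltnS.
move=> /(_ isT); suff -> : unitri_mx (Q i ^ g)%g a b = (1%:M : 'M[int]_n.+1) a b.
  by rewrite !mxE.
have -> : unitri_mx (Q i ^ g)%g =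
    unitri_mx g^-1%g *m ((unitri_mx (Q i) - 1%:M) *m unitri_mx g) + 1%:M.
  rewrite /conjg !val_mul mulmxBl mulmxBr mul1mx -[_ *m unitri_mx g in X in _ - X + _]val_mul.
  by rewrite mulVg val_one subrK.
rewrite mxE mxE big1 ?add0r // => c _; rewrite mxE mulr_sumr big1 // => d _.
rewrite magnus_rep_sub1; case: eqP => [dc|_]; last by rewrite mul0r mulr0.
case: eqP => [sc|_]; last by rewrite mul0r mulr0.
have [ca|ac] := ltnP c a; first by rewrite unitri_low // mul0r.
have [bd|db] := ltnP b d; first by rewrite (unitri_low g) // !mulr0.
case/negP: nab; rewrite (@subword_cat _ _ _ erefl a c b); last by lia.
by rewrite (@subword_cat _ _ _ erefl c d b) ?sc ?mem_cat ?mem_head ?orbT //; lia.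
Qed.

(** Conjugation is trivial modulo the second layer. *)
Lemma conjugate_near (Delta : int) i x : (0 < n)%N ->
  conjugate (unitri_filtration n Delta) n (Q i) x ->
  forall a b, b = a.+1 :> nat ->
  (Delta %| ((unitri_mx x - 1%:M) a b - (subword a b == [:: i])%:R))%Z.
Proof.
move=> n0 [g xE] a b ab.
have {}xE : eqm (unitri_filtration n Delta) 2 (Q i) x.
  have Fg : unitri_filtration n Delta 1 g by apply: unitri_layer_all.
  apply: eqm_trans (eqm_conj_layer _ Fg) _.
  exact: eqm_le xE.
have := magnus_rep_sub1 J i a b; rewrite ab eqxx /= => <-.
have := proj1 (eqm_unitri _ _ _ _) xE a b; rewrite ab addn2 leqnn => /(_ isT).
have subE (M : 'M[int]_n.+1) : (M - 1%:M) a b = M a b - (1%:M : 'M[int]_n.+1) a b.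
  by rewrite 2!mxE.
by rewrite !subE opprB addrA subrK.
Qed.

End Representation.

(** The induction step: [corner_entry] applied to the meridians at the other end of
    the concordance. *)
Lemma mu_concordance_step (m : nat) (L L' : link_diagram m) (r r' : 'I_m -> nat)
    (J : seq 'I_m) (j : 'I_m) : welded_concordant L L' -> (0 < size J)%N ->
  let Delta := Delta L r (rcons J j) in
  (forall I, (0 < size I < size J)%N -> subseq I J ->
     (Delta %| mu L' r' (rcons I j))%Z) ->
  (Delta %| (mu L' r' (rcons J j) - mu L r (rcons J j))%R)%Z.
Proof.
move=> concordant n0 Delta shorter; pose n := size J.
pose F := unitri_filtration n Delta; pose Q := magnus_rep n J.
have K1 : forall x, F 1%N x by apply: unitri_layer_all.
have [ty [rho [ty0 tyE transfer]]] := concordance_transfer concordant r r' j.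
pose chi := Coloring (crossing_color L r j n Q)
  (fun k => if insub k is Some i then base_color j Q i else 1%g).
have bE (i : 'I_m) : base chi i = base_color j Q i by rewrite /= valK.
have V : valid F (Q j) ty n (name_curves (@nat_of_ord m) (based_curve L r)) chi.
  exact: (@valid_of_longitudes _ L r _ F K1 j (Q j) ty _ ty0 n Q n0 erefl (@longitude_commutes _ J j L r) (@longitude_layer _ J j L r) chi erefl bE).
have [chi' [V' tw cj]] := transfer _ F (Q j) _ _ (@diag_coef n)
  (@diag_coefM n Delta) (@diag_coefP n Delta) K1 _ _ V.
have T := twist_longitude K1 ty0 V; have T' := twist_longitude K1 tyE V'.
have endE i : end_meridian j (Q j) (@nat_of_ord m) chi i = Q i.
  rewrite /end_meridian bE /base_color; case: eqP => //= ->.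
  by rewrite conjg1.
pose Q' i : unitri n := end_meridian j (Q j) rho chi' i.
have Q'E i : conjugate F n (Q i) (Q' i).
  rewrite /Q' /end_meridian; have [->|ij] /= := eqVneq i j.
    by exists (base chi' (rho j)); apply: eqm_refl.
  by have := cj i ij; rewrite bE /base_color (negPf ij).
have dE (x : unitri n) : diag_coef n (ord0, ord_max) x = x ord0 ord_max.
  by rewrite /diag_coef /= n0 eqxx.
have {tw} := tw (ord0, ord_max); rewrite !dE.
have corner (x y : unitri n) : eqm F n.+1 x y ->
    (Delta %| (y ord0 ord_max - x ord0 ord_max)%R)%Z.
  by move/eqm_unitri/(_ ord0 ord_max); apply.
have lamE : value (end_meridian j (Q j) (@nat_of_ord m) chi)
    (whom (phi L r n) (longitude L r j)) ord0 ord_max = mu L r (rcons J j).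
  have -> : value (end_meridian j (Q j) (@nat_of_ord m) chi)
    (whom (phi L r n) (longitude L r j)) = value Q (whom (phi L r n) (longitude L r j)).
    by elim: (whom _ _) => //= g w ->; rewrite endE.
  by rewrite (magnus_repE erefl) // subword_all // mu_stable.
have {T} := corner _ _ T; have {T'} := corner _ _ T'; rewrite lamE.
have : (Delta %| (value Q' (whom (phi L' r' n) (longitude L' r' j)) ord0 ord_max
    - mu L' r' (rcons J j))%R)%Z.
  rewrite value_substituted -(mu_stable L' r' j (leqnn n)).
  apply: (corner_entry erefl) => //.
  - by move=> i a b ba; rewrite !mxE; have /is_unitriP -> := unitriP (Q' i); rewrite ?subrr.
  - by move=> i a b; apply: conjugate_far.
  - by move=> i a b; apply: conjugate_near.
  - move=> I /andP[I0 In] sub; rewrite mu_stable; first by apply: shorter; rewrite // I0.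
    exact: ltnW.
rewrite -/Q'; set t := _ ord0 ord_max; set u := mu L' _ _; set v := mu L _ _.
set x := _ ord0 ord_max; set y := _ ord0 ord_max => H1 H2 H3 H4.
rewrite (_ : u - v = (x - y) + (t - x) - (t - u) - (v - y))%R; last by ring.
by apply: rpredB => //; apply: rpredB => //; apply: rpredD.
Qed.

Theorem theorem4p3p5 (m : nat) (L L' : link_diagram m)
  (hconc : welded_concordant L L') (r r' : 'I_m -> nat) (J : seq 'I_m)
  (hJ : 1 < size J) :
  (mu L r J = mu L' r' J %[mod Delta L r J])%Z.
Proof.
have [n] := ubnP (size J); elim: n J hJ => // n IH J.
case/lastP: J => // J j; rewrite size_rcons ltnS => J0 Jn.
apply/eqP; rewrite eqz_mod_dvd -opprB rpredN.
apply: mu_concordance_step => // I /andP[I0 IJ] sub.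
have subK : subseq (rcons I j) (rcons J j) by rewrite -!cats1 cat_subseq.
have sI : (size (rcons I j) < size (rcons J j))%N by rewrite !size_rcons.
have := IH (rcons I j); rewrite !size_rcons ltnS I0 => /(_ isT) H.
have /eqP := H (leq_ltn_trans IJ Jn).
rewrite eqz_mod_dvd => /(dvdz_trans (Delta_dvd_sub L r subK sI)) H'.
have := Delta_dvd_mu (k := 0) L r subK; rewrite rot0 !size_rcons !ltnS I0 IJ.
move=> /(_ isT isT) H0; rewrite -(subKr (mu L r (rcons I j)) (mu L' _ _)).
exact: rpredB.
Qed.
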